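(* Let $p$ be a prime and let $(S,\mathcal F)$ be a fusion system over a discrete $p$-toral group $S$. Then $\mathcal F$ is saturated if and only if the following two conditions hold. (a) If $P_1\le P_2\le P_3\le\cdots$ is an increasing sequence of subgroups of $S$ with $P_\infty=\bigcup_{n=1}^\infty P_n$, and $\varphi\in\operatorname{Hom}(P_\infty,S)$ is any homomorphism such that $\varphi|_{P_n}\in\operatorname{Hom}_{\mathcal F}(P_n,S)$ for all $n$, then $\varphi\in\operatorname{Hom}_{\mathcal F}(P_\infty,S)$. (b) There exists a set $\mathfrak X$ of elements of order $p$ in $S$ such that: (i) each $x\in S$ of order $p$ is $\mathcal F$-conjugate to some $y\in\mathfrak X$; (ii) if $x,y$ are $\mathcal F$-conjugate and $y\in\mathfrak X$, then there is some morphism $\rho\in\operatorname{Hom}_{\mathcal F}(C_S(x),C_S(y))$ such that $\rho(x)=y$; and (iii) for each $x\in\mathfrak X$, $C_{\mathcal F}(x)$ is a saturated fusion system over $C_S(x)$.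
   Context: $\mathbb{Z}/p^\infty=\bigcup_n\mathbb{Z}/p^n$. A discrete $p$-toral group is a group $S$ with a normal subgroup $T\cong(\mathbb{Z}/p^\infty)^r$ (its maximal torus) of finite $p$-power index; its order is the pair $|S|=(r,|S/T|)$, ordered lexicographically. A fusion system $\mathcal F$ over $S$ is a category whose objects are all subgroups of $S$, with $\operatorname{Hom}_S(P,Q)\subseteq\operatorname{Hom}_{\mathcal F}(P,Q)\subseteq\operatorname{Inj}(P,Q)$ ($\operatorname{Hom}_S$: homomorphisms induced by conjugation by elements of $S$), such that each morphism is an $\mathcal F$-isomorphism followed by an inclusion. $P^{\mathcal F}$ is the set of subgroups isomorphic in $\mathcal F$ ($\mathcal F$-conjugate) to $P$; elements $x,y\in S$ are $\mathcal F$-conjugate if some morphism in $\mathcal F$ from $\langle x\rangle$ to $\langle y\rangle$ sends $x$ to $y$. $\operatorname{Out}_{\mathcal F}(P)=\operatorname{Aut}_{\mathcal F}(P)/\operatorname{Inn}(P)$; $\operatorname{Aut}_S(P)$ and $\operatorname{Out}_S(P)$ are the (outer) automorphisms induced by $N_S(P)$. $P$ is fully centralized (fully normalized) if $|C_S(P)|\ge|C_S(P')|$ (resp. $|N_S(P)|\ge|N_S(P')|$) for all $P'\in P^{\mathcal F}$. $\mathcal F$ is saturated if: (I) each fully normalized $P\le S$ is fully centralized, $\operatorname{Out}_{\mathcal F}(P)$ is finite and $\operatorname{Out}_S(P)\in\operatorname{Syl}_p(\operatorname{Out}_{\mathcal F}(P))$; (II) if $\varphi\in\operatorname{Hom}_{\mathcal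 F}(P,S)$ and $\varphi(P)$ is fully centralized, then $\varphi$ extends to some $\widetilde\varphi\in\operatorname{Hom}_{\mathcal F}(N_\varphi,S)$, where $N_\varphi=\{g\in N_S(P):\varphi c_g\varphi^{-1}\in\operatorname{Aut}_S(\varphi(P))\}$; (III) condition (a) of the claim. For $x\in S$, $C_{\mathcal F}(x)$ is the fusion system over $C_S(x)$ in which $\operatorname{Hom}_{C_{\mathcal F}(x)}(P,Q)$ consists of the $\varphi\in\operatorname{Hom}_{\mathcal F}(P,Q)$ that extend to some $\overline\varphi\in\operatorname{Hom}_{\mathcal F}(P\langle x\rangle,Q\langle x\rangle)$ with $\overline\varphi(x)=x$. *)

(* Defs.v *)
From HB Require Import structures.
From mathcomp Require Import all_boot all_order all_algebra algC.
From mathcomp Require Import finmap boolp classical_sets functions cardinality.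

Set Implicit Arguments.
Unset Strict Implicit.
Unset Printing Implicit Defensive.

Import Algebra.

Local Open Scope classical_set_scope.
Local Open Scope group_scope.

(* Groups need not be finite. A group is a subgroup, given as a classical set, *)
(* of an ambient groupType; taking the set to be setT gives the ambient group. *)

Section Groups.
Variable gT : groupType.
Implicit Types (x y g : gT) (A H N P Q S T : set gT) (f : gT -> gT).

Definition subgroup H : Prop := H 1 /\ forall x y, H x -> H y -> H (x / y).

Definition subgroup_of S P : Prop := subgroup P /\ P `<=` S.

Definition generated A : set gT := smallest subgroup A.

Definition cyclic_gen x : set gT := generated [set x].

(* c_g(x) = g x g^-1; note that MathComp's x ^ g is g^-1 x g. *)
Definition cj g x : gT := x ^ g^-1.

Definition centralizer S P : set gT :=
  [set g | S g /\ forall x, P x -> g * x = x * g].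

Definition normalizer S P : set gT := [set g | S g /\ cj g @` P = P].

Definition normal_in T S : Prop := T `<=` S /\ forall g, S g -> cj g @` T = T.

Definition left_cosets S T : set (set gT) := [set [set g * t | t in T] | g in S].

Definition has_order x (n : nat) : Prop :=
  [/\ (0 < n)%N, x ^+ n = 1 & forall m : nat, (0 < m < n)%N -> x ^+ m <> 1].

(* A homomorphism with domain P is represented by a total function gT -> gT   *)
(* of which only the values on P are relevant.                                *)
Definition homomorphism P Q f : Prop :=
  f @` P `<=` Q /\ {in P &, {morph f : x y / x * y}}.

Definition inj_hom P Q f : Prop := homomorphism P Q f /\ {in P &, injective f}.

End Groups.

(* Cardinality of a finite set; it is 0 when A is infinite. *)
Definition ncard (T : choiceType) (A : set T) : nat := #|` fset_set A|%fset.

(* Z/p^oo, as the union of the groups of p^n-th roots of unity. *)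
Definition Zpinfty (p : nat) : set algC :=
  [set z | exists n : nat, (z ^+ (p ^ n) = 1)%R].

Section DiscretePToral.
Variables (p : nat) (gT : groupType).
Implicit Types (P S T : set gT).

Definition torus (r : nat) T : Prop :=
  exists f : gT -> {ffun 'I_r -> algC},
    (forall x y, T x -> T y -> forall i, (f (x * y)%g i = f x i * f y i)%R) /\
    set_bij T [set v | forall i, Zpinfty p (v i)] f.

Definition maximal_torus (r : nat) S T : Prop :=
  [/\ subgroup T, normal_in T S, torus r T, finite_set (left_cosets S T)
    & exists k : nat, ncard (left_cosets S T) = (p ^ k)%N].

Definition discrete_p_toral S : Prop :=
  subgroup S /\ exists r T, maximal_torus r S T.

(* The default value (0, 0) is never used for subgroups of a discrete p-toral *)
(* group, which are again discrete p-toral.                                   *)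
Definition toral_order S : nat * nat :=
  xget (0, 0)%N [set o : nat * nat | exists T : set gT,
                   maximal_torus o.1 S T /\ o.2 = ncard (left_cosets S T)].

Definition toral_order_le P S : bool :=
  ((toral_order P : nat *l nat) <= (toral_order S : nat *l nat))%O.

End DiscretePToral.

Section FusionSystems.
Variable gT : groupType.
Implicit Types (x y g : gT) (P Q R S : set gT) (f h : gT -> gT).

(* F P Q f means that the restriction of f to P is a morphism from P to Q. *)
Definition hom_family := set gT -> set gT -> set (gT -> gT).

Implicit Types F : hom_family.

Definition HomS S : hom_family := fun P Q => [set f : gT -> gT |
  exists2 s, S s & cj s @` P `<=` Q /\ {in P, f =1 cj s}].

Definition isoF F P Q f : Prop :=
  F P Q f /\ exists2 h, F Q P h & {in P, cancel f h} /\ {in Q, cancel h f}.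

(* Identities and inclusions are provided by fusion_conj, with s = 1. *)
Record fusion_system S F : Prop := FusionSystem {
  fusion_obj : forall P Q f,
    F P Q f -> subgroup_of S P /\ subgroup_of S Q;
  fusion_ext : forall P Q f h, {in P, f =1 h} -> F P Q f -> F P Q h;
  fusion_comp : forall P Q R f h, F P Q f -> F Q R h -> F P R (h \o f);
  fusion_conj : forall P Q, subgroup_of S P -> subgroup_of S Q ->
    HomS S P Q `<=` F P Q;
  fusion_inj : forall P Q f, F P Q f -> inj_hom P Q f;
  fusion_factor : forall P Q f, F P Q f -> isoF F P (f @` P) f
}.

Definition conj_class F P : set (set gT) := [set Q | exists f, isoF F P Q f].

Definition conj_elts S F x y : Prop :=
  [/\ S x, S y & exists2 f, F (cyclic_gen x) (cyclic_gen y) f & f x = y].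

Definition AutF F P : set (gT -> gT) := [set f : gT -> gT | isoF F P P f].

Definition AutS S P : set (gT -> gT) :=
  [set f : gT -> gT | exists2 g, normalizer S P g & {in P, f =1 cj g}].

(* The coset Inn(P) f, a set of functions closed under agreement on P. *)
Definition out_class P f : set (gT -> gT) :=
  [set h : gT -> gT | exists2 g, P g & {in P, h =1 cj g \o f}].

Definition OutF F P : set (set (gT -> gT)) := out_class P @` AutF F P.

Definition OutS S P : set (set (gT -> gT)) := out_class P @` AutS S P.

(* For B a subgroup of a finite group A, as OutS S P is of OutF F P. *)
Definition is_Sylow (T : choiceType) (p : nat) (A B : set T) : Prop :=
  [/\ B `<=` A, p.-nat (ncard B) & p^'.-nat (ncard A %/ ncard B)%N].

Definition fully_centralized p S F P : Prop := forall Q, conj_class F P Q ->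
  toral_order_le p (centralizer S Q) (centralizer S P).

Definition fully_normalized p S F P : Prop := forall Q, conj_class F P Q ->
  toral_order_le p (normalizer S Q) (normalizer S P).

(* N_f, with the inverse of f : P -> f(P) given by 'pinv_(fun=> 1) P f. *)
Definition N_phi S P f : set gT :=
  [set g | normalizer S P g /\
           AutS S (f @` P) (f \o cj g \o 'pinv_(fun=> 1) P f)].

Definition saturation_I p S F : Prop :=
  forall P, subgroup_of S P -> fully_normalized p S F P ->
    [/\ fully_centralized p S F P, finite_set (OutF F P)
      & is_Sylow p (OutF F P) (OutS S P)].

Definition saturation_II p S F : Prop :=
  forall P f, F P S f -> fully_centralized p S F (f @` P) ->
    exists2 h, F (N_phi S P f) S h & {in P, h =1 f}.

Definition saturation_III S F : Prop :=
  forall (P : nat -> set gT) f,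
    (forall n, subgroup_of S (P n)) -> (forall n, P n `<=` P n.+1) ->
    homomorphism (\bigcup_n P n) S f -> (forall n, F (P n) S f) ->
    F (\bigcup_n P n) S f.

Definition saturated p S F : Prop :=
  [/\ saturation_I p S F, saturation_II p S F & saturation_III S F].

(* C_S(x) is centralizer S [set x]. For P <= C_S(x) the product P <x> is the  *)
(* subgroup generated by P and x.                                             *)
Definition adjoin P x : set gT := generated (P `|` [set x]).

Definition C_fusion S F x : hom_family := fun P Q => [set f : gT -> gT |
  [/\ subgroup_of (centralizer S [set x]) P,
      subgroup_of (centralizer S [set x]) Q,
      F P Q f
    & exists2 h, F (adjoin P x) (adjoin Q x) h & {in P, h =1 f} /\ h x = x]].

End FusionSystems.

(* Main.v *)
From mathcomp Require Import all_boot all_order all_algebra algC.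
From mathcomp Require Import all_fingroup all_solvable finmap cyclotomic.
From mathcomp Require Import boolp classical_sets functions cardinality.
Require Import Defs.

(* Suppose (a) and (b). The center of a subgroup P <> 1 has finitely many     *)
(* elements of order p, and any p-group of automorphisms of P containing      *)
(* Inn(P) fixes one of them, x. By (b), C_S(x) can be moved into C_S(y) with  *)
(* y in X, and there P is governed by the saturated system C_F(y). For axiom  *)
(* (I), take x fixed by a Sylow subgroup of Out_F(P) above Out_S(P): its      *)
(* image lies in the stabilizer of y, in which Out_S(P) is Sylow. That        *)
(* Out_F(P) is finite follows first, from an x fixed by N_S(P), since the     *)
(* stabilizer of y has finite index. For (II), take x fixed by N_phi and its  *)
(* image under phi, move both to the same y, and extend inside C_F(y).        *)
(*                                                                            *)
(* Conversely, let X be the elements x of order p with <x> fully centralized. *)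
(* Axiom (II) gives (ii), and the axioms for C_F(x) are obtained from those   *)
(* of F by passing from P to P<x>; the p-part of (I) compares the             *)
(* automorphisms of P<x> fixing x and P with a Sylow subgroup of              *)
(* Out_F(P<x>). This uses that every class has a fully normalized member,     *)
(* that is, that the index of the maximal torus in N_S(Q) is bounded when Q   *)
(* runs over a conjugacy class.                                               *)

Set Implicit Arguments.
Unset Strict Implicit.
Unset Printing Implicit Defensive.

Import Algebra.

Local Open Scope classical_set_scope.
Local Open Scope group_scope.

(** * Subgroups of a group type *)

(** Two facts about discrete $p$-toral groups carry both directions. The first is rigidity: an
    injective homomorphism never lowers the order, and one between groups of equal order is onto
    ([toral_order_embedding]). Indeed a divisible subgroup lies in every subgroup of finite index,
    so tori go to tori, and the rank of a torus is read off its $p$-torsion. The second is that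
    $\Omega_1(Z(P))$ is finite, and nontrivial if $P$ is, so that a $p$-group acting on it fixes an
    element of order $p$ ([omega_center_fixpoint], [outer_p_fixpoint]).

    From (a) and (b) to saturation: a fixed $x\in\Omega_1(Z(P))$ is moved to some $y\in\mathfrak X$
    by a morphism defined on all of $C_S(x)$. If $P$ is fully normalized, rigidity makes this
    morphism carry $N_S(P)$ onto the normalizer of the image ([push_center]), and the image is fully
    normalized in $C_{\mathcal F}(y)$. For (I), the stabilizer of $x$ in
    $\operatorname{Out}_{\mathcal F}(P)$ contains a Sylow subgroup above $\operatorname{Out}_S(P)$
    and corresponds to the outer automorphisms in $C_{\mathcal F}(y)$, where
    $\operatorname{Out}_S(P)$ is already Sylow ([saturation_I_of_centralizers]). For (II), the
    extension is made in $C_{\mathcal F}(y)$; rigidity applied to $C_S(\varphi(P))$ shows that it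
    can be pulled back to $C_S(\varphi(x))$ ([saturation_II_of_centralizers]).

    From saturation to (b): for $P\le C_S(x)$ the group $P\langle x\rangle$ carries all the data,
    since morphisms of $C_{\mathcal F}(x)$ are restrictions of $\mathcal F$-morphisms of $P\langle
    x\rangle$ fixing $x$, and both groups have the same centralizer in $C_S(x)$. So (II) and (III)
    are obtained by extending or gluing over $P\langle x\rangle$. For (I), $P\langle x\rangle$ is
    moved to a fully normalized $Q$ in such a way that a Sylow subgroup of the stabilizer of $x$ and
    $P$ becomes induced by $S$. The move extends over $N_{C_S(x)}(P)$, and rigidity makes the
    extension onto, so that this Sylow subgroup is induced by $C_S(x)$ ([C_fusion_saturation_I]).
    That $Q$ exists needs [normalizer_order_bound], as below a given order there may be infinitely
    many others. *)

Definition multiplicative_on (gT : groupType) (P : set gT) (f : gT -> gT) :=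
  forall x y, P x -> P y -> f (x * y) = f x * f y.

Definition injective_on (aT rT : Type) (P : set aT) (f : aT -> rT) :=
  forall x y, P x -> P y -> f x = f y -> x = y.

Section Subgroups.
Variable gT : groupType.
Implicit Types (x y g h : gT) (A H N P Q S T : set gT) (f : gT -> gT).

Lemma inj_homP P Q f :
  inj_hom P Q f <->
  [/\ forall x, P x -> Q (f x), multiplicative_on P f & injective_on P f].
Proof.
split=> [[[im fM] fI]|[im fM fI]].
  split=> [x Px|x y Px Py|x y Px Py]; first by apply: im; exists x.
    by apply: fM; apply/mem_set.
  by apply: fI; apply/mem_set.
split; first split.
- by move=> _ [x Px <-]; apply: im.
- by move=> x y /set_mem Px /set_mem Py; apply: fM.
- by move=> x y /set_mem Px /set_mem Py; apply: fI.
Qed.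

Lemma subgroup1 H : subgroup H -> H 1. Proof. by case. Qed.

Lemma subgroupV H x : subgroup H -> H x -> H x^-1.
Proof. by move=> [H1 HF] Hx; rewrite -[x^-1]mul1g; apply: HF. Qed.

Lemma subgroupM H x y : subgroup H -> H x -> H y -> H (x * y).
Proof.
by move=> sH Hx Hy; rewrite -[y]invgK; apply: sH.2 => //; apply: subgroupV.
Qed.

Lemma subgroupX H x n : subgroup H -> H x -> H (x ^+ n).
Proof.
move=> sH Hx; elim: n => [|n IH]; first exact: subgroup1.
by rewrite expgS; apply: subgroupM.
Qed.

Lemma subgroupI H K : subgroup H -> subgroup K -> subgroup (H `&` K).
Proof.
move=> sH sK; split; first by split; apply: subgroup1.
by move=> x y [Hx Kx] [Hy Ky]; split; [apply: sH.2|apply: sK.2].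
Qed.

Lemma cjE g x : cj g x = g * x * g^-1.
Proof. by rewrite /cj conjgE invgK mulgA. Qed.

Lemma cj1 x : cj 1 x = x. Proof. by rewrite /cj invg1 conjg1. Qed.

Lemma cj_1 g : cj g 1 = 1. Proof. by rewrite /cj conj1g. Qed.

Lemma cj_comp g h x : cj (g * h) x = cj g (cj h x).
Proof. by rewrite /cj invgM conjgM. Qed.

Lemma cjM g x y : cj g (x * y) = cj g x * cj g y.
Proof. exact: conjMg. Qed.

Lemma cjX g x n : cj g (x ^+ n) = cj g x ^+ n.
Proof. exact: conjXg. Qed.

Lemma cjK g : cancel (cj g) (cj g^-1).
Proof. by move=> x; rewrite -cj_comp mulVg cj1. Qed.

Lemma cjVK g : cancel (cj g^-1) (cj g).
Proof. by move=> x; rewrite -cj_comp mulgV cj1. Qed.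

Lemma cj_inj g : injective (cj g). Proof. exact: can_inj (cjK g). Qed.

Lemma subgroup_cj H g x : subgroup H -> H g -> H x -> H (cj g x).
Proof.
move=> sH Hg Hx; rewrite cjE; apply: sH.2 => //.
exact: subgroupM.
Qed.

Lemma cj_fixP g x : cj g x = x <-> g * x = x * g.
Proof.
rewrite cjE; split=> [e|->]; last by rewrite mulgK.
by rewrite -{2}e mulgVK.
Qed.

Lemma multiplicative_on1 P f : subgroup P -> multiplicative_on P f -> f 1 = 1.
Proof.
move=> sP fM; by apply: (@mulgI _ (f 1)); rewrite -fM ?mulg1 //; apply: subgroup1.
Qed.

Lemma multiplicative_onV P f x :
  subgroup P -> multiplicative_on P f -> P x -> f x^-1 = (f x)^-1.
Proof.
move=> sP fM Px; apply: (@mulgI _ (f x)); rewrite mulgV -fM ?mulgV //.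
  exact: (multiplicative_on1 sP fM).
exact: subgroupV.
Qed.

Lemma multiplicative_onX P f x n :
  subgroup P -> multiplicative_on P f -> P x -> f (x ^+ n) = f x ^+ n.
Proof.
move=> sP fM Px; elim: n => [|n IH]; first exact: (multiplicative_on1 sP fM).
by rewrite !expgS fM // ?IH //; apply: subgroupX.
Qed.

Lemma multiplicative_on_cj P f g x : subgroup P -> multiplicative_on P f ->
  P g -> P x -> f (cj g x) = cj (f g) (f x).
Proof.
move=> sP fM Pg Px; have PV := subgroupV sP Pg.
have PM := subgroupM sP Pg Px.
by rewrite !cjE fM // fM // (multiplicative_onV sP fM).
Qed.

Lemma subgroup_image P f :
  subgroup P -> multiplicative_on P f -> subgroup (f @` P).
Proof.
move=> sP fM; split; first by exists 1; [apply: subgroup1|apply: (multiplicative_on1 sP)].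
move=> _ _ [x Px <-] [y Py <-]; exists (x * y^-1); first exact: sP.2.
by rewrite fM ?(multiplicative_onV sP fM) //; apply: subgroupV.
Qed.

Lemma cj_imageP g P : cj g @` P = P <-> forall x, P x <-> P (cj g x).
Proof.
split=> [e x|e].
  split=> [Px|]; first by rewrite -e; exists x.
  by rewrite -{1}e => -[y Py /cj_inj <-].
apply/seteqP; split=> [_ [x /e Px <-] //|x Px].
by exists (cj g^-1 x); [apply/e; rewrite cjVK|rewrite cjVK].
Qed.

Lemma normalizerP S P g :
  normalizer S P g <-> S g /\ forall x, P x <-> P (cj g x).
Proof. by rewrite /normalizer /=; split=> -[Sg /cj_imageP]. Qed.

Lemma normalizer_sub S P g : normalizer S P g -> S g.
Proof. by case. Qed.

Lemma normalizer_cj S P g x : normalizer S P g -> P x -> P (cj g x).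
Proof. by move=> /normalizerP[_ e] /e. Qed.

Lemma subgroup_centralizer S P : subgroup S -> subgroup (centralizer S P).
Proof.
move=> sS; split; first by split=> [|x _]; [apply: subgroup1|rewrite mulg1 mul1g].
move=> x y [Sx cx] [Sy cy]; split; first exact: sS.2.
move=> z Pz; have {}cx := cx z Pz; have {}cy := cy z Pz.
rewrite -mulgA; have -> : y^-1 * z = z * y^-1.
  by apply: (@mulgI _ y); rewrite mulVKg mulgA cy mulgK.
by rewrite !mulgA cx.
Qed.

Lemma subgroup_normalizer S P : subgroup S -> subgroup (normalizer S P).
Proof.
move=> sS; split.
  by apply/normalizerP; split=> [|x]; [apply: subgroup1|rewrite cj1].
move=> x y /normalizerP[Sx nx] /normalizerP[Sy ny]; apply/normalizerP.
split=> [|z]; first exact: sS.2.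
rewrite cj_comp; apply: iff_trans (nx _).
by rewrite (ny (cj y^-1 z)) cjVK.
Qed.

Lemma subgroup_normalizer_self S P g :
  subgroup P -> P `<=` S -> P g -> normalizer S P g.
Proof.
move=> sP PS Pg; apply/normalizerP; split=> [|x]; first exact: PS.
split=> [|H]; first exact: subgroup_cj.
by rewrite -[x](cjK g); apply: subgroup_cj => //; apply: subgroupV.
Qed.

Lemma centralizer_normalizer S P : centralizer S P `<=` normalizer S P.
Proof.
move=> g [Sg cg]; apply/normalizerP; split=> // x.
split=> [Px|Px].
  by have /cj_fixP -> := cg x Px.
have /cj_fixP e := cg _ Px.
by have /cj_inj -> := esym e.
Qed.

Lemma centralizer_sub S P : centralizer S P `<=` S. Proof. by move=> g []. Qed.

Lemma generated_subgroup A : subgroup (generated A).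
Proof.
split; first by move=> H /= [[]].
by move=> x y Hx Hy H /= HA; apply: HA.1.2; [apply: Hx|apply: Hy].
Qed.

Lemma generated_sub A H : subgroup H -> A `<=` H -> generated A `<=` H.
Proof. by move=> sH AH; apply: smallest_sub. Qed.

Lemma sub_generated A : A `<=` generated A.
Proof. exact: sub_gen_smallest. Qed.

Lemma expg_mod x n k : x ^+ n = 1 -> x ^+ k = x ^+ (k %% n).
Proof.
move=> xn; rewrite {1}(divn_eq k n) expgnDr mulnC expgnA xn expg1n.
by rewrite mul1g.
Qed.

(** Inverses are natural powers, so the elements of a finite cyclic group need no integer
    exponents. *)
Lemma expg_inv x n k : (0 < n)%N -> x ^+ n = 1 -> (x ^+ k)^-1 = x ^+ (k * n.-1).
Proof.
move=> n0 xn; apply: mulg1_eq.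
by rewrite -expgnDr -mulnS prednK // mulnC expgnA xn expg1n.
Qed.

Lemma cyclic_genP x n z : (0 < n)%N -> x ^+ n = 1 ->
  cyclic_gen x z <-> exists k, z = x ^+ k.
Proof.
move=> n0 xn; split=> [|[k ->]]; last first.
  apply: (@subgroupX (cyclic_gen x)); first exact: generated_subgroup.
  exact: sub_generated.
have sub : subgroup [set z | exists k, z = x ^+ k].
  split; first by exists 0%N.
  move=> _ _ [i ->] [j ->]; exists (i + j * n.-1)%N.
  by rewrite expgnDr (expg_inv _ n0 xn).
by apply: (generated_sub sub) => y ->; exists 1%N.
Qed.

Lemma sub_adjoin P x : P `<=` adjoin P x.
Proof. by move=> y Py; apply: sub_generated; left. Qed.

Lemma mem_adjoin P x : adjoin P x x.
Proof. by apply: sub_generated; right. Qed.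

Lemma subgroup_adjoin P x : subgroup (adjoin P x).
Proof. exact: generated_subgroup. Qed.

Lemma adjoin_sub P x H : subgroup H -> P `<=` H -> H x -> adjoin P x `<=` H.
Proof. by move=> sH PH Hx; apply: generated_sub => // y [/PH//|->]. Qed.

(** As $x$ commutes with $P$, the products $yx^k$ are closed under division. *)
Lemma adjoinP P x n z : subgroup P -> (forall y, P y -> y * x = x * y) ->
  (0 < n)%N -> x ^+ n = 1 ->
  adjoin P x z <-> exists2 y, P y & exists k, z = y * x ^+ k.
Proof.
move=> sP cx n0 xn; split=> [|[y Py [k ->]]]; last first.
  apply: (@subgroupM (adjoin P x)); first exact: subgroup_adjoin.
    exact: sub_adjoin.
  apply: (@subgroupX (adjoin P x)); first exact: subgroup_adjoin.
  exact: mem_adjoin.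
have cX y k : P y -> x ^+ k * y = y * x ^+ k.
  by move=> Py; apply/commute_sym/commuteX/cx.
suff sub : subgroup [set z | exists2 y, P y & exists k, z = y * x ^+ k].
  apply: (generated_sub sub) => y [Py|->].
    by exists y => //; exists 0%N; rewrite mulg1.
  by exists 1; [apply: subgroup1|exists 1%N; rewrite mul1g].
split; first by exists 1; [apply: subgroup1|exists 0%N; rewrite mulg1].
move=> _ _ [y Py [i ->]] [z' Pz [j ->]]; exists (y * z'^-1); first exact: sP.2.
exists (i + j * n.-1)%N; rewrite expgnDr -(expg_inv _ n0 xn) invgM.
have e : x ^+ i * (x ^+ j)^-1 * z'^-1 = z'^-1 * (x ^+ i * (x ^+ j)^-1).
  by rewrite (expg_inv _ n0 xn) -expgnDr cX //; apply: subgroupV.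
by rewrite -[LHS]mulgA (mulgA (x ^+ i)) e !mulgA.
Qed.

End Subgroups.

(** * Actions of p-groups on finite sets *)

Section Cardinals.
Variables T U : choiceType.
Implicit Types (A B : set T) (C : set U) (f : T -> U).

Lemma ncard_le A B : finite_set B -> A `<=` B -> (ncard A <= ncard B)%N.
Proof.
move=> fB AB; have fA := sub_finite_set AB fB.
by move: AB; rewrite fset_set_sub // => /fsubset_leq_card.
Qed.

Lemma ncard_le_eq A B :
  finite_set B -> A `<=` B -> (ncard B <= ncard A)%N -> A = B.
Proof.
move=> fB AB le; have fA := sub_finite_set AB fB.
apply: fset_set_inj => //; apply/eqP; rewrite eqEfcard.
by move: AB; rewrite fset_set_sub // => ->.
Qed.

Lemma ncard_image A f :
  finite_set A -> injective_on A f -> ncard (f @` A) = ncard A.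
Proof.
move=> fA fI; rewrite /ncard fset_set_image // card_in_imfset //= => x y.
by rewrite !in_fset_set // => /set_mem Ax /set_mem Ay; apply: fI.
Qed.

Lemma ncard_image_le A f : finite_set A -> (ncard (f @` A) <= ncard A)%N.
Proof.
by move=> fA; rewrite /ncard fset_set_image //; apply: leq_imfset_card.
Qed.

Lemma ncard_gt0 A x : finite_set A -> A x -> (0 < ncard A)%N.
Proof.
move=> fA Ax; rewrite /ncard cardfs_gt0; apply/fset0Pn; exists x.
by rewrite in_fset_set // inE.
Qed.

Lemma injective_finite A C f : finite_set C -> f @` A `<=` C ->
  injective_on A f -> finite_set A.
Proof.
move=> fC fAC fI.
have <- : finite_set (f @` A) = finite_set A.
  apply/eq_finite_set/inj_card_eq => x y /set_mem Ax /set_mem Ay.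
  exact: fI.
exact: sub_finite_set fAC fC.
Qed.

End Cardinals.

Section FiniteActions.
Variables (p : nat) (gT : groupType) (U : choiceType).
Variables (H : set gT) (X : set U) (act : gT -> U -> U).
Hypotheses (p_pr : prime p) (sH : subgroup H).
Hypothesis (pH : forall h, H h -> exists n, h ^+ (p ^ n) = 1).
Hypotheses (fX : finite_set X) (actX : forall h x, H h -> X x -> X (act h x)).
Hypothesis actM : forall g h x,
  H g -> H h -> X x -> act (g * h) x = act g (act h x).
Hypothesis act1 : forall x, X x -> act 1 x = x.

Let sT : finType := fset_set X.

Let valX (u : sT) : X (val u).
Proof. by apply/set_mem; rewrite -in_fset_set //; apply: valP. Qed.

Let lift x (Xx : X x) : {u : sT | val u = x}.
Proof.
have Xx' : x \in fset_set X by rewrite in_fset_set // mem_set.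
by exists [` Xx']%fset.
Qed.

Let perm_ex h : H h -> exists s : {perm sT}, forall u, val (s u) = act h (val u).
Proof.
move=> Hh; pose f u := sval (lift (actX Hh (valX u))).
have fE u : val (f u) = act h (val u) by rewrite /f; case: (lift _).
have fI : injective f.
  move=> u v /(congr1 val); rewrite !fE => /(congr1 (act h^-1)).
  have HV := subgroupV sH Hh; have XX := valX.
  by rewrite -!actM // mulVg !act1 // => /val_inj.
by exists (perm fI) => u; rewrite permE.
Qed.

(** The image of [H] in the symmetric group of [X]. It is finite even when [H] is not, so finite
    group theory applies to it. *)
Let W : {set {perm sT}} :=
  [set s : {perm sT} | `[< exists2 h, H h & forall u, val (s u) = act h (val u) >]]%SET.

Let group_set_W : group_set W.
Proof.
apply/group_setP; split.
  rewrite inE; apply/asboolP; exists 1; first exact: subgroup1.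
  by move=> u; rewrite perm1 act1.
move=> s t; rewrite !inE => -[g Hg gE] [h Hh hE].
exists (h * g); first exact: subgroupM.
by move=> u; rewrite permM hE gE actM.
Qed.

Let WG : {group {perm sT}} := Group group_set_W.

Let actXn h (s : {perm sT}) : H h -> (forall u, val (s u) = act h (val u)) ->
  forall k u, val ((s ^+ k) u) = act (h ^+ k) (val u).
Proof.
move=> Hh hE; elim=> [|k IH] u; first by rewrite expg0 perm1 act1.
by rewrite expgS permM IH hE -actM // ?expgSr //; apply: subgroupX.
Qed.

(** By Cauchy, a prime dividing the order of the image is the order of a permutation induced by some
    [h], and [h] has $p$-power order. *)
Let pgroupW : p.-group WG.
Proof.
apply/pgroupP => q q_pr q_dvd; have [s] := Cauchy q_pr q_dvd.
rewrite inE => /asboolP[h Hh hE] so; have [n hn] := pH Hh.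
have : (s ^+ (p ^ n) = 1)%g.
  by apply/permP => u; apply: val_inj; rewrite (actXn Hh hE) hn act1 // perm1.
move/eqP; rewrite -order_dvdn so Euclid_dvdX // => /andP[qp _].
by rewrite inE -(dvdn_prime2 q_pr p_pr).
Qed.

Let WP h u : H h -> exists2 s, s \in WG & val (s u) = act h (val u).
Proof.
move=> Hh; have [s sE] := perm_ex Hh.
by exists s => //; rewrite inE; apply/asboolP; exists h.
Qed.

Let card_sT : #|[set: sT]%SET| = ncard X.
Proof. by rewrite cardsT -cardfE. Qed.

(** The number of fixed points is congruent to [ncard X] modulo $p$, hence divisible by $p$. It is
    positive because of [x0], so it exceeds one. *)
Lemma pgroup_fixpoint x0 : (p %| ncard X)%N -> X x0 ->
  (forall h, H h -> act h x0 = x0) ->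
  exists x, [/\ X x, x <> x0 & forall h, H h -> act h x = x].
Proof.
move=> pX Xx0 fix0; have [u0 u0E] := lift Xx0.
have fixP u : reflect (forall h, H h -> act h (val u) = val u)
    (u \in 'Fix_([set: sT]%SET | 'P)(WG)).
  rewrite inE inE /=; apply: (iffP afixP) => [fu h Hh|fu s].
    by have [s sW <-] := WP u Hh; rewrite -[s u]/(aperm u s) fu.
  rewrite inE => /asboolP[h Hh hE]; apply: val_inj.
  by rewrite /= /aperm hE fu.
have u0F : u0 \in 'Fix_([set: sT]%SET | 'P)(WG) by apply/fixP; rewrite u0E.
have acts : [acts WG, on [set: sT]%SET | 'P] by apply/actsP => s _ u; rewrite !inE.
have := pgroup_fix_mod pgroupW acts; rewrite card_sT.
move/eqP; rewrite (eqP (pX : ncard X %% p == 0)) eq_sym => pF.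
have : (1 < #|'Fix_([set: sT]%SET | 'P)(WG)|)%N.
  rewrite ltn_neqAle card_gt0; apply/andP; split; last by apply/set0Pn; exists u0.
  by apply: contraTneq pF => <-; rewrite modn_small ?prime_gt1.
case/card_gt1P => u [v [uF vF uv]].
have [/eqP ue|nu] := eqVneq u u0.
  exists (val v); split; [exact: valX|move=> ve|exact/fixP].
  by case/negP: uv; rewrite (eqP ue); apply/eqP/val_inj; rewrite u0E -ve.
exists (val u); split; [exact: valX|move=> ve|exact/fixP].
by case/negP: nu; apply/eqP/val_inj; rewrite u0E.
Qed.

Lemma pgroup_transitive x0 : X x0 ->
  (forall x, X x -> exists2 h, H h & act h x0 = x) -> exists k, ncard X = (p ^ k)%N.
Proof.
move=> Xx0 tr; have [u0 u0E] := lift Xx0.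
have e : orbit 'P%act WG u0 = [set: sT]%SET.
  apply/setP => u; rewrite !inE; have [h Hh hE] := tr _ (valX u).
  have [s sW sE] := WP u0 Hh; apply/imsetP; exists s => //.
  by apply: val_inj; rewrite /= sE u0E hE.
have /p_natP[k ek] : p.-nat #|orbit 'P%act WG u0|.
  by rewrite card_orbit; apply: pnat_dvd (dvdn_indexg _ _) pgroupW.
by exists k; rewrite -card_sT -e.
Qed.

(** The condition on stabilizers makes the permutation group [WG] act regularly, so its order is
    [ncard X], and this power kills each of its elements. *)
Lemma regular_action_exponent x0 h : X x0 ->
  (forall x, X x -> exists2 h, H h & act h x0 = x) ->
  (forall g x, H g -> act g x0 = x0 -> X x -> act g x = x) ->
  H h -> act (h ^+ ncard X) x0 = x0.
Proof.
move=> Xx0 tr free Hh; have [u0 u0E] := lift Xx0.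
have e : orbit 'P%act WG u0 = [set: sT]%SET.
  apply/setP => u; rewrite !inE; have [g Hg gE] := tr _ (valX u).
  have [s sW sE] := WP u0 Hg; apply/imsetP; exists s => //.
  by apply: val_inj; rewrite /= sE u0E gE.
have C1 : 'C_WG[u0 | 'P]%g = 1%g.
  apply/trivgP/fintype.subsetP => s; rewrite inE => /andP[]; rewrite inE => /asboolP[g Hg gE].
  move=> /astab1P su0; apply/set1P/permP => u; apply: val_inj.
  rewrite perm1 gE; apply: free => //.
  by rewrite -u0E -gE; congr val.
have cW : #|WG| = ncard X.
  by rewrite -card_sT -e card_orbit C1 indexg1.
have [s sE] := perm_ex Hh.
have sW : s \in WG by rewrite inE; apply/asboolP; exists h.
have := actXn Hh sE (ncard X) u0; rewrite -{1}cW expg_cardG // perm1.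
by rewrite u0E => <-.
Qed.

End FiniteActions.

(** * Homomorphisms from Z/p^oo *)

Section Pruefer.
Variable p : nat.
Hypothesis p_pr : prime p.
Local Open Scope ring_scope.
Import GRing.Theory Num.Theory.

Lemma Zpinfty1 : Zpinfty p 1. Proof. by exists 0%N; rewrite expr1n. Qed.

Lemma ZpinftyM z w : Zpinfty p z -> Zpinfty p w -> Zpinfty p (z * w).
Proof.
move=> [m zm] [n wn]; exists (m + n)%N; rewrite exprMn expnD.
by rewrite exprM zm expr1n mul1r mulnC exprM wn expr1n.
Qed.

Lemma ZpinftyX z n : Zpinfty p z -> Zpinfty p (z ^+ n).
Proof.
move=> Zz; elim: n => [|n IH]; first by rewrite expr0; apply: Zpinfty1.
by rewrite exprS; apply: ZpinftyM.
Qed.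

Lemma Zpinfty_neq0 z : Zpinfty p z -> z != 0.
Proof.
move=> [n zn]; apply/eqP => z0; move: zn.
rewrite z0 expr0n expn_eq0 -leqn0 leqNgt prime_gt0 //= => /eqP.
by rewrite eq_sym oner_eq0.
Qed.

Lemma ZpinftyV z : Zpinfty p z -> Zpinfty p z^-1.
Proof. by move=> [n zn]; exists n; rewrite exprVn zn invr1. Qed.

Lemma Zpinfty_root z : Zpinfty p z -> exists2 w, Zpinfty p w & w ^+ p = z.
Proof.
move=> [n zn]; exists (p.-root z); last by rewrite rootCK ?prime_gt0.
by exists n.+1; rewrite expnS exprM rootCK ?prime_gt0.
Qed.

(** A compatible system: level $n$ generates the $p^n$-th roots of unity and its $p$-th power is the
    level below. Level one is chosen separately because the principal root [p.-root 1] is 1. *)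
Fixpoint pruefer_gen (n : nat) : algC :=
  if n is m.+1 then
    (if m is _.+1 then p.-root (pruefer_gen m)
     else sval (C_prim_root_exists (prime_gt0 p_pr)))
  else 1.

Lemma pruefer_genX n : pruefer_gen n.+1 ^+ p = pruefer_gen n.
Proof.
case: n => [|n] /=; last by rewrite rootCK ?prime_gt0.
by case: (C_prim_root_exists _) => z /= /prim_expr_order.
Qed.

(** The order of level $n+2$ is some $p^j$ with $j\le n+2$. If $j\le n+1$, then level $n+1$ would be
    killed by $p^n$, against the induction hypothesis. *)
Lemma pruefer_gen_prim n : (p ^ n).-primitive_root (pruefer_gen n).
Proof.
case: n => [|n]; first
  by apply/andP; split=> //; apply/forallP => i; rewrite ord1 unity_rootE /= eqxx.
elim: n => [|n IH].
  by rewrite expn1 /=; case: (C_prim_root_exists _).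
have e : pruefer_gen n.+2 ^+ (p ^ n.+2) = 1.
  by rewrite expnS exprM pruefer_genX; apply: prim_expr_order.
have gt0 : (0 < p ^ n.+2)%N by rewrite expn_gt0 prime_gt0.
have [m mP mdvd] := prim_order_exists gt0 e.
have [j jn em] := elimT (dvdn_pfactor _ _ p_pr) mdvd.
have [je|jn'] := eqVneq j n.+2; first by move: mP; rewrite em je.
have /(dvdn_exp2l p) : (j <= n.+1)%N by rewrite -ltnS ltn_neqAle jn' jn.
rewrite -em (prim_order_dvd mP) expnS exprM pruefer_genX.
by rewrite -(prim_order_dvd IH) gtnNdvd ?expn_gt0 ?prime_gt0 // ltn_exp2l ?prime_gt1.
Qed.

Lemma pruefer_genXn n k : pruefer_gen (k + n) ^+ (p ^ k) = pruefer_gen n.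
Proof.
elim: k => [|k IH]; first by rewrite expr1.
by rewrite expnS exprM pruefer_genX.
Qed.

Lemma pruefer_genP z n : z ^+ (p ^ n) = 1 ->
  exists a : nat, z = pruefer_gen n ^+ a.
Proof.
by move=> /(prim_rootP (pruefer_gen_prim n))[i ->]; exists i.
Qed.

End Pruefer.

Definition p_divisible p (gT : groupType) (D : set gT) :=
  forall x, D x -> exists2 y, D y & y ^+ p = x.

Definition p_torsion p (gT : groupType) (D : set gT) :=
  forall x, D x -> exists n, x ^+ (p ^ n) = 1.

Definition abelian_on (gT : groupType) (D : set gT) :=
  forall x y, D x -> D y -> x * y = y * x.

Definition torsion_part (gT : groupType) n (D : set gT) : set gT :=
  [set x | D x /\ x ^+ n = 1].

Section PrueferHom.
Variables (p : nat) (gT : groupType) (D : set gT).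
Hypotheses (p_pr : prime p) (sD : subgroup D) (dD : p_divisible p D).
Local Notation zeta := (pruefer_gen p_pr).

(** Divisibility provides a chain of $p$-th roots of [e] inside [D]; matching it with the chain
    [pruefer_gen] gives the homomorphism. *)
Lemma pruefer_hom e : D e -> e ^+ p = 1 -> exists chi : algC -> gT,
  [/\ forall z, Zpinfty p z -> D (chi z),
      forall z w, Zpinfty p z -> Zpinfty p w -> chi (z * w)%R = chi z * chi w
    & chi (zeta 1) = e].
Proof.
move=> De ep.
have /choice[rt rtP] : forall x, exists y, D x -> D y /\ y ^+ p = x.
  move=> x; case: (pselect (D x)) => [Dx|nDx]; last by exists 1.
  by have [y Dy yx] := dD Dx; exists y.
pose c n := if n is m.+1 then iter m rt e else 1.
have Dc n : D (c n).
  case: n => [|n]; first exact: subgroup1.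
  by elim: n => [//|n IH] /=; have [] := rtP _ IH.
have cX n : c n.+1 ^+ p = c n.
  by case: n => [|n] //=; have [] := rtP _ (Dc n.+1).
have cXn n k : c (k + n)%N ^+ (p ^ k) = c n.
  elim: k => [|k IH]; first by rewrite expg1.
  by rewrite expnS expgnA cX.
have c1 n : c n ^+ (p ^ n) = 1 by rewrite -{1}[n]addn0 cXn.
(* The graph of $\zeta_n^a\mapsto c_n^a$. Two of its pairs can always be rewritten at a common
   level, which makes it single-valued and multiplicative. *)
pose R z y := exists n a : nat, z = (zeta n ^+ a)%R /\ y = c n ^+ a.
have up n k a : (zeta n ^+ a = zeta (k + n) ^+ (p ^ k * a))%R /\
    c n ^+ a = c (k + n)%N ^+ (p ^ k * a).
  by rewrite GRing.exprM expgnA pruefer_genXn cXn.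
have R2 z w y y' : R z y -> R w y' -> exists m a b,
    [/\ z = (zeta m ^+ a)%R, w = (zeta m ^+ b)%R, y = c m ^+ a & y' = c m ^+ b].
  move=> [m [a [-> ->]]] [n [b [-> ->]]].
  exists (m + n)%N, (p ^ n * a)%N, (p ^ m * b)%N.
  by split; rewrite ?(up m n a).1 ?(up n m b).1 ?(up m n a).2 ?(up n m b).2 1?addnC.
have Rfun z y y' : R z y -> R z y' -> y = y'.
  move=> Rzy Rzy'; have [m [a [b [-> /eqP]]]] := R2 _ _ _ _ Rzy Rzy'.
  rewrite (eq_prim_root_expr (pruefer_gen_prim p_pr m)) => /eqP ab -> ->.
  by rewrite (expg_mod _ (c1 m)) ab -(expg_mod _ (c1 m)).
have RM z w y y' : R z y -> R w y' -> R (z * w)%R (y * y').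
  move=> Rzy Rwy'; have [m [a [b [-> -> -> ->]]]] := R2 _ _ _ _ Rzy Rwy'.
  by exists m, (a + b)%N; rewrite GRing.exprD expgnDr.
have /choice[chi chiP] : forall z, exists y, Zpinfty p z -> R z y.
  move=> z; case: (pselect (Zpinfty p z)) => [[n]|nZ]; last by exists 1.
  by move=> /(pruefer_genP p_pr)[a ->]; exists (c n ^+ a) => _; exists n, a.
exists chi; split.
- move=> z /chiP[n [a [_ ->]]]; exact: subgroupX.
- move=> z w Zz Zw; apply: (Rfun (z * w)%R); first exact/chiP/ZpinftyM.
  by apply: RM; apply: chiP.
- apply: (Rfun (zeta 1)); last by exists 1%N, 1%N.
  apply: chiP; exists 1%N; rewrite -{1}[1%N]addn0 pruefer_genXn //.
Qed.

End PrueferHom.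

(** * Tori and divisible groups *)

Lemma ncard_setT (T : finType) : ncard [set: T] = #|T|.
Proof.
have e : fset_set [set: T] = [fset x in T]%fset.
  apply/fsetP => x; rewrite in_fset_set; last exact: finite_finset.
  by rewrite in_fset /=; apply/idP/mem_set.
by rewrite /ncard e card_finset.
Qed.

Section Torus.
Variables (p : nat) (gT : groupType) (r : nat) (T : set gT).
Hypotheses (p_pr : prime p) (sT : subgroup T) (tT : torus p r T).

Lemma torusE : exists f : gT -> {ffun 'I_r -> algC},
  [/\ forall x y i, T x -> T y -> (f (x * y)%g i = f x i * f y i)%R,
      forall x i, T x -> Zpinfty p (f x i),
      injective_on T f &
      forall v : {ffun 'I_r -> algC}, (forall i, Zpinfty p (v i)) ->
        exists2 x, T x & f x = v].
Proof.
have [f [fM [fT fI fS]]] := tT; exists f; split.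
- by move=> x y i Tx Ty; apply: fM.
- by move=> x i /fT; apply.
- move=> x y Tx Ty exy; apply: (fI x y); [exact: mem_set|exact: mem_set|].
  by rewrite exy.
- move=> v Zv; have [x Tx xv] := fS (fun i => v i) Zv; exists x => //.
  by apply/ffunP => i; rewrite xv.
Qed.

Lemma torusX : exists f : gT -> {ffun 'I_r -> algC},
  [/\ forall x y i, T x -> T y -> (f (x * y)%g i = f x i * f y i)%R,
      forall x n i, T x -> (f (x ^+ n)%g i = f x i ^+ n)%R,
      forall x i, T x -> Zpinfty p (f x i),
      injective_on T f &
      forall v : {ffun 'I_r -> algC}, (forall i, Zpinfty p (v i)) ->
        exists2 x, T x & f x = v].
Proof.
have [f [fM fT fI fS]] := torusE; exists f; split=> // x n i Tx.
have f1 : (f 1%g i = 1)%R.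
  have T1 := subgroup1 sT.
  apply: (GRing.mulfI (Zpinfty_neq0 p_pr (fT _ i T1))).
  by rewrite GRing.mulr1 -fM ?mulg1.
elim: n => [|n IH]; first by rewrite f1.
by rewrite expgS GRing.exprS fM // ?IH //; apply: subgroupX.
Qed.

Lemma torus_abelian : abelian_on T.
Proof.
have [f [fM _ fI _]] := torusE => x y Tx Ty.
apply: fI; [exact: subgroupM|exact: subgroupM|].
by apply/ffunP => i; rewrite !fM // GRing.mulrC.
Qed.

Lemma torus_p_torsion : p_torsion p T.
Proof.
have [f [_ fX fT fI _]] := torusX => x Tx.
have /fin_all_exists[n nP] : forall i, exists n : nat, (f x i ^+ (p ^ n) = 1)%R.
  by move=> i; apply: fT.
have T1 := subgroup1 sT; have f1 i : (f 1%g i = 1)%R by rewrite -(expg0 x) fX.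
exists (\max_i n i)%N; apply: fI => //; first exact: subgroupX.
apply/ffunP => i; rewrite fX // f1.
have le : (n i <= \max_i n i)%N by apply: leq_bigmax.
by rewrite -(subnKC le) expnD GRing.exprM nP GRing.expr1n.
Qed.

Lemma torus_p_divisible : p_divisible p T.
Proof.
have [f [_ fX fT fI fS]] := torusX => x Tx.
have /fin_all_exists2[w wZ wP] : forall i, exists2 w, Zpinfty p w & (w ^+ p = f x i)%R.
  by move=> i; apply: Zpinfty_root => //; apply: fT.
have [|y Ty yw] := fS [ffun i => w i]; first by move=> i; rewrite ffunE.
exists y => //; apply: fI => //; first exact: subgroupX.
by apply/ffunP => i; rewrite fX // yw ffunE.
Qed.

(** In coordinates these are the tuples of $p^k$-th roots of unity. For $k=1$ the count determines
    the rank; for larger $k$ the finiteness enters the bound on normalizers. *)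
Lemma torus_torsion_part k :
  finite_set (torsion_part (p ^ k) T) /\ ncard (torsion_part (p ^ k) T) = ((p ^ k) ^ r)%N.
Proof.
have [f [_ fX fT fI fS]] := torusX.
pose z := pruefer_gen p_pr k; have zP := pruefer_gen_prim p_pr k.
pose G (phi : {ffun 'I_r -> 'I_(p ^ k)}) : {ffun 'I_r -> algC} :=
  [ffun i => (z ^+ phi i)%R].
have GI : injective_on setT G.
  move=> phi psi _ _ /ffunP e; apply/ffunP => i; have := e i; rewrite !ffunE.
  move/eqP; rewrite (eq_prim_root_expr zP) !modn_small // => /eqP ?.
  exact: val_inj.
have T1 := subgroup1 sT; have f1 i : (f 1%g i = 1)%R by rewrite -(expg0 1) fX.
have e : f @` torsion_part (p ^ k) T = G @` setT.
  apply/seteqP; split=> [_ [x [Tx xk] <-]|_ [phi _ <-]].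
    have /fin_all_exists[a aP] : forall i, exists a : 'I_(p ^ k), (f x i = z ^+ a)%R.
      move=> i; have e : (f x i ^+ (p ^ k) = 1)%R by rewrite -fX // xk f1.
      by have [a ->] := prim_rootP zP e; exists a.
    by exists [ffun i => a i] => //; apply/ffunP => i; rewrite !ffunE aP.
  have GX i : (G phi i ^+ (p ^ k) = 1)%R.
    by rewrite ffunE -GRing.exprM mulnC GRing.exprM (prim_expr_order zP) GRing.expr1n.
  have [i|x Tx xG] := fS (G phi); first by exists k.
  exists x => //; split=> //; apply: fI => //; first exact: subgroupX.
  by apply/ffunP => i; rewrite fX // f1 xG.
have fI' : injective_on (torsion_part (p ^ k) T) f.
  by move=> x y [Tx _] [Ty _]; apply: fI.
have fin : finite_set (torsion_part (p ^ k) T).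
  apply: (injective_finite (C := G @` setT) (f := f)) => //; last by rewrite e.
  exact/finite_image/finite_finset.
split=> //; rewrite -(ncard_image fin fI') e ncard_image //; last exact: finite_finset.
by rewrite ncard_setT card_ffun !card_ord.
Qed.

End Torus.

Section DivisibleTorus.
Variables (p : nat) (gT : groupType) (D : set gT).
Hypotheses (p_pr : prime p) (sD : subgroup D) (aD : abelian_on D).
Hypotheses (tD : p_torsion p D) (dD : p_divisible p D).
Hypothesis fD : finite_set (torsion_part p D).

Definition Zpinfty_pow r : set {ffun 'I_r -> algC} :=
  [set v | forall i, Zpinfty p (v i)].

(** Injectivity is asked only on $p$-torsion, which is easy to check when a coordinate is added. It
    implies full injectivity because the source is a $p$-torsion group. *)
Definition pruefer_embedding r (g : {ffun 'I_r -> algC} -> gT) :=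
  [/\ forall v, Zpinfty_pow v -> D (g v),
      forall u v w : {ffun 'I_r -> algC}, Zpinfty_pow u -> Zpinfty_pow v ->
        (forall i, w i = u i * v i)%R -> g w = g u * g v &
      forall v : {ffun 'I_r -> algC}, (forall i, v i ^+ p = 1)%R -> g v = 1 -> forall i, v i = 1%R].

Lemma pruefer_embeddingX r (g : {ffun 'I_r -> algC} -> gT) v n :
  pruefer_embedding g -> Zpinfty_pow v -> g [ffun i => (v i ^+ n)%R] = g v ^+ n.
Proof.
move=> [gD gM _] Zv.
have Z1 : Zpinfty_pow [ffun _ : 'I_r => 1%R] by move=> i; rewrite ffunE; exact: Zpinfty1.
elim: n => [|n IH].
  have -> : [ffun i => (v i ^+ 0)%R] = [ffun _ : 'I_r => 1%R : algC].
    by apply/ffunP => i; rewrite !ffunE.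
  apply: (@mulgI _ (g [ffun _ => 1%R])).
  by rewrite mulg1 -(gM _ _ [ffun _ => 1%R]) // => i; rewrite !ffunE GRing.mulr1.
rewrite expgS -IH; apply: gM => //.
  by move=> i; rewrite ffunE; apply: ZpinftyX.
by move=> i; rewrite !ffunE GRing.exprS.
Qed.

(** Induction on an exponent killing $v$: the power $v^{p^k}$ is $p$-torsion in the kernel, hence
    trivial. *)
Lemma pruefer_embedding_ker r (g : {ffun 'I_r -> algC} -> gT) v :
  pruefer_embedding g -> Zpinfty_pow v -> g v = 1 -> forall i, v i = 1%R.
Proof.
move=> gE Zv; have [_ _ gI] := gE.
have /fin_all_exists[n nP] : forall i, exists n : nat, (v i ^+ (p ^ n) = 1)%R by [].
have : forall i, (v i ^+ (p ^ \max_i n i) = 1)%R.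
  move=> i; have le : (n i <= \max_i n i)%N by apply: leq_bigmax.
  by rewrite -(subnKC le) expnD GRing.exprM nP GRing.expr1n.
elim: (\max_i n i)%N => [|k IH] vk gv; first by move=> i; have := vk i; rewrite expn0 GRing.expr1.
apply: IH => // i; have := gI [ffun i => (v i ^+ (p ^ k))%R].
rewrite pruefer_embeddingX // gv expg1n => /(_ _ erefl i).
by rewrite ffunE; apply => j; rewrite ffunE -GRing.exprM -expnSr.
Qed.

Lemma pruefer_embedding_inj r (g : {ffun 'I_r -> algC} -> gT) :
  pruefer_embedding g -> injective_on (@Zpinfty_pow r) g.
Proof.
move=> gE u v Zu Zv guv; have [_ gM _] := gE.
pose w := [ffun i => (u i / v i)%R].
have Zw : Zpinfty_pow w.
  by move=> i; rewrite ffunE; apply: ZpinftyM; [exact: Zu|exact/ZpinftyV/Zv].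
have : g w = 1.
  apply: (@mulIg _ (g v)); rewrite mul1g -(gM w v u) // => i.
  by rewrite ffunE GRing.divfK // (Zpinfty_neq0 p_pr).
move/(pruefer_embedding_ker gE Zw) => w1; apply/ffunP => i.
have := w1 i; rewrite ffunE => /(congr1 (fun z => z * v i))%R.
by rewrite GRing.divfK ?GRing.mul1r // (Zpinfty_neq0 p_pr).
Qed.

(** The $p$-torsion of the source has $p^r$ elements; this bounds the ranks of embeddings. *)
Lemma pruefer_embedding_card r (g : {ffun 'I_r -> algC} -> gT) :
  pruefer_embedding g -> (p ^ r <= ncard (torsion_part p D))%N.
Proof.
move=> gE; have [gD _ _] := gE.
have zP := pruefer_gen_prim p_pr 1; rewrite expn1 in zP.
pose z := pruefer_gen p_pr 1.
pose G (phi : {ffun 'I_r -> 'I_p}) : {ffun 'I_r -> algC} :=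
  [ffun i => (z ^+ phi i)%R].
have ZG phi : Zpinfty_pow (G phi).
  move=> i; rewrite ffunE; apply: ZpinftyX; exists 1%N.
  by rewrite expn1 (prim_expr_order zP).
have GI : injective_on setT (g \o G).
  move=> phi psi _ _ /(pruefer_embedding_inj gE (ZG _) (ZG _)) /ffunP e.
  apply/ffunP => i; have := e i; rewrite !ffunE.
  move/eqP; rewrite (eq_prim_root_expr zP) !modn_small // => /eqP ?.
  exact: val_inj.
rewrite -[r in (p ^ r)%N]card_ord -[p in (p ^ _)%N]card_ord -card_ffun -ncard_setT.
rewrite -(ncard_image finite_finset GI); apply: ncard_le => // _ [phi _ <-] /=.
split; first exact: gD.
rewrite -pruefer_embeddingX // -[RHS](expg0 (g (G phi))) -pruefer_embeddingX //.
congr (g _); apply/ffunP => i; rewrite !ffunE GRing.expr0 -GRing.exprM mulnC.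
by rewrite GRing.exprM (prim_expr_order zP) GRing.expr1n.
Qed.

(** The new coordinate is mapped by a homomorphism through [e]; it meets the old image trivially
    because its $p$-torsion is generated by [e]. *)
Lemma pruefer_embedding_extend r (g : {ffun 'I_r -> algC} -> gT) e :
  pruefer_embedding g -> torsion_part p D e ->
  (forall v, Zpinfty_pow v -> g v <> e) ->
  exists g' : {ffun 'I_r.+1 -> algC} -> gT, pruefer_embedding g'.
Proof.
move=> gE [De ep] ne; have [gD gM gI] := gE.
have [chi [chiD chiM chi1]] := pruefer_hom p_pr sD dD De ep.
pose t (v : {ffun 'I_r.+1 -> algC}) := [ffun i => v (lift ord0 i)].
have Zt v : Zpinfty_pow v -> Zpinfty_pow (t v) by move=> Zv i; rewrite ffunE.
exists (fun v => g (t v) * chi (v ord0)); split.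
- move=> v Zv; apply: subgroupM => //; first exact/gD/Zt.
  exact: chiD.
- move=> u v w Zu Zv wE; rewrite wE chiM //.
  have -> : g (t w) = g (t u) * g (t v).
    by apply: gM => [||i]; [exact: Zt|exact: Zt|rewrite !ffunE].
  rewrite -!mulgA; congr (_ * _); rewrite !mulgA; congr (_ * _).
  by apply: aD; [exact/gD/Zt|exact: chiD].
move=> v vp gv.
have Zv : Zpinfty_pow v by move=> i; exists 1%N; rewrite expn1.
have zP := pruefer_gen_prim p_pr 1; rewrite expn1 in zP.
have [b v0E] := prim_rootP zP (vp ord0).
have Zz : Zpinfty p (pruefer_gen p_pr 1).
  by exists 1%N; rewrite expn1 (prim_expr_order zP).
have chib : chi (v ord0) = e ^+ b.
  rewrite v0E -chi1; elim: (nat_of_ord b) => [|k IH].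
    rewrite GRing.expr0; apply: (@mulgI _ (chi 1%R)); rewrite mulg1.
    by rewrite -chiM ?GRing.mulr1 //; apply: Zpinfty1.
  by rewrite GRing.exprS chiM ?IH ?expgS //; apply: ZpinftyX.
(* Otherwise the last coordinate is $\zeta^b$ with $b$ prime to $p$, so [g] sends the remaining ones
   to $e^{-b}$, and by Bezout a power of them to $e$ itself. *)
have v0 : v ord0 = 1%R.
  have [b0|b_gt0] := posnP b; first by rewrite v0E b0.
  have cop : coprime b p.
    by rewrite coprime_sym prime_coprime // gtnNdvd.
  have gb : g (t v) = (e ^+ b)^-1.
    by apply: (@mulIg _ (e ^+ b)); rewrite mulVg -chib.
  have gp : g (t v) ^+ p = 1 by rewrite gb expVgn -expgnA mulnC expgnA ep expg1n invg1.
  case: (egcdnP p b_gt0) => c kn; rewrite (eqP (cop : gcdn b p == 1%N)) => ec _.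
  case: (ne [ffun i => (t v i ^+ (c * p.-1))%R]).
    by move=> i; rewrite ffunE; apply/ZpinftyX/Zt.
  rewrite pruefer_embeddingX //; last exact: Zt.
  rewrite -(expg_inv _ (prime_gt0 p_pr) gp) gb expVgn invgK -expgnA mulnC ec.
  by rewrite expgnDr mulnC expgnA ep expg1n mul1g.
move=> i; have [j ->|->//] := unliftP ord0 i.
have := gI (t v); rewrite /t => /(_ _ _ j); rewrite ffunE; apply.
  by move=> k; rewrite ffunE.
move: gv; rewrite v0 => {1}<-; rewrite -[LHS]mulg1; congr (_ * _).
by apply: (@mulgI _ (chi 1%R)); rewrite mulg1 -chiM ?GRing.mulr1 //; apply: Zpinfty1.
Qed.

(** The structure theorem for divisible abelian $p$-groups of finite rank: ranks of embeddings are
    bounded, and one of maximal rank cannot be extended. *)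
Lemma divisible_torus : exists r, torus p r D.
Proof.
have ex : exists r, `[< exists g : {ffun 'I_r -> algC} -> gT, pruefer_embedding g >].
  exists 0%N; apply/asboolP; exists (fun _ => 1); split=> [||v _ _ []//].
    by move=> *; apply: subgroup1.
  by move=> *; rewrite mulg1.
have bd r : `[< exists g : {ffun 'I_r -> algC} -> gT, pruefer_embedding g >] ->
    (r <= ncard (torsion_part p D))%N.
  move=> /asboolP[g /pruefer_embedding_card]; apply: leq_trans.
  by apply/ltnW/ltn_expl/prime_gt1.
(* An embedding of maximal rank hits the p-torsion, hence everything. *)
case: (ex_maxnP ex bd) => r /asboolP[g gE] rmax; exists r.
have [gD gM gI] := gE; have gJ := pruefer_embedding_inj gE.
have onto1 d : torsion_part p D d -> exists2 v, Zpinfty_pow v & g v = d.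
  move=> Dd; apply: contrapT => nv.
  have [|g' g'E] := pruefer_embedding_extend gE Dd.
    by move=> v Zv gv; apply: nv; exists v.
  by have := rmax r.+1; rewrite ltnn => /(_ (asboolT (ex_intro _ g' g'E))).
have onto d : D d -> exists2 v, Zpinfty_pow v & g v = d.
  move=> Dd; have [k] := tD Dd; elim: k d Dd => [|k IH] d Dd dk.
    by apply: onto1; split=> //; rewrite -(expg1 d) dk expg1n.
  have [||v Zv vd] := IH (d ^+ p); first exact: subgroupX.
    by rewrite -expgnA -expnS.
  have /fin_all_exists2[w wZ wP] : forall i, exists2 w, Zpinfty p w & (w ^+ p = v i)%R.
    by move=> i; apply: Zpinfty_root.
  pose w' := [ffun i => w i]; have Zw : Zpinfty_pow w' by move=> i; rewrite ffunE.
  have gw : g w' ^+ p = d ^+ p.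
    rewrite -vd -pruefer_embeddingX //; congr (g _).
    by apply/ffunP => i; rewrite !ffunE.
  have Dg := gD _ Zw.
  have [|u Zu ue] := onto1 (d * (g w')^-1).
    split; first exact: sD.2.
    rewrite expgMn; last exact/commuteV/aD.
    by rewrite expVgn gw mulgV.
  exists [ffun i => (u i * w' i)%R].
    by move=> i; rewrite ffunE; apply: ZpinftyM.
  by rewrite (gM u w') ?ue ?mulgVK // => i; rewrite ffunE.
have /choice[f fP] : forall d, exists v, D d -> Zpinfty_pow v /\ g v = d.
  move=> d; case: (pselect (D d)) => [/onto[v Zv gv]|nD]; first by exists v.
  by exists [ffun _ => 1%R].
exists f; split.
  move=> x y Dx Dy i; have [Zx gx] := fP x Dx; have [Zy gy] := fP y Dy.
  have [Zxy gxy] := fP _ (subgroupM sD Dx Dy).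
  have Zf : Zpinfty_pow [ffun i => (f x i * f y i)%R].
    by move=> j; rewrite ffunE; apply: ZpinftyM.
  suff -> : f (x * y) = [ffun i => (f x i * f y i)%R] by rewrite ffunE.
  apply: gJ => //; rewrite gxy (gM (f x) (f y)) ?gx ?gy // => j.
  by rewrite ffunE.
split.
- by move=> x /fP[Zx _] i; apply: Zx.
- move=> x y /set_mem Dx /set_mem Dy exy.
  have [_ <-] := fP x Dx; have [_ <-] := fP y Dy.
  by congr (g _); apply/ffunP => i; rewrite exy.
- move=> v Zv; pose v' := [ffun i => v i].
  have Zv' : Zpinfty_pow v' by move=> i; rewrite ffunE; apply: Zv.
  exists (g v'); first exact: gD.
  have [Zf gf] := fP _ (gD _ Zv'); have := gJ _ _ Zf Zv' gf => -> .
  by apply/funext => i; rewrite ffunE.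
Qed.

End DivisibleTorus.

(** * Cosets *)

Section Cosets.
Variable gT : groupType.
Implicit Types (x y g h : gT) (A H N P Q S T D : set gT) (f : gT -> gT).

Definition lcoset T g : set gT := [set g * t | t in T].

Lemma lcoset_eqP T g h :
  subgroup T -> lcoset T g = lcoset T h <-> T (g^-1 * h).
Proof.
move=> sT; split=> [e|Tgh].
  have : lcoset T g h by rewrite e; exists 1; [exact: subgroup1|rewrite mulg1].
  by move=> [t Tt <-]; rewrite mulKg.
apply/seteqP; split=> _ [t Tt <-].
  exists (h^-1 * g * t); last by rewrite -mulgA mulVKg.
  by apply: subgroupM => //; rewrite -[g]invgK -invgM; apply: subgroupV.
exists (g^-1 * h * t); last by rewrite -mulgA mulVKg.
exact: subgroupM.
Qed.

Lemma lcosetM T g h : [set g * x | x in lcoset T h] = lcoset T (g * h).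
Proof.
apply/seteqP; split=> [_ [_ [t Tt <-] <-]|_ [t Tt <-]].
  by exists t; rewrite ?mulgA.
by exists (h * t); [exists t|rewrite mulgA].
Qed.

Lemma left_cosetsP S T c :
  left_cosets S T c <-> exists2 g, S g & c = lcoset T g.
Proof. by split=> [[g Sg <-]|[g Sg ->]]; exists g. Qed.

(** A cover may repeat cosets, so it only bounds the index from above; in return covers restrict to
    subgroups and compose along chains. *)
Definition coset_cover S T (s : seq gT) :=
  forall x, S x -> exists2 g, g \in s & T (g^-1 * x).

Lemma coset_cover_exists S T : subgroup T -> finite_set (left_cosets S T) ->
  exists s, [/\ size s = ncard (left_cosets S T),
    forall g, g \in s -> S g & coset_cover S T s].
Proof.
move=> sT fin.
have /choice[rep repP] : forall c, exists g,
    left_cosets S T c -> S g /\ c = lcoset T g.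
  move=> c; case: (pselect (left_cosets S T c)) => [[g Sg <-]|nc]; last by exists 1.
  by exists g.
exists (map rep (fset_set (left_cosets S T))); split.
- by rewrite size_map.
- move=> _ /mapP[c + ->]; rewrite in_fset_set // => /set_mem /repP[]//.
move=> x Sx; have cx : left_cosets S T (lcoset T x) by exists x.
exists (rep (lcoset T x)); last first.
  by have [_ e] := repP _ cx; apply/(lcoset_eqP _ _ sT).
by apply: map_f; rewrite in_fset_set //; apply: mem_set.
Qed.

Lemma coset_cover_card S T s : subgroup T -> coset_cover S T s ->
  finite_set (left_cosets S T) /\ (ncard (left_cosets S T) <= size s)%N.
Proof.
move=> sT cov; pose F (i : 'I_(size s)) := lcoset T (nth 1 s i).
have sub : left_cosets S T `<=` F @` setT.
  move=> _ [x /cov[g gs Tgx] <-].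
  have gi : (index g s < size s)%N by rewrite index_mem.
  exists (Ordinal gi) => //; rewrite /F /= nth_index //.
  exact/lcoset_eqP.
have fin : finite_set (F @` setT) by exact/finite_image/finite_finset.
split; first exact: sub_finite_set sub fin.
apply: leq_trans (ncard_le fin sub) _.
by rewrite (leq_trans (ncard_image_le _ finite_finset)) // ncard_setT card_ord.
Qed.

Lemma left_cosets_act S T h c : subgroup S ->
  S h -> left_cosets S T c -> left_cosets S T [set h * x | x in c].
Proof.
move=> sS Sh [g Sg <-]; exists (h * g); first exact: subgroupM.
by rewrite -[LHS]lcosetM.
Qed.

Lemma p_group_index p S T : prime p -> subgroup S -> p_torsion p S ->
  finite_set (left_cosets S T) -> exists k, ncard (left_cosets S T) = (p ^ k)%N.
Proof.
move=> p_pr sS tS fin.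
have S1 := subgroup1 sS.
apply: (@pgroup_transitive p gT _ S (left_cosets S T)
  (fun h c => [set h * x | x in c]) p_pr sS tS fin _ _ _ (lcoset T 1)).
- by move=> h c; apply: left_cosets_act.
- by move=> g h _ _ _ /left_cosetsP[k _ ->]; rewrite !lcosetM mulgA.
- by move=> _ /left_cosetsP[k _ ->]; rewrite lcosetM mul1g.
- by exists 1.
- by move=> _ /left_cosetsP[k Sk ->]; exists k => //; rewrite lcosetM mulg1.
Qed.

(** Left translation on the cosets: since [T] is normal, an element fixing the coset [T] fixes every
    coset. *)
Lemma normal_index_exponent S T x : subgroup S -> subgroup T -> normal_in T S ->
  finite_set (left_cosets S T) -> S x -> T (x ^+ ncard (left_cosets S T)).
Proof.
move=> sS sT [TS nT] fin Sx; have S1 := subgroup1 sS.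
suff : [set x ^+ ncard (left_cosets S T) * y | y in lcoset T 1] = lcoset T 1.
  rewrite lcosetM mulg1 => /lcoset_eqP => /(_ sT).
  by rewrite mulg1 => /(subgroupV sT); rewrite invgK.
apply: (@regular_action_exponent gT _ S (left_cosets S T)
  (fun h c => [set h * x | x in c]) sS fin) => //.
- by move=> h c; apply: left_cosets_act.
- by move=> g h _ _ _ /left_cosetsP[k _ ->]; rewrite !lcosetM mulgA.
- by move=> _ /left_cosetsP[k _ ->]; rewrite lcosetM mul1g.
- by exists 1.
- by move=> _ /left_cosetsP[k Sk ->]; exists k => //; rewrite lcosetM mulg1.
- move=> g c Sg /esym; rewrite !lcosetM mulg1 => /lcoset_eqP => /(_ sT).
  rewrite invg1 mul1g => Tg /left_cosetsP[k Sk ->]; rewrite lcosetM.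
  apply/esym/lcoset_eqP => //; have := nT _ (subgroupV sS Sk).
  by move/cj_imageP/(_ g) => -[H _]; have := H Tg; rewrite cjE invgK -mulgA.
Qed.

Lemma p_divisibleX p D n x : p_divisible p D -> D x ->
  exists2 y, D y & y ^+ (p ^ n) = x.
Proof.
move=> dD; elim: n x => [|n IH] x Dx; first by exists x; rewrite ?expg1.
have [y /IH[z Dz <-] <-] := dD _ Dx.
by exists z; rewrite // -expgnA -expnSr.
Qed.

Lemma p_torsion_sub p H T : p_torsion p T -> H `<=` T -> p_torsion p H.
Proof. by move=> tT HT x /HT/tT. Qed.

(** [K] need not be normal. Two of the powers $x^0,\dots,x^M$ share a coset of [K], where $M$ is the
    index, so a power of $x$ with exponent at most $M$ lies in [K]. *)
Lemma finite_index_exponent p H K : prime p -> subgroup H -> subgroup K ->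
  p_torsion p H -> finite_set (left_cosets H K) ->
  exists M, forall x, H x -> K (x ^+ (p ^ M)).
Proof.
move=> p_pr sH sK tH fin; exists (ncard (left_cosets H K)) => x Hx.
set M := ncard _.
have [i [j [ij jM Kij]]] : exists i j, [/\ (i < j)%N, (j <= M)%N & K (x ^+ (j - i))].
  pose F (i : 'I_M.+1) := lcoset K (x ^+ i).
  have /existsP[i /existsP[j /andP[ij /eqP Fij]]] :
      [exists i : 'I_M.+1, [exists j : 'I_M.+1, (i < j) && (F i == F j)]]%N.
    apply: contraT => nF; have FI : injective_on setT F.
      move=> i j _ _ Fij; apply: contraNeq nF; rewrite neq_ltn => /orP[ij|ji].
        by apply/existsP; exists i; apply/existsP; exists j; rewrite ij Fij /=.
      by apply/existsP; exists j; apply/existsP; exists i; rewrite ji Fij /=.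
    have := ncard_image finite_finset FI; rewrite ncard_setT card_ord => e.
    have : (ncard (F @` setT) <= M)%N.
      apply: ncard_le => // _ [i _ <-]; exists (x ^+ i) => //.
      exact: subgroupX.
    by rewrite e ltnn.
  exists i, j; split=> //; first by rewrite -ltnS.
  by move/lcoset_eqP: Fij => /(_ sK); rewrite -{1}(subnKC (ltnW ij)) expgnDr mulKg.
have [m xm] := tH x Hx.
have ji_gt0 : (0 < j - i)%N by rewrite subn_gt0.
(* The gcd of $j-i$ and $p^m$ is a power $p^a$ with $p^a\le j-i\le M$, which bounds $a$
   independently of $x$. *)
have [km kn e _] := egcdnP (p ^ m) ji_gt0.
have Kg : K (x ^+ gcdn (j - i) (p ^ m)).
  have : K (x ^+ (km * (j - i))) by rewrite mulnC expgnA; apply: subgroupX.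
  by rewrite e expgnDr mulnC expgnA xm expg1n mul1g.
have [a am ea] := elimT (dvdn_pfactor _ _ p_pr) (dvdn_gcdr (j - i) (p ^ m)).
have aM : (a <= M)%N.
  have : (p ^ a <= j - i)%N by rewrite -ea dvdn_leq // dvdn_gcdl.
  move/(leq_trans (ltnW (ltn_expl a (prime_gt1 p_pr)))) => le.
  by rewrite (leq_trans le) // (leq_trans (leq_subr _ _)).
rewrite ea in Kg; rewrite -(subnKC aM) expnD expgnA.
exact: subgroupX.
Qed.

(** Every element of [D] is a $p^M$-th power of an element of [D], for the uniform exponent $M$ that
    brings [H] into [K]. Hence a maximal torus contains every divisible subgroup. *)
Lemma p_divisible_sub p H K D : prime p -> subgroup H -> subgroup K ->
  p_torsion p H -> finite_set (left_cosets H K) ->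
  p_divisible p D -> D `<=` H -> D `<=` K.
Proof.
move=> p_pr sH sK tH fin dD DH x Dx.
have [M KM] := finite_index_exponent p_pr sH sK tH fin.
by have [y Dy <-] := p_divisibleX M dD Dx; apply/KM/DH.
Qed.

End Cosets.

(** * The order of a discrete p-toral group *)

Section ToralOrder.
Variables (p : nat) (gT : groupType).
Hypothesis p_pr : prime p.
Implicit Types (x y g h : gT) (P Q S T D : set gT) (f : gT -> gT).

Lemma maximal_torus_p_torsion r S T :
  subgroup S -> maximal_torus p r S T -> p_torsion p S.
Proof.
move=> sS [sT nT tT fin [k ek]] x Sx.
have [n] := torus_p_torsion p_pr sT tT (normal_index_exponent sS sT nT fin Sx).
by rewrite -expgnA ek -expnD; exists (k + n)%N.
Qed.

(** The image of [TP] is divisible, so it lies in [TQ], and counting $p$-torsion compares the ranks.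
    With equal ranks [f] maps [TP] onto [TQ], and then the indices are compared coset by coset. *)
Lemma maximal_torus_embedding rP P TP rQ Q TQ f :
  subgroup P -> subgroup Q ->
  maximal_torus p rP P TP -> maximal_torus p rQ Q TQ ->
  (forall x, P x -> Q (f x)) -> multiplicative_on P f -> injective_on P f ->
  (rP <= rQ)%N /\ ((rQ <= rP)%N ->
    (ncard (left_cosets P TP) <= ncard (left_cosets Q TQ))%N /\
    ((ncard (left_cosets Q TQ) <= ncard (left_cosets P TP))%N -> f @` P = Q)).
Proof.
move=> sP sQ mP mQ PQ fM fI.
have tQ := maximal_torus_p_torsion sQ mQ.
have [sTP [TPP nTP] tTP finP _] := mP.
have [sTQ [TQQ nTQ] tTQ finQ _] := mQ.
have fMT : multiplicative_on TP f by move=> x y /TPP Px /TPP Py; apply: fM.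
have f1 := multiplicative_on1 sP fM.
have sub : f @` TP `<=` TQ.
  apply: (p_divisible_sub p_pr sQ sTQ tQ finQ).
    move=> _ [x TPx <-]; have [y TPy yx] := torus_p_divisible p_pr sTP tTP TPx.
    by exists (f y); [exists y|rewrite -(multiplicative_onX _ sTP fMT) // yx].
  by move=> _ [x /TPP Px <-]; apply: PQ.
have := torus_torsion_part p_pr sTP tTP 1; rewrite expn1 => -[fin1P card1P].
have := torus_torsion_part p_pr sTQ tTQ 1; rewrite expn1 => -[fin1Q card1Q].
have sub1 : f @` torsion_part p TP `<=` torsion_part p TQ.
  move=> _ [x [TPx xp] <-]; split; first by apply: sub; exists x.
  by rewrite -(multiplicative_onX _ sTP fMT) // xp.
have cardf : ncard (f @` torsion_part p TP) = (p ^ rP)%N.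
  rewrite ncard_image // => x y [/TPP Px _] [/TPP Py _]; exact: fI.
split.
  by rewrite -(leq_exp2l _ _ (prime_gt1 p_pr)) -cardf -card1Q; apply: ncard_le.
move=> le_r; have e1 : f @` torsion_part p TP = torsion_part p TQ.
  by apply: ncard_le_eq => //; rewrite cardf card1Q leq_exp2l ?prime_gt1.
(* Induction on the exponent of [y]: a preimage of $y^p$ has a $p$-th root in [TP], whose image
   differs from [y] by $p$-torsion, which is already hit. *)
have onto y : TQ y -> exists2 x, TP x & f x = y.
  move=> TQy; have [n] := torus_p_torsion p_pr sTQ tTQ TQy.
  elim: n y TQy => [|n IH] y TQy.
    by rewrite expg1 => ->; exists 1; [exact: subgroup1|].
  rewrite expnS expgnA => /IH[|u TPu fu]; first exact: subgroupX.
  have [v TPv vu] := torus_p_divisible p_pr sTP tTP TPu.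
  have TQv : TQ (f v) by apply: sub; exists v.
  have : torsion_part p TQ (y * (f v)^-1).
    split; first exact: sTQ.2.
    rewrite expgMn; last by apply: commuteV; apply: (torus_abelian sTQ tTQ).
    by rewrite expVgn -(multiplicative_onX _ sTP fMT) // vu fu mulgV.
  rewrite -e1 => -[w [TPw _] fw]; exists (w * v); first exact: subgroupM.
  by rewrite fMT // fw mulgVK.
have [s [ss sQs cov]] := coset_cover_exists sTQ finQ.
pose hit q := `[< exists2 g, P g & TQ (q^-1 * f g) >].
have /choice[rep repP] : forall q, exists g, hit q -> P g /\ TQ (q^-1 * f g).
  move=> q; have [hq|nh] := boolP (hit q); last by exists 1.
  by have /asboolP[g Pg Tg] := hq; exists g.
(* One element of [P] for each coset of [TQ] met by the image of [f]; these cover [P] because [f]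
   maps [TP] onto [TQ] injectively. *)
have covP : coset_cover P TP [seq rep q | q <- s & hit q].
  move=> x Px; have [q qs Tq] := cov _ (PQ _ Px).
  have hq : hit q by apply/asboolP; exists x.
  exists (rep q); first by apply: map_f; rewrite mem_filter hq.
  have [Pr Tr] := repP q hq.
  have : TQ (f ((rep q)^-1 * x)).
    have PV := subgroupV sP Pr.
    rewrite fM // (multiplicative_onV sP fM) //.
    have -> : (f (rep q))^-1 * f x = (q^-1 * f (rep q))^-1 * (q^-1 * f x).
      by rewrite invgM invgK -mulgA mulVKg.
    by apply: subgroupM => //; apply: subgroupV.
  move=> /onto[t TPt /fI e]; rewrite -e //; first exact: TPP.
  by apply: subgroupM => //; apply: subgroupV.
have [_] := coset_cover_card sTP covP.
rewrite size_map size_filter => le1; rewrite -ss.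
split; first by rewrite (leq_trans le1) ?count_size.
move=> /leq_trans/(_ le1) le2.
(* Equality of the indices forces every coset of [TQ] to meet the image. *)
have /allP hs : all hit s by rewrite all_count eqn_leq count_size.
apply/seteqP; split=> [_ [x Px <-]|x Qx]; first exact: PQ.
have [q qs Tq] := cov x Qx; have /asboolP[g Pg Tg] := hs q qs.
have : TQ ((f g)^-1 * x).
  have -> : (f g)^-1 * x = (q^-1 * f g)^-1 * (q^-1 * x).
    by rewrite invgM invgK -mulgA mulVKg.
  by apply: subgroupM => //; apply: subgroupV.
move=> /onto[t TPt ft]; have Pt := TPP _ TPt; exists (g * t); first exact: subgroupM.
by rewrite fM // ft mulVKg.
Qed.

(** Fibers of the $p$-th power map are cosets of the finite $p$-torsion; [rt] picks one point in
    each nonempty fiber. *)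
Lemma torsion_part_finite n D : subgroup D -> abelian_on D ->
  finite_set (torsion_part p D) -> finite_set (torsion_part (p ^ n) D).
Proof.
move=> sD aD fin; elim: n => [|n IH].
  apply: sub_finite_set (finite_set1 1) => x [_].
  by rewrite expg1.
have /choice[rt rtP] : forall y, exists x,
    (exists2 x, D x & x ^+ p = y) -> D x /\ x ^+ p = y.
  move=> y; case: (pselect (exists2 x, D x & x ^+ p = y)) => [[x]|nx].
    by exists x.
  by exists 1.
apply: sub_finite_set (finite_image2 (fun y u => rt y * u) IH fin) => x [Dx xp].
exists (x ^+ p); first by split; rewrite -?expgnA -?expnS //; apply: subgroupX.
have [Dr rp] := rtP (x ^+ p) (ex_intro2 _ _ x Dx erefl).
have DV := subgroupV sD Dr.
exists ((rt (x ^+ p))^-1 * x); last exact: mulVKg.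
split; first exact: subgroupM.
by rewrite expgMn ?expVgn ?rp ?mulVg //; apply: aD.
Qed.

(** The divisible part is obtained as the group of $p^n$-th powers for large $n$; in this form its
    invariance under conjugations preserving [D] is immediate. *)
Lemma abelian_divisible_part D : subgroup D -> abelian_on D ->
  finite_set (torsion_part p D) -> exists n,
  let E := [set x ^+ (p ^ n) | x in D] in
  [/\ subgroup E, p_torsion p D -> p_divisible p E,
    forall g, cj g @` D = D -> cj g @` E = E &
    p_torsion p D ->
    exists s : seq gT, coset_cover D E s].
Proof.
move=> sD aD fin; pose E n := [set x ^+ (p ^ n) | x in D].
have sE n : subgroup (E n).
  apply: subgroup_image => // x y Dx Dy.
  by rewrite expgMn //; apply: aD.
have ED n : E n `<=` D by move=> _ [x Dx <-]; apply: subgroupX.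
have EE m n : E (m + n)%N `<=` E m.
  move=> _ [x Dx <-]; exists (x ^+ (p ^ n)); first exact: subgroupX.
  by rewrite -expgnA -expnD addnC.
have tE n : torsion_part p (E n) `<=` torsion_part p D.
  by move=> x [/ED Dx xp].
(* The finite p-torsion of D^(p^n) decreases with n; stop where it is least. *)
have ex : exists m, `[< exists n, ncard (torsion_part p (E n)) = m >].
  by exists (ncard (torsion_part p (E 0%N))); apply/asboolP; exists 0%N.
case: (ex_minnP ex) => m /asboolP[n en] mmin; exists n.
have stab k : torsion_part p (E (n + k)%N) = torsion_part p (E n).
  apply: ncard_le_eq; first exact: sub_finite_set (tE n) fin.
    by move=> x [/EE Ex xp].
  by rewrite en; apply: mmin; apply/asboolP; exists (n + k)%N.
have dE : p_torsion p D -> p_divisible p (E n).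
  move=> tD x Ex; have [k] := tD x (ED _ _ Ex).
  elim: k x Ex => [|k IH] x Ex xk.
    by exists x => //; move: xk; rewrite expg1 => ->; rewrite expg1n.
  (* By stability $x^{p^k}=y^{p^{n+k+1}}$ for some $y$; dividing $x$ by the $p$-th power of
     $y^{p^n}$ lowers its exponent. *)
  have : torsion_part p (E n) (x ^+ (p ^ k)).
    by split; [exact: subgroupX|rewrite -expgnA -expnSr].
  rewrite -(stab k.+1) => -[[y Dy ey] _].
  have Ey : E n (y ^+ (p ^ n)) by exists y.
  have Dx := ED _ _ Ex.
  have Exy : E n (x * ((y ^+ (p ^ n)) ^+ p)^-1).
    by apply: (sE n).2 => //; apply: subgroupX.
  have [|z Ez ez] := IH _ Exy.
    rewrite expgMn; last first.
      by apply: commuteV; apply: aD => //; apply: subgroupX => //; apply: subgroupX.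
    by rewrite expVgn -!expgnA -expnS -expnD ey mulgV.
  exists (z * y ^+ (p ^ n)); first exact: subgroupM.
  by rewrite expgMn ?ez ?mulgVK //; apply: aD; apply: (ED n).
split.
- exact: sE.
- exact: dE.
- move=> g gD; apply/seteqP; split=> [_ [_ [x Dx <-] <-]|z [x]].
    exists (cj g x); last by rewrite cjX.
    by rewrite -gD; exists x.
  rewrite -{1}gD => -[y Dy <-] <-; exists (y ^+ (p ^ n)); first by exists y.
  exact: cjX.
- move=> tD; have [s es] := (finite_seqP _).1 (torsion_part_finite n sD aD fin).
  exists s => x Dx.
  have Ex : E n (x ^+ (p ^ n)) by exists x.
  (* $x$ and $e$ have the same $p^n$-th power, so every coset of [E n] contains one of the finitely
     many elements killed by $p^n$. *)
  have [e Ee ee] := p_divisibleX n (dE tD) Ex.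
  have De := ED _ _ Ee; have DV := subgroupV sD De.
  have : torsion_part (p ^ n) D (x * e^-1).
    split; first exact: subgroupM.
    by rewrite expgMn ?expVgn ?ee ?mulgV //; apply: aD.
  rewrite es => xs; exists (x * e^-1) => //.
  by rewrite invgM invgK -mulgA mulVg mulg1.
Qed.

Lemma coset_cover_sub S T s P : subgroup T -> subgroup P -> P `<=` S ->
  coset_cover S T s -> exists s' : seq gT,
    [/\ (size s' <= size s)%N, forall g, g \in s' -> P g &
      coset_cover P (P `&` T) s'].
Proof.
move=> sT sP PS cov.
have /choice[rep repP] : forall q, exists g, P g /\
    ((exists2 x, P x & T (q^-1 * x)) -> T (q^-1 * g)).
  move=> q; case: (pselect (exists2 x, P x & T (q^-1 * x))) => [[x Px Tx]|nx].
    by exists x.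
  by exists 1; split; [exact: subgroup1|].
exists (map rep s); split; first by rewrite size_map.
  by move=> _ /mapP[q _ ->]; have [] := repP q.
move=> x Px; have [q qs Tq] := cov x (PS _ Px).
exists (rep q); first exact: map_f.
have [Pr /(_ (ex_intro2 _ _ x Px Tq)) Tr] := repP q.
split; first by apply: subgroupM => //; apply: subgroupV.
have -> : (rep q)^-1 * x = (q^-1 * rep q)^-1 * (q^-1 * x).
  by rewrite invgM invgK -mulgA mulVKg.
by apply: subgroupM => //; apply: subgroupV.
Qed.

Lemma coset_cover_trans S T D s t : coset_cover S T s -> coset_cover T D t ->
  coset_cover S D [seq g * h | g <- s, h <- t].
Proof.
move=> cS cT x /cS[g gs /cT[h ht Dx]]; exists (g * h).
  by apply/allpairsP; exists (g, h).
by rewrite invgM -mulgA.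
Qed.

(** The torus of [P] is the divisible part of [P] $\cap$ [T]; it has finite index there, and [P]
    $\cap$ [T] has finite index in [P]. *)
Lemma sub_discrete_p_toral S P :
  discrete_p_toral p S -> subgroup_of S P -> discrete_p_toral p P.
Proof.
move=> [sS [r [T mT]]] [sP PS]; split=> //.
have tS := maximal_torus_p_torsion sS mT.
have [sT [TS nT] tT fin _] := mT.
have aT := torus_abelian sT tT.
pose A := P `&` T.
have sA : subgroup A := subgroupI sP sT.
have aA : abelian_on A by move=> x y [_ Tx] [_ Ty]; apply: aT.
have finA : finite_set (torsion_part p A).
  have := (torus_torsion_part p_pr sT tT 1).1; rewrite expn1.
  by apply: sub_finite_set => x [[_ Tx] xp].
have tA : p_torsion p A by apply: p_torsion_sub tS _ => x [/PS].
have tP : p_torsion p P by apply: p_torsion_sub tS _.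
have [n [sE dE nE cE]] := abelian_divisible_part sA aA finA.
set E := (X in subgroup X) in sE dE nE cE.
have EA : E `<=` A by move=> _ [x Ax <-]; apply: subgroupX.
have [] := @divisible_torus p gT E p_pr sE.
- by move=> x y /EA Ax /EA Ay; apply: aA.
- exact: p_torsion_sub tA EA.
- exact: dE.
- by apply: sub_finite_set finA => x [/EA Ax xp].
move=> r' tE; exists r', E.
have finE : finite_set (left_cosets P E).
  have [s [_ _ cov]] := coset_cover_exists sT fin.
  have [s' [_ _ cov']] := coset_cover_sub sT sP PS cov.
  have [t covt] := cE tA.
  exact: (coset_cover_card sE (coset_cover_trans cov' covt)).1.
split=> //; last exact: p_group_index p_pr sP tP finE.
split; first by move=> x /EA[].
move=> g Pg; apply: nE; apply/cj_imageP => x.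
have /cj_imageP nTg := nT g (PS _ Pg).
have [_ /cj_imageP nPg] := subgroup_normalizer_self sP PS Pg.
by split=> -[Px Tx]; split; [apply/(nPg x)|apply/(nTg x)|apply/(nPg x)|apply/(nTg x)].
Qed.

Lemma toral_orderP S : discrete_p_toral p S -> exists T,
  maximal_torus p (toral_order p S).1 S T /\
  (toral_order p S).2 = ncard (left_cosets S T).
Proof.
move=> [sS [r [T mT]]]; rewrite /toral_order.
case: xgetP => [o -> [T' [mT' eT']]|/(_ (r, ncard (left_cosets S T)))[]].
  by exists T'.
by exists T.
Qed.

(** Rigidity of the order. It plays the role that comparing cardinalities plays for finite
    groups. *)
Lemma toral_order_embedding P Q f : discrete_p_toral p P -> discrete_p_toral p Q ->
  (forall x, P x -> Q (f x)) -> multiplicative_on P f -> injective_on P f ->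
  toral_order_le p P Q /\ (toral_order_le p Q P -> f @` P = Q).
Proof.
move=> tP tQ PQ fM fI.
have [TP [mP eP]] := toral_orderP tP; have [TQ [mQ eQ]] := toral_orderP tQ.
have [le_r le_n] := maximal_torus_embedding tP.1 tQ.1 mP mQ PQ fM fI.
rewrite /toral_order_le !Order.ProdLexiOrder.leEprodlexi !Order.NatOrder.leEnat.
split; first by rewrite le_r /=; apply/implyP => /le_n[]; rewrite -eP -eQ.
move=> /andP[ge_r /implyP/(_ le_r)]; have [_] := le_n ge_r.
by rewrite -eP -eQ.
Qed.

Lemma toral_order_le_trans P Q R : toral_order_le p P Q ->
  toral_order_le p Q R -> toral_order_le p P R.
Proof. exact: Order.POrderTheory.le_trans. Qed.

End ToralOrder.

(** * Morphisms of a fusion system *)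

Section FusionBasics.
Variables (gT : groupType) (S : set gT) (F : hom_family gT).
Hypothesis fusF : fusion_system S F.
Implicit Types (x y g : gT) (P Q R : set gT) (f h : gT -> gT).

Lemma fusion_domS P Q f : F P Q f -> subgroup P.
Proof. by move=> /(fusion_obj fusF)[[]]. Qed.

Lemma fusion_dom_sub P Q f : F P Q f -> P `<=` S.
Proof. by move=> /(fusion_obj fusF)[[]]. Qed.

Lemma fusion_dom P Q f : F P Q f -> subgroup_of S P.
Proof. by move=> /(fusion_obj fusF)[]. Qed.

Lemma fusion_cod P Q f : F P Q f -> subgroup_of S Q.
Proof. by move=> /(fusion_obj fusF)[]. Qed.

Lemma fusion_map P Q f x : F P Q f -> P x -> Q (f x).
Proof. by move=> /(fusion_inj fusF)/inj_homP[fPQ _ _]; apply: fPQ. Qed.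

Lemma fusion_mul P Q f : F P Q f -> multiplicative_on P f.
Proof. by move=> /(fusion_inj fusF)/inj_homP[]. Qed.

Lemma fusion_injective P Q f : F P Q f -> injective_on P f.
Proof. by move=> /(fusion_inj fusF)/inj_homP[]. Qed.

Lemma fusion_eq P Q f h : F P Q f -> (forall x, P x -> h x = f x) -> F P Q h.
Proof.
by move=> Ff e; apply: (fusion_ext fusF _ Ff) => x /set_mem Px; rewrite e.
Qed.

Lemma fusion_image P Q f : F P Q f -> subgroup_of S (f @` P).
Proof.
move=> Ff; split; first exact: subgroup_image (fusion_domS Ff) (fusion_mul Ff).
by move=> _ [x Px <-]; apply: (fusion_cod Ff).2; apply: (fusion_map Ff).
Qed.

Lemma fusion_cj P Q g : subgroup_of S P -> subgroup_of S Q -> S g ->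
  (forall x, P x -> Q (cj g x)) -> F P Q (cj g).
Proof.
move=> sP sQ Sg PQ; apply: (fusion_conj fusF) => //; exists g => //.
by split=> // _ [x Px <-]; apply: PQ.
Qed.

Lemma fusion_incl P Q f : subgroup S -> subgroup_of S P -> subgroup_of S Q ->
  (forall x, P x -> f x = x) -> P `<=` Q -> F P Q f.
Proof.
move=> sS sP sQ fid PQ; apply: (fusion_eq (f := cj 1)).
  by apply: fusion_cj => // [|x Px]; [exact: subgroup1|rewrite cj1; apply: PQ].
by move=> x Px; rewrite cj1 fid.
Qed.

(** The source shrinks by composing with an inclusion; the target changes because a morphism factors
    through its image. *)
Lemma fusion_restrict P Q f P' Q' : subgroup S -> F P Q f ->
  subgroup P' -> P' `<=` P -> subgroup_of S Q' ->
  (forall x, P' x -> Q' (f x)) -> F P' Q' f.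
Proof.
move=> sS Ff sP' P'P sQ' fP'.
have sSP' : subgroup_of S P' by split=> // x /P'P; apply: (fusion_dom Ff).2.
have F1 : F P' Q f.
  apply: (fusion_comp fusF (f := id) (h := f) _ Ff).
  by apply: fusion_incl => //; apply: fusion_dom Ff.
have [F2 _] := fusion_factor fusF F1.
apply: (fusion_comp fusF (h := id) F2); apply: fusion_incl => //.
  exact: fusion_image F1.
by move=> _ [x Px <-]; apply: fP'.
Qed.

Lemma isoF_inv P Q f : isoF F P Q f -> exists h,
  [/\ F P Q f, F Q P h, (forall x, P x -> h (f x) = x) &
      forall y, Q y -> f (h y) = y].
Proof.
move=> [Ff [h Fh [hf fh]]]; exists h; split=> //.
  by move=> x Px; apply: hf; apply: mem_set.
by move=> y Qy; apply: fh; apply: mem_set.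
Qed.

Lemma isoF_intro P Q f h : F P Q f -> F Q P h ->
  (forall x, P x -> h (f x) = x) -> (forall y, Q y -> f (h y) = y) ->
  isoF F P Q f.
Proof.
move=> Ff Fh hf fh; split=> //; exists h => //.
by split=> [x /set_mem|y /set_mem]; [exact: hf|exact: fh].
Qed.

Lemma isoF_image P Q f : isoF F P Q f -> f @` P = Q.
Proof.
move=> /isoF_inv[h [Ff Fh hf fh]]; apply/seteqP; split=> [_ [x Px <-]|y Qy].
  exact: fusion_map Ff _.
by exists (h y); [exact: fusion_map Fh _|exact: fh].
Qed.

Lemma isoF_onto P Q f : F P Q f -> (forall y, Q y -> exists2 x, P x & f x = y) ->
  isoF F P Q f.
Proof.
move=> Ff onto; have := fusion_factor fusF Ff.
suff -> : f @` P = Q by [].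
by apply/seteqP; split=> [_ [x Px <-]|y /onto[x Px <-]]; [exact: fusion_map Ff _|exists x].
Qed.

Lemma isoF_sym P Q f : isoF F P Q f -> exists2 h, isoF F Q P h &
  (forall x, P x -> h (f x) = x) /\ (forall y, Q y -> f (h y) = y).
Proof.
by move=> /isoF_inv[h [Ff Fh hf fh]]; exists h => //; exact: isoF_intro Fh Ff fh hf.
Qed.

Lemma isoF_comp P Q R f h : isoF F P Q f -> isoF F Q R h -> isoF F P R (h \o f).
Proof.
move=> /isoF_inv[f' [Ff Ff' f'f ff']] /isoF_inv[h' [Fh Fh' h'h hh']].
apply: (isoF_intro (h := f' \o h')); [exact: fusion_comp fusF _ _ _ _ _ Ff Fh|exact: fusion_comp fusF _ _ _ _ _ Fh' Ff'| |].
  by move=> x Px /=; rewrite h'h ?f'f //; apply: (fusion_map Ff).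
by move=> x Rx /=; rewrite ff' ?hh' //; apply: (fusion_map Fh').
Qed.

Lemma isoF_eq P Q f h : isoF F P Q f -> (forall x, P x -> h x = f x) ->
  isoF F P Q h.
Proof.
move=> isof e; have /isoF_inv[k [Ff Fk kf fk]] := isof.
apply: (isoF_intro (h := k)) => //; first exact: fusion_eq Ff e.
  by move=> x Px; rewrite e ?kf.
by move=> y Qy; rewrite e ?fk //; apply: (fusion_map Fk).
Qed.

Lemma AutS_AutF P : subgroup S -> subgroup_of S P -> AutS S P `<=` AutF F P.
Proof.
move=> sS sP f [g ng fg]; have /normalizerP[Sg nP] := ng.
apply: (isoF_eq (f := cj g)); last by move=> x Px; apply: fg; apply: mem_set.
apply: isoF_onto; first by apply: fusion_cj => // x /nP.
by move=> y Py; exists (cj g^-1 y); [apply/nP; rewrite cjVK|rewrite cjVK].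
Qed.

Lemma isoF_cj P Q f g x : isoF F P Q f -> P g -> P x ->
  f (cj g x) = cj (f g) (f x).
Proof.
by move=> [Ff _]; apply: multiplicative_on_cj (fusion_domS Ff) (fusion_mul Ff).
Qed.

Lemma out_classP P f h : subgroup P -> (forall x, P x -> P (f x)) ->
  (forall x, P x -> P (h x)) ->
  out_class P f = out_class P h <->
  exists2 g, P g & forall x, P x -> h x = cj g (f x).
Proof.
move=> sP fP hP; split=> [e|[g Pg e]].
  have : out_class P f h.
    by rewrite e; exists 1; [exact: subgroup1|move=> x _ /=; rewrite cj1].
  by move=> [g Pg hg]; exists g => // x Px; apply: hg; apply: mem_set.
apply/seteqP; split=> k [a Pa ka].
  exists (a * g^-1); first exact: sP.2.
  move=> x xP; rewrite ka //= e; last exact: set_mem.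
  by rewrite cj_comp cjK.
exists (a * g); first exact: subgroupM.
by move=> x xP; rewrite ka //= e ?cj_comp //; apply: set_mem.
Qed.

End FusionBasics.

(** A correspondence, total on both sides, that respects the equivalences defined by [c] and [c']
    induces a bijection of classes. It transports counts of outer automorphisms; [v0] is a default
    value for the choice of representatives. *)
Lemma ncard_corr (X Y : Type) (U V : choiceType) (B : set X) (B' : set Y)
    (c : X -> U) (c' : Y -> V) (v0 : V) (R : X -> Y -> Prop) :
  (forall b, B b -> exists2 b', B' b' & R b b') ->
  (forall b', B' b' -> exists2 b, B b & R b b') ->
  (forall b1 b1' b2 b2', B b1 -> B b2 -> B' b1' -> B' b2' -> R b1 b1' -> R b2 b2' ->
    c b1 = c b2 <-> c' b1' = c' b2') ->
  finite_set (c @` B) ->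
  finite_set (c' @` B') /\ ncard (c' @` B') = ncard (c @` B).
Proof.
move=> tot tot' ker fin.
have /choice[r rP] : forall u, exists v, forall b, B b -> c b = u ->
    exists b', [/\ B' b', R b b' & c' b' = v].
  move=> u; case: (pselect (exists2 b, B b & c b = u)) => [[b Bb bu]|nb].
    have [b' Bb' Rb] := tot _ Bb; exists (c' b') => d Bd du.
    have [d' Bd' Rd] := tot _ Bd; exists d'; split=> //.
    by apply/(ker d d' b b') => //; rewrite du bu.
  by exists v0 => b Bb bu; case: nb; exists b.
have rI : injective_on (c @` B) r.
  move=> _ _ [b1 Bb1 <-] [b2 Bb2 <-] e.
  have [b1' [Bb1' R1 e1]] := rP _ b1 Bb1 erefl.
  have [b2' [Bb2' R2 e2]] := rP _ b2 Bb2 erefl.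
  by apply/(ker b1 b1' b2 b2') => //; rewrite e1 e2.
have -> : c' @` B' = r @` (c @` B).
  apply/seteqP; split=> [_ [b' Bb' <-]|_ [_ [b Bb <-] <-]].
    have [b Bb Rb] := tot' _ Bb'; exists (c b); first by exists b.
    have [d' [Bd' Rd <-]] := rP _ b Bb erefl.
    exact/(ker b d' b b').
  by have [b' [Bb' _ <-]] := rP _ b Bb erefl; exists b'.
by split; [exact: finite_image|exact: ncard_image].
Qed.

(** * Fixed points of $p$-groups in centers *)

Section CentralFixpoints.
Variables (p : nat) (gT : groupType).
Hypothesis p_pr : prime p.
Implicit Types (x y g h : gT) (P Q S T D H : set gT) (f : gT -> gT).

Lemma p_torsion_part_neq1 D x : subgroup D -> p_torsion p D -> D x -> x <> 1 ->
  exists2 y, torsion_part p D y & y <> 1.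
Proof.
move=> sD tD Dx; have [n] := tD x Dx; elim: n x Dx => [|n IH] x Dx xn x1.
  by case: x1; move: xn; rewrite expg1.
have [xp|/eqP xp] := eqVneq (x ^+ p) 1; first by exists x.
by apply: (IH (x ^+ p)) => //; [exact: subgroupX|rewrite -expgnA -expnS].
Qed.

(** [D] acts transitively on itself by translation, so its cardinality is a power of $p$, and it is
    not 1. *)
Lemma p_dvd_ncard D x : subgroup D -> p_torsion p D -> finite_set D -> D x ->
  x <> 1 -> (p %| ncard D)%N.
Proof.
move=> sD tD fin Dx x1.
have [k ek] : exists k, ncard D = (p ^ k)%N.
  apply: (@pgroup_transitive p gT _ D D (fun g x => g * x) p_pr sD tD fin
    _ _ _ 1) => //.
  - by move=> g y; apply: subgroupM.
  - by move=> g h y _ _ _; rewrite mulgA.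
  - by move=> y _; rewrite mul1g.
  - exact: subgroup1.
  - by move=> y Dy; exists y; rewrite ?mulg1.
case: k ek => [|k] ek; last by rewrite ek expnS dvdn_mulr.
have : ([set 1; x] : set gT) = D.
  apply: ncard_le_eq => //; first by move=> y [->|->] //; apply: subgroup1.
  by rewrite ek expn0; apply: (ncard_gt0 (x := 1)); [exact: finite_set2|left].
move=> e; have : ([set 1] : set gT) = [set 1; x].
  apply: ncard_le_eq; [exact: finite_set2|by move=> y ->; left|].
  by rewrite e ek expn0; apply: (ncard_gt0 (x := 1)); [exact: finite_set1|].
by move/seteqP => -[_ sub]; case: x1; apply: (sub x); right.
Qed.

Lemma p_group_fixpoint D H x : subgroup D -> p_torsion p D -> finite_set D ->
  D x -> x <> 1 -> subgroup H -> p_torsion p H ->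
  (forall h y, H h -> D y -> D (cj h y)) ->
  exists y, [/\ D y, y <> 1 & forall h, H h -> cj h y = y].
Proof.
move=> sD tD fin Dx x1 sH tH HD.
apply: (@pgroup_fixpoint p gT _ H D (@cj gT)) => //.
- by move=> g h y _ _ _; apply: cj_comp.
- by move=> y _; apply: cj1.
- exact: p_dvd_ncard x1.
- exact: subgroup1.
- by move=> h _; apply: cj_1.
Qed.

(** This is $\Omega_1(Z(P))$, as [centralizer P P] is the center. *)
Definition omega_center P : set gT := torsion_part p (centralizer P P).

Variable S : set gT.
Hypothesis tS : discrete_p_toral p S.

Lemma discrete_p_toral_p_torsion : p_torsion p S.
Proof. by have [sS [r [T mT]]] := tS; apply: maximal_torus_p_torsion mT. Qed.

Lemma subgroup_omega_center P : subgroup P -> subgroup (omega_center P).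
Proof.
move=> sP; have sZ := subgroup_centralizer P sP.
split; first by split; [exact: subgroup1|rewrite expg1n].
move=> x y [Zx xp] [Zy yp]; split; first exact: sZ.2.
rewrite expgMn; last by apply: commuteV; apply: Zx.2; apply: Zy.1.
by rewrite expVgn xp yp invg1 mulg1.
Qed.

(** [D] need not lie in the torus, but two $p$-torsion elements in one coset of [T] differ by
    $p$-torsion of [T], and there are finitely many cosets. *)
Lemma torsion_part_ab_finite D : subgroup D -> D `<=` S -> abelian_on D ->
  finite_set (torsion_part p D).
Proof.
move=> sD DS aD; have [_ [r [T [sT _ tT fin _]]]] := tS.
have [s [_ _ cov]] := coset_cover_exists sT fin.
have finT := (torus_torsion_part p_pr sT tT 1).1; rewrite expn1 in finT.
pose B q := [set x | torsion_part p D x /\ T (q^-1 * x)].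
have finB q : finite_set (B q).
  case: (pselect (exists x0, B q x0)) => [[x0 [[Dx0 x0p] Tx0]]|nB]; last first.
    by apply: sub_finite_set (finite_set0 gT) => x Bx; case: nB; exists x.
  apply: (injective_finite (C := torsion_part p T) (f := fun x => x0^-1 * x)) => //.
    move=> _ [x [[Dx xp] Tx] <-]; split.
      have -> : x0^-1 * x = (q^-1 * x0)^-1 * (q^-1 * x).
        by rewrite invgM invgK -mulgA mulVKg.
      by apply: subgroupM => //; apply: subgroupV.
    rewrite expgMn; last by apply/commute_sym/commuteV/aD.
    by rewrite expVgn x0p xp invg1 mulg1.
  by move=> x y _ _ /mulgI.
apply: (@sub_finite_set _ _ (\bigcup_(q in [set` s]) B q)).
  by move=> x [Dx xp]; have [q qs Tq] := cov x (DS _ Dx); exists q.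
by apply: bigcup_finite => //; exact: finite_seq.
Qed.

Lemma omega_center_finite P : subgroup_of S P -> finite_set (omega_center P).
Proof.
move=> [sP PS]; apply: torsion_part_ab_finite.
- exact: subgroup_centralizer.
- by move=> x [/PS].
- by move=> x y [_ cx] [Py _]; apply: cx.
Qed.

(** If $P\cap T\ne1$, then [P] acts on the finite $p$-torsion of $P\cap T$ and fixes a nontrivial
    element. Otherwise [P] embeds in $S/T$, is finite, and acts on itself. *)
Lemma omega_center_neq1 P x : subgroup_of S P -> P x -> x <> 1 ->
  exists2 z, omega_center P z & z <> 1.
Proof.
move=> [sP PS] Px x1; have tP := p_torsion_sub discrete_p_toral_p_torsion PS.
have sZ := subgroup_centralizer P sP.
have tZ : p_torsion p (centralizer P P) by apply: p_torsion_sub tP _ => y [].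
suff [z [Pz z1 cz]] : exists z, [/\ P z, z <> 1 & forall g, P g -> cj g z = z].
  apply: p_torsion_part_neq1 z1 => //; split=> // y Py.
  by apply/esym/cj_fixP/cz.
have [_ [r [T [sT [TS nT] tT fin _]]]] := tS.
have sA := subgroupI sP sT.
have [[a [Aa a1]]|nA] := pselect (exists a, (P `&` T) a /\ a <> 1).
  have tA : p_torsion p (P `&` T) by apply: p_torsion_sub tP _ => y [].
  have aA : abelian_on (P `&` T).
    by move=> u v [_ Tu] [_ Tv]; apply: (torus_abelian sT tT).
  have [b bA b1] := p_torsion_part_neq1 sA tA Aa a1.
  have finA : finite_set (torsion_part p (P `&` T)).
    by apply: torsion_part_ab_finite => // y [_ /TS].
  have sD : subgroup (torsion_part p (P `&` T)).
    split; first by split; [exact: subgroup1|rewrite expg1n].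
    move=> u v [Au up] [Av vp]; split; first exact: sA.2.
    rewrite expgMn; last by apply: commuteV; apply: aA.
    by rewrite expVgn up vp invg1 mulg1.
  have tD : p_torsion p (torsion_part p (P `&` T)).
    by apply: p_torsion_sub tA _ => y [].
  have [|z [[[Pz _] _] z1 cz]] := p_group_fixpoint sD tD finA bA b1 sP tP.
    move=> h y Ph [[Py Ty] yp]; split; last by rewrite -cjX yp cj_1.
    split; first exact: subgroup_cj.
    have /cj_imageP nTh := nT h (PS _ Ph); exact: (nTh y).1 Ty.
  by exists z.
have finP : finite_set P.
  have [s [_ _ cov]] := coset_cover_exists sT fin.
  have [s' [_ _ cov']] := coset_cover_sub sT sP PS cov.
  apply: sub_finite_set (finite_seq s') => y /cov'[q qs Aq].
  have [e|/eqP ne] := eqVneq (q^-1 * y) 1; last by case: nA; exists (q^-1 * y).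
  by have -> : y = q by rewrite -[y](mulVKg q) e mulg1.
by apply: (p_group_fixpoint sP tP finP Px x1 sP tP) => h y; apply: subgroup_cj.
Qed.

Lemma omega_center_fixpoint P H x : subgroup_of S P -> P x -> x <> 1 ->
  subgroup H -> H `<=` normalizer S P ->
  exists y, [/\ omega_center P y, y <> 1 & forall h, H h -> cj h y = y].
Proof.
move=> sSP Px x1 sH HN; have [sP PS] := sSP.
have tS' := discrete_p_toral_p_torsion.
have [z zO z1] := omega_center_neq1 sSP Px x1.
apply: (p_group_fixpoint (subgroup_omega_center sP) _ (omega_center_finite sSP)
   zO z1 sH).
- by apply: p_torsion_sub tS' _ => y [[/PS]].
- by apply: p_torsion_sub tS' _ => y /HN[].
move=> h y /HN /normalizerP[Sh nP] [[Py cy] yp]; split; last first.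
  by rewrite -cjX yp cj_1.
split=> [|u Pu]; first exact: (nP y).1 Py.
by rewrite -[u](cjVK h) -!cjM cy //; apply/nP; rewrite cjVK.
Qed.

Lemma has_order_p x : x <> 1 -> x ^+ p = 1 -> has_order x p.
Proof.
move=> x1 xp; split=> //; first exact: prime_gt0.
move=> m /andP[m0 mp] xm; case: x1.
have cop : coprime m p by rewrite coprime_sym prime_coprime // gtnNdvd.
case: (egcdnP p m0) => c kn; rewrite (eqP (cop : gcdn m p == 1%N)) => ec _.
have : x ^+ (c * m) = 1 by rewrite mulnC expgnA xm expg1n.
by rewrite ec expgnDr mulnC expgnA xp expg1n mul1g expg1.
Qed.

End CentralFixpoints.

(** * Outer automorphism groups *)

Lemma p_elements_pgroup (p : nat) (rT : finGroupType) (G : {group rT}) :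
  prime p -> (forall s, s \in G -> exists n, (s ^+ (p ^ n) = 1)%g) -> p.-group G.
Proof.
move=> p_pr tG; apply/pgroupP => q q_pr /(Cauchy q_pr)[s /tG[n /eqP]].
rewrite -order_dvdn => + so; rewrite so Euclid_dvdX // => /andP[qp _].
by rewrite inE -(dvdn_prime2 q_pr p_pr).
Qed.

Section OuterAutomorphisms.
Variables (gT : groupType) (S : set gT) (F : hom_family gT).
Hypotheses (fusF : fusion_system S F) (sS : subgroup S).
Implicit Types (x y g : gT) (P Q R : set gT) (f h : gT -> gT).

Lemma out_class_eq P f h : (forall x, P x -> f x = h x) ->
  out_class P f = out_class P h.
Proof.
move=> e; apply/seteqP; split=> k [g Pg kg]; exists g => // x Px.
  by rewrite kg //= e //; exact: set_mem Px.
by rewrite kg //= e //; exact: set_mem Px.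
Qed.

Lemma AutF_map P f x : AutF F P f -> P x -> P (f x).
Proof. by move=> [Ff _]; apply: (fusion_map fusF Ff). Qed.

Lemma AutF_id P : subgroup_of S P -> AutF F P id.
Proof.
by move=> sP; apply: (isoF_intro (h := id)) => //; apply: (fusion_incl fusF).
Qed.

Lemma AutF_comp P f h : AutF F P f -> AutF F P h -> AutF F P (f \o h).
Proof. by move=> Af Ah; exact: (isoF_comp fusF Ah Af). Qed.

Definition out_act P f (c : set (gT -> gT)) : set (gT -> gT) :=
  [set k | exists2 h, c h & forall x, P x -> k x = h (f x)].

Lemma out_actE P f h : (forall x, P x -> P (f x)) ->
  out_act P f (out_class P h) = out_class P (h \o f).
Proof.
move=> fP; apply/seteqP; split=> k.
  move=> [h' [g Pg hg] kE]; exists g => // x /set_mem Px.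
  by rewrite kE // hg //; apply: mem_set; apply: fP.
move=> [g Pg kE]; exists (cj g \o h); first by exists g.
by move=> x Px; rewrite kE //; apply: mem_set.
Qed.

(** The regular representation of $\operatorname{Out}_{\mathcal F}(P)$, by precomposition; as
    permutations compose from left to right, [pi] is not reversed. It makes Sylow theory
    available. *)
Lemma outer_representation P : subgroup_of S P -> finite_set (OutF F P) ->
  exists (rT : finGroupType) (pi : (gT -> gT) -> rT),
    (forall f h, AutF F P f -> AutF F P h -> pi (f \o h) = (pi f * pi h)%g) /\
    (forall f h, AutF F P f -> AutF F P h ->
       pi f = pi h <-> out_class P f = out_class P h).
Proof.
move=> sP fin; pose sT : finType := fset_set (OutF F P).
have valE (u : sT) : exists2 h, AutF F P h & val u = out_class P h.
  have : val u \in OutF F P by rewrite -in_fset_set //; apply: valP.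
  by move=> /set_mem[h Ah <-]; exists h.
have lift h : AutF F P h -> exists u : sT, val u = out_class P h.
  move=> Ah; have hO : out_class P h \in fset_set (OutF F P).
    by rewrite in_fset_set //; apply: mem_set; exists h.
  by exists [` hO]%fset.
have /choice[s sE] : forall f, exists s : {perm sT}, AutF F P f ->
    forall u, val (s u) = out_act P f (val u).
  move=> f; case: (pselect (AutF F P f)) => [Af|nA]; last by exists 1%g.
  have fP x := @AutF_map P f x Af.
  have /choice[t tE] : forall u : sT, exists v : sT, val v = out_act P f (val u).
    move=> u; have [h Ah ->] := valE u.
    by rewrite out_actE //; apply: lift; apply: AutF_comp.
  have tI : injective t.
    move=> u v /(congr1 val); rewrite !tE.
    have [h Ah hE] := valE u; have [k Ak kE] := valE v.
    rewrite hE kE !out_actE // => e; apply: val_inj; rewrite hE kE.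
    have [f' Af' [f'f ff']] := isoF_sym Af.
    have fP' x := @AutF_map P f' x Af'.
    have := congr1 (out_act P f') e; rewrite !out_actE // => e'.
    rewrite (@out_class_eq _ h ((h \o f) \o f')) ?e' => [|x Px /=]; last by rewrite ff'.
    by apply: out_class_eq => x Px /=; rewrite ff'.
  by exists (perm tI) => _ u; rewrite permE.
exists {perm sT}, s; split=> f h Af Ah.
  apply/permP => u; apply: val_inj; rewrite permM !sE //; last exact: AutF_comp.
  have [k Ak ->] := valE u.
  have fP x := @AutF_map P f x Af; have hP x := @AutF_map P h x Ah.
  by rewrite !out_actE // => x Px /=; apply/fP/hP.
have fP x := @AutF_map P f x Af; have hP x := @AutF_map P h x Ah.
split=> [e|e].
  have [u uE] := lift id (AutF_id sP).
  by have := sE f Af u; rewrite e sE // uE !out_actE.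
apply/permP => u; apply: val_inj; rewrite !sE //.
have [k Ak ->] := valE u; rewrite !out_actE //.
have kP x := @AutF_map P k x Ak.
apply/out_classP => //; [exact: sP.1|by move=> x Px /=; apply/kP/fP|by move=> x Px /=; apply/kP/hP|].
have [g Pg gE] := (out_classP sP.1 fP hP).1 e.
exists (k g); first exact: kP.
by move=> x Px /=; rewrite gE // (isoF_cj fusF Ak) //; apply: fP.
Qed.

(** Transport along [f] turns conjugation by $g$ into conjugation by $f(g)$, so inner automorphisms
    correspond. *)
Lemma out_class_transport P P' f a b a' b' : isoF F P P' f ->
  (forall x, P x -> P (a x)) -> (forall x, P x -> P (b x)) ->
  (forall x, P x -> a' (f x) = f (a x)) -> (forall x, P x -> b' (f x) = f (b x)) ->
  out_class P a = out_class P b <-> out_class P' a' = out_class P' b'.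
Proof.
move=> isof aP bP aE bE; have [f' isof' [f'f ff']] := isoF_sym isof.
have fP x : P x -> P' (f x) by apply: (fusion_map fusF isof.1).
have fP' x : P' x -> P (f' x) by apply: (fusion_map fusF isof'.1).
have aP' x : P' x -> P' (a' x).
  by move=> Px; rewrite -[x]ff' // aE; [apply/fP/aP/fP'|apply: fP'].
have bP' x : P' x -> P' (b' x).
  by move=> Px; rewrite -[x]ff' // bE; [apply/fP/bP/fP'|apply: fP'].
have sP := fusion_domS fusF isof.1; have sP' := fusion_domS fusF isof'.1.
split=> [/(out_classP sP aP bP)|/(out_classP sP' aP' bP')] [g Pg gE].
  apply/(out_classP sP' aP' bP'); exists (f g); first exact: fP.
  move=> x Px; have Px' := fP' _ Px; have Pa := aP _ Px'.
  by rewrite -[x]ff' // aE // bE // gE // (isoF_cj fusF isof).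
apply/(out_classP sP aP bP); exists (f' g); first exact: fP'.
move=> x Px; have Pa := aP _ Px; have Pb := bP _ Px.
rewrite -[LHS]f'f // -bE // gE ?aE //; last exact: fP.
by rewrite (isoF_cj fusF isof') ?f'f //; apply: fP.
Qed.

End OuterAutomorphisms.

Section OuterGroups.
Variables (p : nat) (gT : groupType) (S : set gT) (F : hom_family gT).
Hypotheses (p_pr : prime p) (tS : discrete_p_toral p S).
Hypothesis (fusF : fusion_system S F).
Variables (P : set gT) (rT : finGroupType) (pi : (gT -> gT) -> rT).
Hypothesis sP : subgroup_of S P.
Hypothesis piM : forall f h, AutF F P f -> AutF F P h ->
  pi (f \o h) = (pi f * pi h)%g.
Hypothesis piE : forall f h, AutF F P f -> AutF F P h ->
  pi f = pi h <-> out_class P f = out_class P h.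
Implicit Types (x y g : gT) (f h : gT -> gT) (B : set (gT -> gT)).

Let sS : subgroup S := tS.1.

Definition out_image B : {set rT} :=
  [set s : rT | `[< exists2 f, B f & pi f = s >]]%SET.

Lemma out_imageP B s :
  reflect (exists2 f, B f & pi f = s) (s \in out_image B).
Proof. by apply: (iffP idP); rewrite inE => /asboolP. Qed.

Lemma pi_id : pi id = 1%g.
Proof.
have := piM (AutF_id fusF sS sP) (AutF_id fusF sS sP).
by move=> e; apply: (mulgI (pi id)); rewrite -e mulg1.
Qed.

Lemma out_image_group_set B : B `<=` AutF F P -> B id ->
  (forall f h, B f -> B h -> B (f \o h)) -> group_set (out_image B).
Proof.
move=> BA Bid BM; apply/group_setP; split.
  by apply/out_imageP; exists id; rewrite ?pi_id.
move=> _ _ /out_imageP[f Bf <-] /out_imageP[h Bh <-].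
apply/out_imageP; exists (f \o h); first exact: BM.
by apply: piM; apply: BA.
Qed.

Lemma card_out_image B : B `<=` AutF F P -> finite_set (out_class P @` B) ->
  #|out_image B| = ncard (out_class P @` B).
Proof.
move=> BA fin.
have [_ <-] : finite_set (pi @` B) /\ ncard (pi @` B) = ncard (out_class P @` B).
  apply: (ncard_corr 1%g (R := eq)) fin => [b Bb|b Bb|b1 _ b2 _ B1 B2 _ _ <- <-].
  - by exists b.
  - by exists b.
  by apply: iff_sym; apply: piE; apply: BA.
have e : fset_set (pi @` B) = [fset s in out_image B]%fset.
  apply/fsetP => s; rewrite in_fset_set; last exact: finite_finset.
  rewrite in_fset /=; apply/idP/out_imageP => [/set_mem[f Bf <-]|[f Bf <-]].
    by exists f.
  by apply: mem_set; exists f.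
by rewrite /ncard e card_finset.
Qed.

Lemma AutS_image_pgroup (G : {group rT}) : G = out_image (AutS S P) :> {set rT} ->
  p.-group G.
Proof.
move=> eG; apply: p_elements_pgroup => // s; rewrite eG => /out_imageP[f Af <-].
have [g ng fg] := Af; have [n gn] := discrete_p_toral_p_torsion p_pr tS (normalizer_sub ng).
have sN := subgroup_normalizer P sS.
have Acj u : normalizer S P u -> AutF F P (cj u).
  by move=> nu; apply: (AutS_AutF fusF sS sP); exists u.
have piX k : (pi (cj g) ^+ k)%g = pi (cj (g ^+ k)).
  elim: k => [|k IH].
    rewrite expg0 -pi_id; apply/piE; [exact: (AutF_id fusF)|exact: Acj (subgroup1 sN)|].
    by apply: out_class_eq => x _; rewrite cj1.
  have nk : normalizer S P (g ^+ k) := subgroupX k sN ng.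
  rewrite expgS IH -piM; [|exact: Acj|exact: Acj].
  apply/piE; [by apply: (AutF_comp fusF); exact: Acj|exact: Acj (subgroupX k.+1 sN ng)|].
  by apply: out_class_eq => x _; rewrite /= expgS cj_comp.
exists n; have -> : pi f = pi (cj g).
  apply/piE; [exact: (AutS_AutF fusF)|exact: Acj|].
  by apply: out_class_eq => x Px; apply: fg; apply: mem_set.
rewrite piX gn -pi_id; apply/piE; [exact: Acj (subgroup1 sN)|exact: (AutF_id fusF)|].
by apply: out_class_eq => x _; rewrite cj1.
Qed.

Lemma AutF_omega f x : AutF F P f -> omega_center p P x -> omega_center p P (f x).
Proof.
move=> Af [[Px cx] xp]; have fP y := @AutF_map _ _ _ fusF P f y Af.
have fM := fusion_mul fusF Af.1.
split; last first.
  by rewrite -(multiplicative_onX p sP.1 fM) // xp (multiplicative_on1 sP.1 fM).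
split=> [|y Py]; first exact: fP.
have [f' [Ff' _] [_ ff']] := isoF_sym Af.
have Py' := fusion_map fusF Ff' Py.
by rewrite -[y]ff' // -!fM ?cx.
Qed.

(* Inner automorphisms act trivially on the center, so a p-subgroup of the *)
(* outer automorphism group acts on the finite p-group omega_center.       *)
Lemma outer_p_fixpoint (G : {group rT}) x : G \subset out_image (AutF F P) ->
  p.-group G -> P x -> x <> 1 ->
  exists y, [/\ omega_center p P y, y <> 1 &
    forall f, AutF F P f -> pi f \in G -> f y = y].
Proof.
move=> GA pG Px x1; have [z Oz z1] := omega_center_neq1 p_pr tS sP Px x1.
have sO := subgroup_omega_center p sP.1.
have finO := omega_center_finite p_pr tS sP.
have tO : p_torsion p (omega_center p P).
  by apply: p_torsion_sub (discrete_p_toral_p_torsion p_pr tS) _ => y [[/sP.2]].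
have /choice[sel selP] : forall s, exists f, s \in G -> AutF F P f /\ pi f = s.
  move=> s; have [sG|] := boolP (s \in G); last by exists id.
  by have /out_imageP[f Af fs] := fintype.subsetP GA s sG; exists f.
have pi_eq f h y : AutF F P f -> AutF F P h -> pi f = pi h ->
    omega_center p P y -> f y = h y.
  move=> Af Ah /(piE Af Ah).
  have fP u := @AutF_map _ _ _ fusF P f u Af; have hP u := @AutF_map _ _ _ fusF P h u Ah.
  move=> /(out_classP sP.1 fP hP)[g Pg gE] Oy; have [[Py _] _] := Oy.
  rewrite gE //; apply/esym/cj_fixP; have [[_ cf] _] := AutF_omega Af Oy.
  by rewrite cf.
have sG : subgroup [set s | s \in G] by split; [exact: group1|move=> s t /= sG tG; rewrite groupM ?groupV].
have selG s y : s \in G -> omega_center p P y -> omega_center p P (sel s y).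
  by move=> /selP[As _]; apply: AutF_omega.
have id_fix f y : AutF F P f -> pi f = 1%g -> omega_center p P y -> f y = y.
  by move=> Af f1; apply: pi_eq => //; [exact: (AutF_id fusF)|rewrite pi_id].
have [||||||y [Oy y1 fixy]] := @pgroup_fixpoint p rT _ [set s | s \in G]
    (omega_center p P) sel p_pr sG _ finO selG _ _ 1.
- move=> s /= sG'; have [n on] := p_natP (pnat_dvd (order_dvdG sG') pG).
  by exists n; rewrite -on expg_order.
- move=> s t y /= sG' tG Oy.
  have [As es] := selP _ sG'; have [At et] := selP _ tG.
  have [Ast est] := selP _ (groupM sG' tG).
  have Ac := AutF_comp fusF As At.
  have e : pi (sel (s * t)%g) = pi (sel s \o sel t) by rewrite est piM // es et.
  exact: (pi_eq _ _ y Ast Ac e Oy).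
- by move=> y Oy; have [A1 e1] := selP _ (group1 G); apply: id_fix.
- exact: p_dvd_ncard tO finO Oz z1.
- exact: subgroup1.
- move=> s sG'; have [As _] := selP _ sG'.
  exact: multiplicative_on1 sP.1 (fusion_mul fusF As.1).
exists y; split=> // f Af fG; have [As es] := selP _ fG.
by rewrite -[RHS](fixy (pi f) fG); apply: pi_eq.
Qed.

End OuterGroups.

(** * Centralizer fusion systems *)

Section CentralizerFusion.
Variables (p : nat) (gT : groupType) (S : set gT) (F : hom_family gT).
Hypotheses (p_pr : prime p) (tS : discrete_p_toral p S).
Hypothesis (fusF : fusion_system S F).
Implicit Types (x y g : gT) (P Q R : set gT) (f h : gT -> gT).

Let sS : subgroup S := tS.1.

Local Notation C x := (centralizer S [set x]).

Lemma adjoin_id P x : subgroup P -> P x -> adjoin P x = P.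
Proof.
by move=> sP Px; apply/seteqP; split; [apply: adjoin_sub|exact: sub_adjoin].
Qed.

(** If $x$ already lies in [P] and [Q], adjoining it changes nothing and the extension can only be
    [f]. *)
Lemma C_fusionP x P Q f : P x -> Q x ->
  C_fusion S F x P Q f <->
  [/\ subgroup_of (C x) P, subgroup_of (C x) Q, F P Q f & f x = x].
Proof.
move=> Px Qx; split=> [[sP sQ Ff [h _ [hf hx]]]|[sP sQ Ff fx]].
  by split=> //; rewrite -hf //; apply: mem_set.
split=> //; exists f => //; rewrite !adjoin_id //; [exact: sQ.1|exact: sP.1].
Qed.

Lemma isoF_C x P Q f : P x -> isoF (C_fusion S F x) P Q f <->
  [/\ subgroup_of (C x) P, subgroup_of (C x) Q, isoF F P Q f & f x = x].
Proof.
move=> Px; split=> [isof|[sP sQ isof fx]].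
  have [h [[sP sQ Ff [f' _ [f'f f'x]]] [_ _ Fh _] hf fh]] := isoF_inv isof.
  by split=> //; [exact: isoF_intro Ff Fh hf fh|rewrite -f'f //; apply: mem_set].
have [h [Ff Fh hf fh]] := isoF_inv isof.
have Qx : Q x by rewrite -fx; apply: (fusion_map fusF Ff).
have hx : h x = x by rewrite -{1}fx hf.
by apply: (isoF_intro (h := h)) => //; apply/C_fusionP.
Qed.

Lemma fusion_order_le P Q f A B : F P Q f -> subgroup A -> A `<=` P ->
  subgroup_of S B -> (forall x, A x -> B (f x)) ->
  toral_order_le p A B /\ (toral_order_le p B A -> f @` A = B).
Proof.
move=> Ff sA AP sB AB; apply: toral_order_embedding => //.
- apply: (sub_discrete_p_toral p_pr tS); split=> // x /AP.
  exact: (fusion_dom_sub fusF Ff).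
- exact: (sub_discrete_p_toral p_pr tS).
- by move=> x y /AP Px /AP Py; apply: (fusion_mul fusF Ff).
- by move=> x y /AP Px /AP Py; apply: (fusion_injective fusF Ff).
Qed.

Lemma order_refl P : toral_order_le p P P.
Proof. exact: Order.POrderTheory.lexx. Qed.

Lemma fusion_conj_elts P Q f x : F P Q f -> P x -> x ^+ p = 1 ->
  conj_elts S F x (f x).
Proof.
move=> Ff Px xp; have [sP PS] := fusion_dom fusF Ff.
have fM := fusion_mul fusF Ff.
have Qfx := fusion_map fusF Ff Px.
have QS := (fusion_cod fusF Ff).2.
have fxp : f x ^+ p = 1.
  by rewrite -(multiplicative_onX p sP fM) // xp (multiplicative_on1 sP fM).
have cP : cyclic_gen x `<=` P by apply: generated_sub => // y ->.
split; [exact: PS|exact: QS|exists f => //].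
apply: (fusion_restrict fusF sS Ff) => //; first exact: generated_subgroup.
  split; first exact: generated_subgroup.
  apply: generated_sub => // y ->; exact: QS.
move=> y /(cyclic_genP _ (prime_gt0 p_pr) xp)[k ->].
apply/(cyclic_genP _ (prime_gt0 p_pr) fxp); exists k.
exact: (multiplicative_onX k sP fM Px).
Qed.

Lemma centralizer_centralizer x P : P x ->
  centralizer (C x) P = centralizer S P.
Proof.
move=> Px; apply/seteqP; split=> g [Cg cg]; first by split=> //; case: Cg.
by split=> //; split=> // y ->; apply: cg.
Qed.

Lemma centralizer_sub_C x P : P x -> centralizer S P `<=` C x.
Proof. by move=> Px g [Sg cg]; split=> // y ->; apply: cg. Qed.

Lemma normalizer_C x P : normalizer S P `<=` C x ->
  normalizer (C x) P = normalizer S P.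
Proof.
move=> NC; apply/seteqP; split=> g; first by move=> [[Sg _] nP].
by move=> ng; split; [exact: NC|case: ng].
Qed.

Lemma normalizer_C_sub x P : normalizer (C x) P `<=` normalizer S P.
Proof. by move=> g [[Sg _] nP]. Qed.

Lemma center_sub_C x P : P `<=` S -> centralizer P P x -> P `<=` C x.
Proof.
by move=> PS [_ cx] u Pu; split; [exact: PS|move=> _ ->; rewrite cx].
Qed.

Lemma subgroup_C x : subgroup (C x). Proof. exact: subgroup_centralizer. Qed.

Lemma C_sub x : C x `<=` S. Proof. exact: centralizer_sub. Qed.

Lemma discrete_p_toral_C x : discrete_p_toral p (C x).
Proof. by apply: (sub_discrete_p_toral p_pr tS); split; [exact: subgroup_C|exact: C_sub]. Qed.

Lemma subgroup_of_C x P : subgroup_of (C x) P -> subgroup_of S P.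
Proof. by move=> [sP PC]; split=> // u /PC[]. Qed.

Lemma fusion_centralizer P Q f A u : F P Q f -> A `<=` P -> P u ->
  centralizer S A u -> centralizer S (f @` A) (f u).
Proof.
move=> Ff AP Pu [Su cu]; split.
  by apply: (fusion_cod fusF Ff).2; apply: (fusion_map fusF Ff).
move=> _ [a Aa <-]; have fM := fusion_mul fusF Ff; have Pa := AP _ Aa.
by rewrite -!fM // cu.
Qed.

Lemma fusion_normalizer P Q f A u : F P Q f -> subgroup A -> A `<=` P -> P u ->
  normalizer S A u -> normalizer S (f @` A) (f u).
Proof.
move=> Ff sA AP Pu /normalizerP[Su nA]; have sP := fusion_domS fusF Ff.
have fM := fusion_mul fusF Ff; have fI := fusion_injective fusF Ff.
apply/normalizerP; split.
  by apply: (fusion_cod fusF Ff).2; apply: (fusion_map fusF Ff).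
move=> y; split=> [[a Aa <-]|].
  by exists (cj u a); [exact: (nA a).1|rewrite (multiplicative_on_cj sP fM) //; apply: AP].
move=> [a Aa ea]; have PV := subgroupV sP Pu.
have Aa' : A (cj u^-1 a) by apply/nA; rewrite cjVK.
exists (cj u^-1 a) => //; rewrite (multiplicative_on_cj sP fM) ?ea //; last exact: AP.
by rewrite (multiplicative_onV sP fM) // cjK.
Qed.

Lemma fusion_sub_iso P Q f A : F P Q f -> subgroup A -> A `<=` P ->
  subgroup_of Q (f @` A) /\ isoF F A (f @` A) f.
Proof.
move=> Ff sA AP; have fA : F A Q f.
  apply: (fusion_restrict fusF sS Ff) => //; first exact: (fusion_cod fusF Ff).
  by move=> u /AP; apply: (fusion_map fusF Ff).
split; last exact: (fusion_factor fusF fA).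
split; first exact: (fusion_image fusF fA).1.
by move=> _ [u Au <-]; apply: (fusion_map fusF fA).
Qed.

Lemma toral_order_sub A B : subgroup A -> subgroup_of S B -> A `<=` B ->
  toral_order_le p A B.
Proof.
move=> sA sB AB; have idF : F B B id by apply: (fusion_incl fusF).
by have [] := fusion_order_le idF sA AB sB AB.
Qed.

Lemma subgroup_of_normalizer P : subgroup_of S (normalizer S P).
Proof. by split; [exact: subgroup_normalizer|exact: normalizer_sub]. Qed.

Lemma subgroup_of_centralizer P : subgroup_of S (centralizer S P).
Proof. by split; [exact: subgroup_centralizer|exact: centralizer_sub]. Qed.

End CentralizerFusion.

(** * From centralizers to saturation *)

Section CentralizersToOut.
Variables (p : nat) (gT : groupType) (S : set gT) (F : hom_family gT).
Hypotheses (p_pr : prime p) (tS : discrete_p_toral p S).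
Hypothesis (fusF : fusion_system S F).
Variable X : set gT.
Hypothesis XS : forall x, X x -> S x /\ has_order x p.
Hypothesis X_repr : forall x, S x -> has_order x p -> exists2 y, X y & conj_elts S F x y.
Hypothesis X_extend : forall x y, conj_elts S F x y -> X y ->
  exists2 rho, F (centralizer S [set x]) (centralizer S [set y]) rho & rho x = y.
Hypothesis X_sat : forall x, X x ->
  saturated p (centralizer S [set x]) (C_fusion S F x).
Implicit Types (x y g : gT) (P Q R : set gT) (f h : gT -> gT).

Let sS : subgroup S := tS.1.

Local Notation C x := (centralizer S [set x]).

Lemma to_representative x : S x -> has_order x p ->
  exists y rho, [/\ X y, F (C x) (C y) rho & rho x = y].
Proof.
move=> Sx ox; have [y Xy cxy] := X_repr Sx ox.
by have [rho Frho rx] := X_extend cxy Xy; exists y, rho.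
Qed.

Lemma X_expg y : X y -> y ^+ p = 1.
Proof. by move=> /XS[_ []]. Qed.

(** A conjugate $Q=f(P)$ lies in the centralizer of $f(y)$, which [X_extend] moves back to $y$. The
    image of $Q$ is conjugate to $P$ inside $C_{\mathcal F}(y)$, and $C_S(Q)$ embeds in its
    centralizer. *)
Lemma fully_centralized_lift y P : X y -> P y -> subgroup_of (C y) P ->
  fully_centralized p (C y) (C_fusion S F y) P -> fully_centralized p S F P.
Proof.
move=> Xy Py sP fcP Q [f isof].
have [h [Ff Fh hf fh]] := isoF_inv isof.
have QS := (fusion_cod fusF Ff).2; have sQ := fusion_domS fusF Fh.
have Qfy := fusion_map fusF Ff Py.
have fM := fusion_mul fusF Ff.
have cy : centralizer P P y.
  by split=> // u /sP.2[_ cu]; rewrite cu.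
have cfy : centralizer Q Q (f y).
  split=> // v Qv; have Ph := fusion_map fusF Fh Qv.
  by rewrite -[v]fh // -!fM // cy.2.
have fyp : f y ^+ p = 1.
  rewrite -(multiplicative_onX p sP.1 fM) // X_expg //.
  exact: multiplicative_on1 sP.1 fM.
have := fusion_conj_elts p_pr tS fusF Fh Qfy fyp; rewrite hf // => cQ.
have [rho Frho rhoy] := X_extend cQ Xy.
have QC : Q `<=` C (f y) := center_sub_C QS cfy.
have [sQ' isor] := fusion_sub_iso tS fusF Frho sQ QC.
have isoC : isoF (C_fusion S F y) P (rho @` Q) (rho \o f).
  by apply/(isoF_C fusF) => //; split=> //; apply: (isoF_comp fusF isof isor).
have := fcP _ (ex_intro _ _ isoC); rewrite !centralizer_centralizer //; last by exists (f y).
apply: toral_order_le_trans.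
have CQ := centralizer_sub_C (S := S) Qfy.
have [] // := fusion_order_le p_pr tS fusF Frho (subgroup_centralizer Q sS) CQ
  (subgroup_of_centralizer tS (rho @` Q)) _.
move=> u cu; apply: (fusion_centralizer fusF Frho QC _ cu); exact: CQ.
Qed.

Lemma omega_order P x : omega_center p P x -> x <> 1 -> has_order x p.
Proof. by move=> [_ xp] x1; apply: has_order_p. Qed.

(** As $N_S(P)$ fixes $x$, it lies in the domain of [psi] and is mapped into the normalizer of the
    image. Full normalization of [P] excludes a larger normalizer, so rigidity makes this map
    onto. *)
Lemma push_center P x : subgroup_of S P -> fully_normalized p S F P ->
  omega_center p P x -> x <> 1 -> (forall g, normalizer S P g -> cj g x = x) ->
  exists y psi, [/\ X y, psi x = y, F (C x) (C y) psi, isoF F P (psi @` P) psi &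
    [/\ subgroup_of (C y) (psi @` P), normalizer S P `<=` C x,
      psi @` (normalizer S P) = normalizer S (psi @` P),
      normalizer S (psi @` P) `<=` C y &
      fully_normalized p (C y) (C_fusion S F y) (psi @` P)]].
Proof.
move=> sP fnP Ox x1 fixx; have [[Px cx] xp] := Ox.
have [y [psi [Xy Fpsi psix]]] := to_representative (sP.2 _ Px) (omega_order Ox x1).
have PC : P `<=` C x := center_sub_C sP.2 (conj Px cx).
have NC : normalizer S P `<=` C x.
  move=> g ng; split; first exact: normalizer_sub ng.
  by move=> _ ->; apply/cj_fixP/fixx.
have [sP' isop] := fusion_sub_iso tS fusF Fpsi sP.1 PC.
have nM u : normalizer S P u -> normalizer S (psi @` P) (psi u).
  by move=> nu; apply: (fusion_normalizer fusF Fpsi) => //; [exact: sP.1|exact: NC].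
have sN := subgroup_normalizer P sS.
have [le eN] := fusion_order_le p_pr tS fusF Fpsi sN NC
   (subgroup_of_normalizer tS (psi @` P)) nM.
have {}eN := eN (fnP _ (ex_intro _ _ isop)).
have NC' : normalizer S (psi @` P) `<=` C y.
  by rewrite -eN => _ [u /NC Cu <-]; apply: (fusion_map fusF Fpsi).
exists y, psi; split=> //; split=> // Q [f isof].
have Py : (psi @` P) y by exists x.
have /(isoF_C fusF _ _ Py)[_ sQ isof' _] := isof.
rewrite (normalizer_C NC'); apply: toral_order_le_trans le.
apply: toral_order_le_trans (fnP Q _).
  apply: (toral_order_sub p_pr tS fusF); first exact: (subgroup_normalizer Q (subgroup_C tS y)).
    exact: (subgroup_of_normalizer tS).
  exact: normalizer_C_sub.
by exists (f \o psi); apply: (isoF_comp fusF isop isof').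
Qed.

(** Automorphisms are sorted by the preimage of $y$ in the finite $\Omega_1(Z(P))$; each part is a
    translate of the stabilizer of $y$, which consists of automorphisms in $C_{\mathcal F}(y)$. *)
Lemma stabilizer_finite_out P y : subgroup_of (C y) P -> P y -> omega_center p P y ->
  finite_set (OutF (C_fusion S F y) P) -> finite_set (OutF F P).
Proof.
move=> sPC Py Oy fin; have sP := subgroup_of_C sPC.
have finO := omega_center_finite p_pr tS sP.
pose B z := out_class P @` [set f | AutF F P f /\ f z = y].
apply: (@sub_finite_set _ _ (\bigcup_(z in omega_center p P) B z)).
  move=> _ [f Af <-]; have [f' Af' [f'f ff']] := isoF_sym Af.
  exists (f' y); first exact: (AutF_omega fusF sP Af').
  by exists f => //; split=> //; apply: ff'.
apply: bigcup_finite => // z Oz; have [[Pz _] _] := Oz.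
case: (pselect (exists f0, AutF F P f0 /\ f0 z = y)) => [[f0 [A0 f0z]]|nB]; last first.
  by apply: sub_finite_set (finite_set0 _) => c [f Bf _]; case: nB; exists f.
apply: sub_finite_set (finite_image (out_act P f0) fin) => _ [f [Af fz] <-].
have [f' Af' [f'f ff']] := isoF_sym A0.
have f0P u := @AutF_map _ _ _ fusF P f0 u A0.
exists (out_class P (f \o f')).
  exists (f \o f') => //; apply/(isoF_C fusF) => //; split=> //.
    exact: (AutF_comp fusF).
  by rewrite /= -{1}f0z f'f.
rewrite out_actE //; apply: out_class_eq => u Pu /=.
by rewrite f'f.
Qed.

Lemma AutF_conj P Q f a : isoF F P Q f -> AutF F P a ->
  exists2 b, AutF F Q b & forall u, P u -> b (f u) = f (a u).
Proof.
move=> isof Aa; have [f' isof' [f'f _]] := isoF_sym isof.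
exists (f \o (a \o f')); last by move=> u Pu /=; rewrite f'f.
exact: (isoF_comp fusF (isoF_comp fusF isof' Aa) isof).
Qed.

Lemma AutF_conj_inv P Q f b : isoF F P Q f -> AutF F Q b ->
  exists2 a, AutF F P a & forall u, P u -> b (f u) = f (a u).
Proof.
move=> isof Ab; have [f' isof' [f'f ff']] := isoF_sym isof.
have [a Aa aE] := AutF_conj isof' Ab; exists a => // u Pu.
have Qu := fusion_map fusF isof.1 Pu.
have Qbu := fusion_map fusF Ab.1 Qu.
by rewrite -{2}[u]f'f // aE // ff'.
Qed.

Lemma OutF_finite_iso P Q f : isoF F P Q f -> finite_set (OutF F Q) ->
  finite_set (OutF F P).
Proof.
move=> isof fin; pose R b a := forall u, P u -> b (f u) = f (a u).
have aP a u := @AutF_map _ _ _ fusF P a u.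
suff [] : finite_set (OutF F P) /\ ncard (OutF F P) = ncard (OutF F Q) by [].
apply: (ncard_corr set0 (R := R)) fin => //.
- by move=> b /(AutF_conj_inv isof)[a Aa aE]; exists a.
- by move=> a /(AutF_conj isof)[b Ab bE]; exists b.
move=> b1 a1 b2 a2 _ _ A1 A2 R1 R2; apply: iff_sym.
by apply: (out_class_transport fusF isof) => // u; apply: aP.
Qed.

(** Finiteness has to precede any Sylow argument, so the fixed element is taken for $N_S(P)$
    only. *)
Lemma fully_normalized_out_finite P x : subgroup_of S P -> P x -> x <> 1 ->
  fully_normalized p S F P -> finite_set (OutF F P).
Proof.
move=> sP Px x1 fnP.
have sN := subgroup_normalizer P sS.
have [z [Oz z1 fixz]] := omega_center_fixpoint p_pr tS sP Px x1 sN (fun _ => id).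
have [y [psi [Xy psiz Fpsi isop [sP' _ eN NC fnP']]]] := push_center sP fnP Oz z1 fixz.
have [satI _ _] := X_sat Xy; have [_ fin _] := satI _ sP' fnP'.
apply: (OutF_finite_iso isop); apply: (stabilizer_finite_out sP' _ _ fin).
  by exists z => //; case: Oz => -[].
have [[Pz cz] _] := Oz.
have P'y : (psi @` P) y by exists z.
split; last exact: X_expg.
by split=> // u /sP'.2[_ cu]; rewrite cu.
Qed.

End CentralizersToOut.

(** The index of [R] in [T] is a power of $p$ and divides the index of [R] in [H], which is prime to
    $p$; so [R] $=$ [T]. *)
Lemma Sylow_index_coprime (p : nat) (rT : finGroupType) (G T H R : {group rT}) :
  p.-Sylow(G) T -> R \subset T -> T \subset H -> H \subset G ->
  p^'.-nat (#|H| %/ #|R|)%N -> p^'.-nat (#|G| %/ #|R|)%N.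
Proof.
move=> sylT RT TH HG; have RH := fintype.subset_trans RT TH.
rewrite !divgS ?(fintype.subset_trans RH HG) // => idx.
have pT : p.-group T by case/and3P: sylT.
have TR1 : #|T : R| = 1%N.
  apply: (@pnat_1 p); first exact: pnat_dvd (dvdn_indexg _ _) pT.
  by apply: pnat_dvd idx; rewrite -(Lagrange_index TH RT) dvdn_mull.
by rewrite (index1g RT TR1); case/and3P: sylT.
Qed.

(** * Axiom (I) from the centralizers *)

Section CentralizersToI.
Variables (p : nat) (gT : groupType) (S : set gT) (F : hom_family gT).
Hypotheses (p_pr : prime p) (tS : discrete_p_toral p S).
Hypothesis (fusF : fusion_system S F).
Variable X : set gT.
Hypothesis XS : forall x, X x -> S x /\ has_order x p.
Hypothesis X_repr : forall x, S x -> has_order x p -> exists2 y, X y & conj_elts S F x y.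
Hypothesis X_extend : forall x y, conj_elts S F x y -> X y ->
  exists2 rho, F (centralizer S [set x]) (centralizer S [set y]) rho & rho x = y.
Hypothesis X_sat : forall x, X x ->
  saturated p (centralizer S [set x]) (C_fusion S F x).
Implicit Types (x y g : gT) (P Q R : set gT) (f h : gT -> gT).

Let sS : subgroup S := tS.1.

Local Notation C x := (centralizer S [set x]).

Lemma AutS_id P : AutS S P id.
Proof. by exists 1; [exact: (subgroup1 (subgroup_normalizer P sS))|move=> x _; rewrite cj1]. Qed.

Lemma AutS_comp P f h : AutS S P f -> AutS S P h -> AutS S P (f \o h).
Proof.
move=> [a na fa] [b nb hb]; exists (a * b).
  exact: (subgroupM (subgroup_normalizer P sS) na nb).
move=> x /set_mem Px; rewrite /= hb ?fa ?cj_comp //; apply: mem_set => //.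
exact: normalizer_cj nb Px.
Qed.

Lemma OutS_OutF P : subgroup_of S P -> OutS S P `<=` OutF F P.
Proof. by move=> sP _ [f Af <-]; exists f => //; apply: (AutS_AutF fusF). Qed.

(** The trivial group has no element of order $p$ to move, and is treated directly: its only
    conjugate is itself. *)
Lemma trivial_saturation_I P : subgroup_of S P -> (forall x, P x -> x = 1) ->
  [/\ fully_centralized p S F P, finite_set (OutF F P)
    & is_Sylow p (OutF F P) (OutS S P)].
Proof.
move=> sP P1.
have Out1 : OutF F P = [set out_class P id].
  apply/seteqP; split=> [_ [f Af <-]|_ ->]; last by exists id => //; exact: (AutF_id fusF).
  apply: out_class_eq => x Px; rewrite (P1 x Px).
  exact: multiplicative_on1 sP.1 (fusion_mul fusF Af.1).
have OutS1 : OutS S P = [set out_class P id].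
  apply/seteqP; split=> [c /(OutS_OutF sP)|_ ->]; first by rewrite Out1.
  by exists id => //; exact: AutS_id.
have n1 : ncard [set out_class P id] = 1%N by rewrite /ncard fset_set1 cardfs1.
split; last by rewrite /is_Sylow Out1 OutS1 n1 divn1; split.
  move=> Q [f isof]; have [h [Ff Fh hf fh]] := isoF_inv isof.
  have Q1 u : Q u -> u = 1.
    move=> Qu; have := P1 _ (fusion_map fusF Fh Qu) => hu.
    rewrite -[u]fh // hu; exact: multiplicative_on1 sP.1 (fusion_mul fusF Ff).
  suff -> : Q = P by exact: (order_refl p).
  apply/seteqP; split=> u; first by move=> /Q1 ->; apply: subgroup1 sP.1.
  by move=> /P1 ->; apply: subgroup1 (fusion_domS fusF Fh).
by rewrite Out1; exact: finite_set1.
Qed.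

Lemma saturation_I_of_centralizers : saturation_I p S F.
Proof.
move=> P sP fnP.
have [[x [Px x1]]|nP] := pselect (exists x, P x /\ x <> 1); last first.
  apply: trivial_saturation_I => // x Px; apply: contrapT => x1.
  by case: nP; exists x.
have finO := fully_normalized_out_finite p_pr tS fusF XS X_repr X_extend X_sat sP Px x1 fnP.
have [rT [pi [piM piE]]] := outer_representation fusF sS sP finO.
have SF : AutS S P `<=` AutF F P := AutS_AutF fusF sS sP.
have gO := out_image_group_set tS fusF sP piM (fun _ => id) (AutF_id fusF sS sP)
  (AutF_comp fusF (P := P)).
have gR := out_image_group_set tS fusF sP piM SF (AutS_id P) (@AutS_comp P).
pose O := Group gO; pose R := Group gR.
have pR : p.-group R by apply: (AutS_image_pgroup p_pr tS fusF sP piM piE).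
have RO : R \subset O.
  apply/fintype.subsetP => _ /out_imageP[f /SF Af <-]; by apply/out_imageP; exists f.
have [T sylT RT] := Sylow_superset RO pR.
have [TO pT _] := and3P sylT.
(* Since [T] contains the image of $\operatorname{Aut}_S(P)$, the element $z$ is fixed by $N_S(P)$
   too, as [push_center] requires. *)
have [z [Oz z1 fixz]] := outer_p_fixpoint p_pr tS fusF sP piM piE TO pT Px x1.
have fixN g : normalizer S P g -> cj g z = z.
  move=> ng; have Ag : AutS S P (cj g) by exists g.
  apply: fixz; first exact: SF.
  by apply: (fintype.subsetP RT); apply/out_imageP; exists (cj g).
have [y [psi [Xy psiz Fpsi isop [sP' NC eN NC' fnP']]]] :=
  push_center p_pr tS fusF X_repr X_extend sP fnP Oz z1 fixN.
set P' := psi @` P in isop sP' eN NC' fnP'.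
have Pz : P z by case: Oz => -[].
have P'y : P' y by exists z.
have [satI _ _] := X_sat Xy.
have [fcP' finG [_ _ idxG]] := satI _ sP' fnP'.
pose St := [set f | AutF F P f /\ f z = z].
have StA : St `<=` AutF F P by move=> f [].
have gSt : group_set (out_image pi St).
  apply: (out_image_group_set tS fusF sP piM StA).
    by split=> //; exact: (AutF_id fusF).
  by move=> f h [Af fz] [Ah hz]; split; [exact: (AutF_comp fusF)|rewrite /= hz].
have TSt : T \subset Group gSt.
  apply/fintype.subsetP => s sT; have /out_imageP[f Af fs] := fintype.subsetP TO s sT.
  by apply/out_imageP; exists f => //; split=> //; apply: fixz; rewrite ?fs.
have StO : Group gSt \subset O.
  by apply/fintype.subsetP => _ /out_imageP[f [Af _] <-]; apply/out_imageP; exists f.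
have finS : finite_set (OutS S P) := sub_finite_set (OutS_OutF sP) finO.
have finSt : finite_set (out_class P @` St).
  by apply: sub_finite_set finO => _ [f [Af _] <-]; exists f.
have cO : #|O| = ncard (OutF F P) by apply: (card_out_image piE).
have cR : #|R| = ncard (OutS S P) by apply: (card_out_image piE).
have cSt : #|Group gSt| = ncard (out_class P @` St) by apply: (card_out_image piE).
(* R is Sylow in St by (I) for C_F(y), and T lies in St, so R = T. *)
pose rel b b' := forall u, P u -> b' (psi u) = psi (b u).
have fP f u : AutF F P f -> P u -> P (f u) by move=> Af; apply: (AutF_map fusF Af).
(* [psi] maps $N_S(P)$ onto the normalizer of [P'], so conjugation by [psi] matches the
   automorphisms these groups induce. *)
have cR' : ncard (OutS (C y) P') = ncard (OutS S P).
  suff [] : finite_set (OutS (C y) P') /\ ncard (OutS (C y) P') = ncard (OutS S P) by [].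
  have cjpsi n u : normalizer S P n -> P u -> cj (psi n) (psi u) = psi (cj n u).
    move=> nn Pu; apply/esym/(multiplicative_on_cj (subgroup_C tS z) (fusion_mul fusF Fpsi)).
      exact: NC.
    by apply: (center_sub_C sP.2 _ Pu); case: Oz.
  apply: (ncard_corr set0 (R := rel) _ _ _ finS).
  - move=> b [n nn bE]; exists (cj (psi n)).
      by exists (psi n) => //; rewrite (normalizer_C NC') -eN; exists n.
    by move=> u Pu; rewrite cjpsi // bE //; apply: mem_set.
  - move=> b' [m]; rewrite (normalizer_C NC') -eN => -[n nn <-] bE.
    exists (cj n); first by exists n.
    move=> u Pu; rewrite bE ?cjpsi //; apply: mem_set; by exists u.
  move=> b1 b1' b2 b2' /SF A1 /SF A2 _ _ R1 R2.
  by apply: (out_class_transport fusF isop) => // u; apply: fP.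
(* Automorphisms of [P] fixing $z$ correspond under [psi] to automorphisms of [P'] fixing $y$. *)
have cSt' : ncard (OutF (C_fusion S F y) P') = ncard (out_class P @` St).
  suff [] : finite_set (OutF (C_fusion S F y) P') /\
    ncard (OutF (C_fusion S F y) P') = ncard (out_class P @` St) by [].
  apply: (ncard_corr set0 (R := rel) _ _ _ finSt).
  - move=> f [Af fz]; have [b Ab bE] := AutF_conj fusF isop Af.
    exists b; last exact: bE.
    by apply/(isoF_C fusF) => //; split=> //; rewrite -psiz bE // fz.
  - move=> b /(isoF_C fusF _ _ P'y)[_ _ Ab bfix].
    have [f Af fE] := AutF_conj_inv fusF isop Ab; exists f => //; split=> //.
    apply: (fusion_injective fusF isop.1) => //; first exact: fP.
    by rewrite -fE // psiz.
  move=> b1 b1' b2 b2' [A1 _] [A2 _] _ _ R1 R2.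
  by apply: (out_class_transport fusF isop) => // u; apply: fP.
split=> //.
(* [P'] is fully centralized in $\mathcal F$, and its centralizer lies in its normalizer, the image
   of $N_S(P)$; the inverse of [psi] embeds it in $C_S(P)$. *)
- move=> Q [f isof].
  have [f' isof' _] := isoF_sym isop.
  have fcF := fully_centralized_lift p_pr tS fusF XS X_extend Xy P'y sP' fcP'.
  have le1 := fcF Q (ex_intro _ _ (isoF_comp fusF isof' isof)).
  apply: toral_order_le_trans le1 _.
  have sN := subgroup_normalizer P sS.
  have [_ /isoF_sym[f'' isof'' [f''psi _]]] := fusion_sub_iso tS fusF Fpsi sN NC.
  have CN : centralizer S P' `<=` psi @` normalizer S P.
    by rewrite eN; apply: centralizer_normalizer.
  apply: (fusion_order_le p_pr tS fusF isof''.1 _ CN _ _).1.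
  - exact: (subgroup_centralizer P' sS).
  - exact: (subgroup_of_centralizer tS).
  move=> _ /[dup] /CN[n nn <-] [_ cn]; rewrite f''psi //; split; first by case: nn.
  move=> u Pu; have PC : P `<=` C z by apply: (center_sub_C sP.2); case: Oz.
  have Cn := NC _ nn; have Cu := PC _ Pu; have sC := subgroup_C tS z.
  apply: (fusion_injective fusF Fpsi); [exact: subgroupM|exact: subgroupM|].
  by rewrite !(fusion_mul fusF Fpsi) // cn //; exists u.
split; [exact: OutS_OutF|by rewrite -cR|].
rewrite -cO -cR; apply: (Sylow_index_coprime sylT RT TSt StO).
by rewrite cSt cR -cSt' -cR'.
Qed.

End CentralizersToI.

(** * The subgroup $N_\varphi$, and axiom (II) from the centralizers *)

Section NPhi.
Variables (gT : groupType) (S : set gT).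
Hypothesis sS : subgroup S.
Implicit Types (x y g u : gT) (P Q : set gT) (f : gT -> gT).

Lemma N_phiP P f g : injective_on P f -> N_phi S P f g <->
  normalizer S P g /\ exists2 h, normalizer S (f @` P) h &
    forall u, P u -> f (cj g u) = cj h (f u).
Proof.
move=> fI; have pinvE u : P u -> 'pinv_(fun=> 1) P f (f u) = u.
  move=> Pu; apply: pinvKV; last exact: mem_set.
  by move=> v w /set_mem Pv /set_mem Pw; apply: fI.
split=> -[ng [h nh hE]]; split=> //; exists h => //.
  move=> u Pu; have := hE (f u) (mem_set (ex_intro2 _ _ u Pu erefl)).
  by rewrite /= pinvE.
by move=> _ /set_mem[u Pu <-]; rewrite /= pinvE // hE.
Qed.

Lemma subgroup_N_phi P f : injective_on P f -> subgroup (N_phi S P f).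
Proof.
move=> fI; have sN := subgroup_normalizer P sS.
have sNf := subgroup_normalizer (f @` P) sS.
split.
  apply/N_phiP => //; split; first exact: subgroup1.
  by exists 1 => [|u Pu]; [exact: subgroup1|rewrite !cj1].
move=> a b /(N_phiP _ fI)[na [c nc cE]] /(N_phiP _ fI)[nb [d nd dE]].
apply/N_phiP => //; split; first exact: sN.2.
exists (c * d^-1) => [|u Pu]; first exact: sNf.2.
have Pv : P (cj b^-1 u) := normalizer_cj (subgroupV sN nb) Pu.
by rewrite !cj_comp cE // -{2}[u](cjVK b) dE // cjK.
Qed.

Lemma N_phi_sub P f : N_phi S P f `<=` S.
Proof. by move=> g [[]]. Qed.

Lemma sub_N_phi P f : subgroup_of S P -> subgroup_of S (f @` P) ->
  multiplicative_on P f -> injective_on P f -> P `<=` N_phi S P f.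
Proof.
move=> [sP PS] [sfP fPS] fM fI g Pg; apply/(N_phiP _ fI); split.
  exact: subgroup_normalizer_self.
exists (f g); first by apply: subgroup_normalizer_self => //; exists g.
by move=> u Pu; apply: (multiplicative_on_cj sP fM).
Qed.

End NPhi.

Section CentralizersToII.
Variables (p : nat) (gT : groupType) (S : set gT) (F : hom_family gT).
Hypotheses (p_pr : prime p) (tS : discrete_p_toral p S).
Hypothesis (fusF : fusion_system S F).
Variable X : set gT.
Hypothesis XS : forall x, X x -> S x /\ has_order x p.
Hypothesis X_repr : forall x, S x -> has_order x p -> exists2 y, X y & conj_elts S F x y.
Hypothesis X_extend : forall x y, conj_elts S F x y -> X y ->
  exists2 rho, F (centralizer S [set x]) (centralizer S [set y]) rho & rho x = y.
Hypothesis X_sat : forall x, X x ->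
  saturated p (centralizer S [set x]) (C_fusion S F x).
Implicit Types (x y g : gT) (P Q R : set gT) (f h : gT -> gT).

Let sS : subgroup S := tS.1.

Local Notation C x := (centralizer S [set x]).

Lemma saturation_II_of_centralizers : saturation_II p S F.
Proof.
move=> P f Ff fcQ; have sP := fusion_dom fusF Ff; have PS := sP.2.
have isof := fusion_factor fusF Ff; set Q := f @` P in fcQ isof.
have fI := fusion_injective fusF Ff; have fM := fusion_mul fusF Ff.
have sQ : subgroup_of S Q := fusion_image fusF Ff.
have sN := subgroup_N_phi sS fI; set N := N_phi S P f in sN *.
have [[a [Pa a1]]|nP] := pselect (exists x, P x /\ x <> 1); last first.
  have P1 u : P u -> u = 1 by move=> Pu; apply: contrapT => u1; apply: nP; exists u.
  exists id; last first.
    by move=> u /set_mem /P1 ->; rewrite (multiplicative_on1 sP.1 fM).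
  have NS : N `<=` S := @N_phi_sub _ S P f.
  exact: (fusion_incl fusF sS (conj sN NS) (conj sS (fun _ => id)) (fun _ _ => erefl) NS).
have NN : N `<=` normalizer S P by move=> g [].
have [x [Ox x1 fixx]] := omega_center_fixpoint p_pr tS sP Pa a1 sN NN.
have [[Px cx] xp] := Ox.
have [f' isof' [f'f ff']] := isoF_sym isof.
have Qfx : Q (f x) := fusion_map fusF isof.1 Px.
have fxp : f x ^+ p = 1.
  by rewrite -(multiplicative_onX p sP.1 fM) // xp (multiplicative_on1 sP.1 fM).
have ox : has_order x p by apply: has_order_p.
have [y [rho [Xy Frho rhox]]] :=
  to_representative X_repr X_extend (PS _ Px) ox.
have PC : P `<=` C x := center_sub_C PS (conj Px cx).
have QC : Q `<=` C (f x).
  apply: (center_sub_C sQ.2); split=> // _ [u Pu <-].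
  by rewrite -!fM // cx.
have NC : N `<=` C x.
  by move=> g Ng; split; [exact: N_phi_sub Ng|move=> _ ->; apply/cj_fixP/fixx].
have [sP1 isor] := fusion_sub_iso tS fusF Frho sP.1 PC.
have [rho_ isor_ [rho_K rhoK_]] := isoF_sym isor.
have cfx : conj_elts S F (f x) y.
  have Fg := (isoF_comp fusF isof' isor).1.
  by have := fusion_conj_elts p_pr tS fusF Fg Qfx fxp; rewrite /= f'f // rhox.
have [rho' Frho' rhox'] := X_extend cfx Xy.
have [sQ1 isor'] := fusion_sub_iso tS fusF Frho' sQ.1 QC.
set P1 := rho @` P in sP1 isor isor_ rhoK_.
set Q1 := rho' @` Q in sQ1 isor'.
have P1y : P1 y by exists x.
have Q1y : Q1 y by exists (f x).
(* The given morphism transported between [P1] and [Q1]; it fixes $y$, so it belongs to $C_{\mathcal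
   F}(y)$. *)
pose sigma := rho' \o (f \o rho_).
have isos : isoF F P1 Q1 sigma.
  exact: (isoF_comp fusF (isoF_comp fusF isor_ isof) isor').
have sigmaE u : P u -> sigma (rho u) = rho' (f u).
  by move=> Pu; rewrite /sigma /= rho_K.
have sigmay : sigma y = y by rewrite -rhox sigmaE // rhox'.
have CQ : centralizer S Q `<=` C (f x) := centralizer_sub_C Qfx.
have Cmap u : centralizer S Q u -> centralizer S Q1 (rho' u).
  by move=> cu; apply: (fusion_centralizer fusF Frho' QC _ cu); exact: CQ.
have [leC eC] := fusion_order_le p_pr tS fusF Frho' (subgroup_centralizer Q sS) CQ
  (subgroup_of_centralizer tS Q1) Cmap.
(* As [Q] is fully centralized, [rho'] maps $C_S(Q)$ onto $C_S(Q_1)$. This makes [Q1] fully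
   centralized, and later allows the extension to be pulled back. *)
have {}eC := eC (fcQ _ (ex_intro _ _ isor')).
have fcQ1 : fully_centralized p (C y) (C_fusion S F y) Q1.
  move=> R [k isok]; have /(isoF_C fusF _ _ Q1y)[_ sR isok' ky] := isok.
  have Ry : R y by rewrite -ky; apply: (fusion_map fusF isok'.1).
  rewrite !centralizer_centralizer //; apply: toral_order_le_trans leC.
  by apply: fcQ; exists (k \o rho'); apply: (isoF_comp fusF isor' isok').
have sC := subgroup_C tS; have sSC z : subgroup_of S (C z).
  by split; [exact: sC|exact: C_sub].
have Gs : C_fusion S F y P1 (C y) sigma.
  have Cyy : C y y by split; [exact: (subgroup_of_C sP1).2|move=> _ ->].
  apply/C_fusionP => //; split=> //; first exact: (conj (sC y) (fun _ => id)).
  apply: (fusion_restrict fusF sS isos.1 sP1.1) => // u P1u.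
  by apply: sQ1.2; apply: (fusion_map fusF isos.1).
have [_ satII _] := X_sat Xy.
have eQ1 : sigma @` P1 = Q1 := isoF_image fusF isos.
have [|tau Gtau tauE] := satII P1 sigma Gs; first by rewrite eQ1.
set N1 := N_phi (C y) P1 sigma in Gtau.
have [_ _ Ftau _] := Gtau.
have {}tauE u : P u -> tau (rho u) = rho' (f u).
  by move=> Pu; rewrite tauE ?sigmaE //; apply: mem_set; exists u.
have rhoM := fusion_mul fusF Frho; have rhoM' := fusion_mul fusF Frho'.
(* An element $w$ realizing the conjugate of $c_g$ on [Q] centralizes $f(x)$, because $g$ fixes $x$.
   So [rho' w] is defined, and [rho g] lies in the domain of [tau]. *)
have wit g : N g -> exists w, [/\ C (f x) w, N1 (rho g) &
    forall u, P u -> cj (tau (rho g)) (rho' (f u)) = cj (rho' w) (rho' (f u))].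
  move=> Ng; have /(N_phiP _ _ fI)[ng [w nw wE]] := Ng.
  have Cg := NC _ Ng.
  have Cw : C (f x) w.
    split; first exact: normalizer_sub nw.
    by move=> _ ->; apply/cj_fixP; rewrite -wE // fixx.
  have key u : P u -> sigma (cj (rho g) (rho u)) = cj (rho' w) (rho' (f u)).
    move=> Pu; have Cu := PC _ Pu; have Pgu := normalizer_cj ng Pu.
    rewrite -(multiplicative_on_cj (sC x) rhoM) // sigmaE // wE //.
    rewrite (multiplicative_on_cj (sC (f x)) rhoM') //.
    by apply: QC; exists u.
  have N1g : N1 (rho g).
    apply/(N_phiP _ _ (fusion_injective fusF isos.1)); rewrite eQ1; split.
      split; first exact: (fusion_map fusF Frho).
      by have [_] := fusion_normalizer fusF Frho sP.1 PC Cg ng.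
    exists (rho' w).
      split; first exact: (fusion_map fusF Frho').
      by have [_] := fusion_normalizer fusF Frho' sQ.1 QC Cw nw.
    by move=> _ [u Pu <-]; rewrite key // sigmaE.
  exists w; split=> // u Pu; rewrite -key //.
  have Cu := PC _ Pu; have Pgu := normalizer_cj ng Pu.
  have N1u : N1 (rho u).
    have := @sub_N_phi _ (C y) P1 sigma sP1; rewrite eQ1.
    apply=> //; [exact: (fusion_mul fusF isos.1)|exact: (fusion_injective fusF isos.1)|].
    by exists u.
  rewrite -tauE // -(multiplicative_on_cj (fusion_domS fusF Ftau) (fusion_mul fusF Ftau)) //.
  by rewrite -(multiplicative_on_cj (sC x) rhoM) // tauE // sigmaE.
(* [tau (rho g)] and [rho' w] act alike on [Q1], so they differ by an element of
   $C_S(Q_1)=\rho'(C_S(Q))$. *)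
have onto g : N g -> (rho' @` C (f x)) (tau (rho g)).
  move=> Ng; have [w [Cw N1g e]] := wit g Ng.
  have Ck := fusion_map fusF Ftau N1g.
  have : centralizer S Q1 ((rho' w)^-1 * tau (rho g)).
    have Cw' := fusion_map fusF Frho' Cw.
    split; first by apply: (C_sub (x := y)); apply: subgroupM => //; apply: subgroupV.
    move=> _ [_ [u Pu <-] <-]; apply/cj_fixP.
    by rewrite cj_comp e // cjK.
  rewrite -eC => -[c cc ec]; have Cc := CQ _ cc.
  exists (w * c); first exact: (subgroupM (sC _)).
  by rewrite rhoM' // ec mulVKg.
have [_ isoC] := fusion_sub_iso tS fusF Frho' (sC (f x)) (fun _ => id).
have [rho'' iso'' [rho''K _]] := isoF_sym isoC.
have FN : F N (rho' @` C (f x)) (tau \o rho).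
  have F1 : F N N1 rho.
    apply: (fusion_restrict fusF sS Frho) => //; last by move=> g /wit[h []].
    exact: (fusion_dom fusF Ftau).
  apply: (fusion_restrict fusF sS (fusion_comp fusF F1 Ftau)) => //.
  exact: (fusion_cod fusF isoC.1).
exists (rho'' \o (tau \o rho)).
  have F2 := fusion_comp fusF FN iso''.1.
  apply: (fusion_restrict fusF sS F2 sN (fun _ => id) (conj sS (fun _ => id))).
  by move=> g Ng; apply: (fusion_dom_sub fusF isoC.1); apply: (fusion_map fusF iso''.1); apply: (fusion_map fusF FN).
move=> u /set_mem Pu /=; rewrite tauE // rho''K //.
by apply: QC; exists u.
Qed.

End CentralizersToII.

(** * Existence of fully normalized subgroups *)

Section Norm.
Variables (gT : groupType) (T : set gT).
Hypotheses (sT : subgroup T) (aT : abelian_on T).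

Definition prodseq (l : seq gT) : gT := foldr (fun x y => x * y) 1 l.

Lemma prodseq_mem (l : seq gT) : (forall x, x \in l -> T x) -> T (prodseq l).
Proof.
elim: l => [|x l IH] Tl /=; first exact: subgroup1.
apply: (subgroupM sT); first by apply: Tl; rewrite mem_head.
by apply: IH => y yl; apply: Tl; rewrite inE yl orbT.
Qed.

Lemma prodseq_cat (l m : seq gT) : prodseq (l ++ m) = prodseq l * prodseq m.
Proof. by elim: l => [|x l IH] /=; rewrite ?mul1g // IH mulgA. Qed.

Lemma prodseq_perm (l m : seq gT) : (forall x, x \in l -> T x) ->
  perm_eq l m -> prodseq l = prodseq m.
Proof.
move=> Tl lm; pose Pm s := (forall x, x \in s -> T x) /\ prodseq l = prodseq s.
suff : Pm m by case.
apply: (@catCA_perm_ind _ Pm) lm _ => // s1 s2 s3 [Ts e]; split.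
  by move=> x; rewrite !mem_cat orbCA -!mem_cat => /Ts.
rewrite e !prodseq_cat !mulgA; congr (_ * _); apply: aT.
  by apply: prodseq_mem => x xs; apply: Ts; rewrite !mem_cat xs.
by apply: prodseq_mem => x xs; apply: Ts; rewrite !mem_cat xs !orbT.
Qed.

Lemma cj_prodseq g (l : seq gT) : cj g (prodseq l) = prodseq (map (cj g) l).
Proof. by elim: l => [|x l IH] /=; rewrite ?cj_1 // cjM IH. Qed.

Lemma prodseqM (I : eqType) (l : seq I) (f h : I -> gT) :
  (forall i, i \in l -> T (f i)) -> (forall i, i \in l -> T (h i)) ->
  prodseq [seq f i * h i | i <- l] = prodseq (map f l) * prodseq (map h l).
Proof.
elim: l => [|i l IH] Tf Th /=; first by rewrite mulg1.
have Tf' j : j \in l -> T (f j) by move=> jl; apply: Tf; rewrite inE jl orbT.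
have Th' j : j \in l -> T (h j) by move=> jl; apply: Th; rewrite inE jl orbT.
rewrite IH // -!mulgA; congr (_ * _); rewrite !mulgA; congr (_ * _).
apply: aT; first by apply: Th; rewrite mem_head.
by apply: prodseq_mem => _ /mapP[j jl ->]; apply: Tf'.
Qed.

Variable S Q : set gT.
Hypotheses (nTS : normal_in T S) (sQ : subgroup Q) (QS : Q `<=` S).
Hypothesis fin : finite_set (left_cosets Q (Q `&` T)).

Let A : set gT := Q `&` T.

(* nm is the norm of the finite group Q / (Q n T) acting on T by conjugation. *)
Lemma norm_map : exists nm : gT -> gT,
  [/\ forall t, T t -> T (nm t), multiplicative_on T nm,
      forall t q, T t -> Q q -> cj q (nm t) = nm t &
      forall t, T t -> normalizer S Q t ->
        exists2 a, A a & nm t = a * t ^+ ncard (left_cosets Q A)].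
Proof.
have sA : subgroup A := subgroupI sQ sT.
have TJ g t : Q g -> T t -> T (cj g t).
  by move=> /QS Sg Tt; have /cj_imageP nT := nTS.2 g Sg; exact: (nT t).1 Tt.
have /choice[rep repP] : forall c, exists g,
    left_cosets Q A c -> Q g /\ c = lcoset A g.
  move=> c; case: (pselect (left_cosets Q A c)) => [[g Qg <-]|nc]; last by exists 1.
  by exists g.
pose L : seq (set gT) := fset_set (left_cosets Q A).
have LP c : c \in L -> left_cosets Q A c.
  by rewrite in_fset_set // => /set_mem.
have TL t c : T t -> c \in L -> T (cj (rep c) t).
  by move=> Tt /LP/repP[Qr _]; apply: TJ.
exists (fun t => prodseq [seq cj (rep c) t | c <- L]); split.
- by move=> t Tt; apply: prodseq_mem => _ /mapP[c cL ->]; apply: TL.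
- move=> t u Tt Tu; rewrite -prodseqM; [|by move=> c; apply: TL|by move=> c; apply: TL].
  by congr prodseq; apply: eq_map => c; rewrite cjM.
- move=> t q Tt Qq; rewrite cj_prodseq -map_comp.
  pose tr c := [set q * x | x in c].
  have trL c : c \in L -> tr c \in L.
    by move=> /LP Lc; rewrite in_fset_set //; apply: mem_set; apply: left_cosets_act.
  have trI : injective tr.
    move=> c d e; have K b : [set q^-1 * x | x in tr b] = b.
      rewrite /tr image_comp -[RHS]image_id; congr (_ @` _).
      by apply/funext => x /=; rewrite mulKg.
    by rewrite -[c]K e K.
  have -> : map (cj q \o (fun c => cj (rep c) t)) L = [seq cj (rep c) t | c <- map tr L].
    rewrite -map_comp; apply/eq_in_map => c cL /=.
    have [Qr ec] := repP _ (LP _ cL); have [Qr' ec'] := repP _ (LP _ (trL _ cL)).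
    have : A ((rep (tr c))^-1 * (q * rep c)).
      by apply/(lcoset_eqP _ _ sA); rewrite -ec' /tr {1}ec lcosetM.
    move=> [_ Ta]; rewrite -cj_comp -{1}(mulVKg (rep (tr c)) (q * rep c)) cj_comp.
    by congr cj; apply/cj_fixP/aT.
  apply/esym/prodseq_perm; first by move=> _ /mapP[c cL ->]; apply: TL.
  apply: perm_map; apply: uniq_perm; first exact: fset_uniq.
    by rewrite map_inj_uniq ?fset_uniq.
  have sub : {subset map tr L <= L} by move=> _ /mapP[c cL ->]; apply: trL.
  have U : uniq (map tr L) by rewrite map_inj_uniq ?fset_uniq.
  have le : (size L <= size (map tr L))%N by rewrite size_map.
  by have [_ e] := uniq_min_size U sub le; move=> c; rewrite e.
move=> t Tt nt.
have -> : ncard (left_cosets Q A) = size L by [].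
have : {subset L <= L} by [].
elim: {1 3 4}L => [|c l IH] lL /=; first by exists 1; [exact: subgroup1|rewrite mulg1].
have [|a Aa ->] := IH; first by move=> d dl; apply: lL; rewrite inE dl orbT.
have cL : c \in L by apply: lL; rewrite mem_head.
have [Qr _] := repP _ (LP _ cL); have Tc := TL _ _ Tt cL.
(* Each factor of the norm differs from [t] by a commutator, which lies in [Q] because [t]
   normalizes [Q] and in [T] because [T] is normal. *)
have Ac : A (cj (rep c) t * t^-1).
  split; last exact: sT.2.
  have nV := subgroupV (subgroup_normalizer Q _) nt.
  rewrite cjE -!mulgA; apply: (subgroupM sQ) => //.
  rewrite mulgA -cjE; apply: normalizer_cj nt _; exact: subgroupV.
exists (cj (rep c) t * t^-1 * a); first exact: subgroupM.
rewrite expgS !mulgA; congr (_ * _).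
have cta : t^-1 * a = a * t^-1 by apply: aT; [exact: subgroupV|case: Aa].
by rewrite -(mulgA _ t^-1 a) cta !mulgA mulgVK.
Qed.

End Norm.

Section FullyNormalized.
Variables (p : nat) (gT : groupType) (S : set gT).
Hypotheses (p_pr : prime p) (tS : discrete_p_toral p S).
Implicit Types (x y g : gT) (P Q R : set gT).

Let sS : subgroup S := tS.1.

(* With A = Q n T and k = |Q/A|, the norm shows t^k in D A for t in N_T(Q),  *)
(* where D is the image of the norm, a divisible subgroup of C_T(Q); the     *)
(* k-th roots of coset representatives of the torus of Q then cover N_T(Q)   *)
(* modulo divisible subgroups of N_S(Q).                                     *)
Lemma normalizer_order_bound n : exists B, forall Q, subgroup_of S Q ->
  (toral_order p Q).2 = n -> ((toral_order p (normalizer S Q)).2 <= B)%N.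
Proof.
have [_ [r [T mT]]] := tS; have [sT nTS tT finT [M eM]] := mT; have [TS nT] := nTS.
have aT := torus_abelian sT tT; have dT := torus_p_divisible p_pr sT tT.
have tS' := maximal_torus_p_torsion p_pr sS mT.
have [s0 [sz0 _ cov0]] := coset_cover_exists sT finT.
have [E eE] := (finite_seqP _).1 (torus_torsion_part p_pr sT tT M).1.
(* [s0] covers $N_S(Q)$ modulo $N_T(Q)$; the torus of $N_S(Q)$ is then covered by $n$ classes of
   roots, each up to the elements of [E]. *)
exists (size s0 * (n * size E))%N => Q sQ en; have QS := sQ.2.
have tQ := sub_discrete_p_toral p_pr tS sQ.
have [TQ [mTQ eQ]] := toral_orderP tQ.
have sN : subgroup_of S (normalizer S Q) by split; [exact: subgroup_normalizer|move=> g []].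
have [TN [mTN eN]] := toral_orderP (sub_discrete_p_toral p_pr tS sN).
have [sTQ [TQQ _] tTQ finTQ _] := mTQ; have [sTN [TNN _] tTN finTN _] := mTN.
have dTQ := torus_p_divisible p_pr sTQ tTQ.
have QN : Q `<=` normalizer S Q.
  by move=> g Qg; apply: subgroup_normalizer_self Qg => //; exact: sQ.1.
have TQT : TQ `<=` T.
  by apply: (p_divisible_sub p_pr sS sT tS' finT dTQ) => u /TQQ/QS.
have tN : p_torsion p (normalizer S Q) by apply: p_torsion_sub tS' _ => g [].
have inTN (D : set gT) : p_divisible p D -> D `<=` normalizer S Q -> D `<=` TN.
  exact: (p_divisible_sub p_pr sN.1 sTN tN finTN).
have TQTN : TQ `<=` TN by apply: inTN => // u /TQQ/QN.
have [s1 [sz1 _ cov1]] := coset_cover_sub sT sQ.1 QS cov0.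
have sA := subgroupI sQ.1 sT.
have [finA leA] := coset_cover_card sA cov1.
have [nm [nmT nmM nmC nmE]] := norm_map sT aT nTS sQ.1 QS finA.
have [j ej] := p_group_index p_pr sQ.1 (p_torsion_sub tS' QS) finA.
set k := ncard _ in ej nmE leA.
(* $|Q/A|=p^j$ is at most $|S/T|=p^M$, so elements of [T] killed by [k] lie in [E], which does not
   depend on [Q]. *)
have jM : (j <= M)%N.
  by rewrite -(leq_exp2l _ _ (prime_gt1 p_pr)) -ej -eM -sz0 (leq_trans leA).
have nmTN : nm @` T `<=` TN.
  apply: inTN.
    move=> _ [t Tt <-]; have [t' Tt' <-] := dT _ Tt; exists (nm t'); first by exists t'.
    by rewrite (multiplicative_onX _ sT nmM).
  move=> _ [t Tt <-]; apply: centralizer_normalizer; split; first exact/TS/nmT.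
  by move=> q Qq; have /cj_fixP := nmC t q Tt Qq.
have [s2 [sz2 _ cov2]] := coset_cover_sub sT sN.1 sN.2 cov0.
have [sq [szq _ covq]] := coset_cover_exists sTQ finTQ.
have TX u i : T u -> T (u ^+ i) by apply: subgroupX.
have TV u : T u -> T u^-1 by apply: subgroupV.
have TM u v : T u -> T v -> T (u * v) by apply: subgroupM.
(* For each representative [b], one $k$-th root of [b] modulo [TQ], when there is one. *)
have /choice[z zP] : forall b, exists z, (exists2 z, T z & TQ (b^-1 * z ^+ k)) ->
    T z /\ TQ (b^-1 * z ^+ k).
  move=> b; case: (pselect (exists2 z, T z & TQ (b^-1 * z ^+ k))) => [[z Tz zb]|nz].
    by exists z.
  by exists 1.
have root (D : set gT) u : p_divisible p D -> D u -> exists2 v, D v & v ^+ k = u.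
  by move=> dD Du; rewrite ej; apply: p_divisibleX.
have expT u v i : T u -> T v -> (u * v) ^+ i = u ^+ i * v ^+ i.
  by move=> Tu Tv; apply: expgMn; apply: aT.
have cov3 : coset_cover (normalizer S Q `&` T) TN [seq z b * e | b <- sq, e <- E].
  move=> t [nt Tt]; have [a [Qa Ta] ea] := nmE t Tt nt.
  have tk : t ^+ k = a^-1 * nm t by rewrite ea mulKg.
  have [b bq TQu] := covq _ (subgroupV sQ.1 Qa).
  set u := b^-1 * a^-1 in TQu; have au : a^-1 = b * u by rewrite /u mulVKg.
  have [t' Tt' t'k] := root T _ dT Tt.
  have [u' TQu' u'k] := root TQ _ dTQ TQu.
  have Tu' := TQT _ TQu'; have Tnm := nmT _ Tt'.
  have Tud := TM _ _ Tu' Tnm.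
  (* Removing the divisible contributions from [t] leaves an exact $k$-th root of [b]. *)
  pose z0 := t * (u' * nm t')^-1.
  have Tz0 : T z0 by apply: TM => //; apply: TV.
  have z0k : z0 ^+ k = b.
    rewrite /z0 expT //; last exact: TV.
    rewrite expVgn expT // u'k -(multiplicative_onX _ sT nmM) // t'k tk.
    by rewrite invgM mulgA mulgK au mulgK.
  have [Tz TQz] : T (z b) /\ TQ (b^-1 * z b ^+ k).
    by apply: zP; exists z0; rewrite // z0k mulVg; exact: subgroup1.
  set v := b^-1 * z b ^+ k in TQz; have zk : z b ^+ k = b * v by rewrite /v mulVKg.
  have [v' TQv' v'k] := root TQ _ dTQ TQz; have Tv' := TQT _ TQv'.
  (* The roots [z b] and [z0] have $k$-th powers differing by [v] $=v'^k$, so this correction makes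
     their quotient killed by [k]. *)
  pose e := v' * ((z b)^-1 * z0).
  have Tzz : T ((z b)^-1 * z0) by apply: TM => //; apply: TV.
  have Te : T e by apply: TM.
  have TVz := TV _ Tz.
  have Ee : e \in E.
    have : torsion_part (p ^ M) T e.
      split=> //; rewrite -(subnKC jM) expnD expgnA -ej.
      have -> : e ^+ k = 1; last by rewrite expg1n.
      by rewrite /e expT // expT // expVgn z0k zk v'k invgM mulgVK mulgV.
    by rewrite eE.
  exists (z b * e); first by apply/allpairsP; exists (b, e).
  have -> : (z b * e)^-1 * t = (u' * nm t') * v'^-1.
    have -> : t = z0 * (u' * nm t') by rewrite /z0 mulgVK.
    have -> : z b * e = z0 * v'.
      by rewrite /e (aT v') // !mulgA mulgV mul1g.
    rewrite invgM -(mulgA v'^-1) (mulKg z0); apply: aT => //; exact: TV.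
  apply: (subgroupM sTN); last exact/(subgroupV sTN)/TQTN.
  apply: (subgroupM sTN); first exact: TQTN.
  by apply: nmTN; exists t'.
have [_ le] := coset_cover_card sTN (coset_cover_trans cov2 cov3).
rewrite eN (leq_trans le) // !size_allpairs szq -eQ en.
by rewrite leq_mul2r sz2 orbT.
Qed.

End FullyNormalized.

(** The first coordinate is maximized, then the second among the maximizers; bounding the first
    alone would not suffice. *)
Lemma lexi_max_exists (I : Type) (A : set I) (o : I -> nat * nat) (a b : nat) :
  (exists i, A i) -> (forall i, A i -> (o i).1 <= a /\ (o i).2 <= b)%N ->
  exists2 i, A i & forall j, A j ->
    ((o j : nat *l nat) <= (o i : nat *l nat))%O.
Proof.
move=> [i0 Ai0] bd.
have ex1 : exists m, `[< exists2 i, A i & (o i).1 = m >].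
  by exists (o i0).1; apply/asboolP; exists i0.
have bd1 m : `[< exists2 i, A i & (o i).1 = m >] -> (m <= a)%N.
  by move=> /asboolP[i /bd[+ _] <-].
case: (ex_maxnP ex1 bd1) => m /asboolP[i1 Ai1 e1] max1.
have ex2 : exists l, `[< exists i, [/\ A i, (o i).1 = m & (o i).2 = l] >].
  by exists (o i1).2; apply/asboolP; exists i1.
have bd2 l : `[< exists i, [/\ A i, (o i).1 = m & (o i).2 = l] >] -> (l <= b)%N.
  by move=> /asboolP[i [/bd[_ +] _ <-]].
case: (ex_maxnP ex2 bd2) => l /asboolP[i [Ai ei1 ei2]] max2.
exists i => // j Aj; rewrite Order.ProdLexiOrder.leEprodlexi !Order.NatOrder.leEnat.
have le1 : ((o j).1 <= m)%N by apply: max1; apply/asboolP; exists j.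
rewrite ei1 le1 /=; apply/implyP => ge1; rewrite ei2.
apply: max2; apply/asboolP; exists j; split=> //.
by apply/eqP; rewrite eqn_leq le1.
Qed.

Section ExistsFullyNormalized.
Variables (p : nat) (gT : groupType) (S : set gT) (F : hom_family gT).
Hypotheses (p_pr : prime p) (tS : discrete_p_toral p S).
Hypothesis (fusF : fusion_system S F).

(** Conjugate subgroups have the same order, so [normalizer_order_bound] applies to the whole class
    with a single bound. *)
Lemma exists_fully_normalized P : subgroup_of S P ->
  exists Q f, isoF F P Q f /\ fully_normalized p S F Q.
Proof.
move=> sP; have sS := tS.1.
have [B leB] := normalizer_order_bound p_pr tS (toral_order p P).2.
have sub Q : conj_class F P Q -> subgroup_of S Q.
  by move=> [f [Ff _]]; apply: (fusion_cod fusF Ff).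
have bd Q : conj_class F P Q -> ((toral_order p (normalizer S Q)).1 <= (toral_order p S).1)%N
    /\ ((toral_order p (normalizer S Q)).2 <= B)%N.
  move=> cQ; have sQ := sub _ cQ; split.
    have := toral_order_sub p_pr tS fusF (subgroup_normalizer Q sS)
      (conj sS (fun _ => id)) (@normalizer_sub _ S Q).
    by rewrite /toral_order_le Order.ProdLexiOrder.leEprodlexi !Order.NatOrder.leEnat => /andP[].
  apply: leB => //; have [f isof] := cQ; have [h isoh _] := isoF_sym isof.
  have le1 := (fusion_order_le p_pr tS fusF isof.1 sP.1 (fun _ => id) sQ
    (fun x => fusion_map fusF isof.1)).1.
  have le2 := (fusion_order_le p_pr tS fusF isoh.1 sQ.1 (fun _ => id) sP
    (fun x => fusion_map fusF isoh.1)).1.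
  suff -> : toral_order p Q = toral_order p P by [].
  apply/eqP; rewrite /toral_order_le in le1 le2.
  rewrite (_ : (_ == _) = ((toral_order p Q : nat *l nat) == toral_order p P)) //.
  by rewrite Order.POrderTheory.eq_le le1 le2.
have idP : conj_class F P P by exists id; exact: (AutF_id fusF sS sP).
have [Q cQ maxQ] := lexi_max_exists (o := fun Q => toral_order p (normalizer S Q))
  (ex_intro _ P idP) bd.
have [f isof] := cQ; exists Q, f; split=> // R [h isoh].
by apply: maxQ; exists (h \o f); apply: (isoF_comp fusF isof isoh).
Qed.

End ExistsFullyNormalized.

(** * From saturation to centralizers *)

Section CentralizerFusionSystem.
Variables (p : nat) (gT : groupType) (S : set gT) (F : hom_family gT).
Hypotheses (p_pr : prime p) (tS : discrete_p_toral p S).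
Hypothesis (fusF : fusion_system S F).
Variable x : gT.
Hypotheses (Sx : S x) (xp : x ^+ p = 1).
Implicit Types (y g u : gT) (P Q R : set gT) (f h k : gT -> gT).

Let sS : subgroup S := tS.1.

Let sSS : subgroup_of S S := conj sS (fun _ => id).

Local Notation C := (centralizer S [set x]).
Local Notation G := (C_fusion S F x).

Let sC : subgroup C := subgroup_C tS x.

Let inR P u : P u -> adjoin P x u. Proof. exact: sub_adjoin. Qed.

Lemma mem_C : C x.
Proof. by split=> // _ ->. Qed.

Lemma adjoin_memP P y : subgroup_of C P ->
  adjoin P x y <-> exists2 u, P u & exists n, y = u * x ^+ n.
Proof.
move=> [sP PC]; apply: (adjoinP _ sP) (prime_gt0 p_pr) xp => u /PC[_ cu].
exact: cu.
Qed.

Lemma adjoin_sub_C P : subgroup_of C P -> subgroup_of C (adjoin P x).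
Proof.
move=> [sP PC]; split; first exact: subgroup_adjoin.
by apply: adjoin_sub => //; exact: mem_C.
Qed.

Lemma adjoin_C_id : adjoin C x = C.
Proof. by apply: adjoin_id => //; exact: mem_C. Qed.

Lemma adjoin_of_S P : subgroup_of C P -> subgroup_of S (adjoin P x).
Proof. by move=> /adjoin_sub_C/subgroup_of_C. Qed.

Lemma adjoin_map P Q f : subgroup_of C P -> subgroup_of C Q ->
  multiplicative_on (adjoin P x) f -> f x = x ->
  (forall u, P u -> Q (f u)) -> forall u, adjoin P x u -> adjoin Q x (f u).
Proof.
move=> sP sQ fM fx PQ u /(adjoin_memP _ sP)[v Pv [n ->]].
have sR := subgroup_adjoin P x; have Rv := inR Pv; have Rx := @mem_adjoin gT P x.
rewrite fM //; last exact: (subgroupX n sR Rx).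
rewrite (multiplicative_onX n sR fM Rx) fx; apply/(adjoin_memP _ sQ).
by exists (f v); [exact: PQ|exists n].
Qed.

(** A homomorphism on $P\langle x\rangle$ is determined by its restriction to [P] and its value at
    $x$. *)
Lemma adjoin_agree P f h : subgroup_of C P -> multiplicative_on (adjoin P x) f ->
  multiplicative_on (adjoin P x) h -> f x = h x -> (forall u, P u -> f u = h u) ->
  forall u, adjoin P x u -> f u = h u.
Proof.
move=> sP fM hM fx e u /(adjoin_memP _ sP)[v Pv [n ->]].
have sR := subgroup_adjoin P x; have Rv := inR Pv; have Rx := @mem_adjoin gT P x.
have RX := subgroupX n sR Rx.
by rewrite fM // hM // (multiplicative_onX n sR fM Rx) (multiplicative_onX n sR hM Rx) fx e.
Qed.

Lemma image_adjoin P f : subgroup_of C P -> multiplicative_on (adjoin P x) f ->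
  f x = x -> subgroup_of C (f @` P) -> f @` (adjoin P x) = adjoin (f @` P) x.
Proof.
move=> sP fM fx sfP; apply/seteqP; split=> [_ [u Ru <-]|u].
  by apply: (adjoin_map sP sfP fM fx) => // v Pv; exists v.
move=> /(adjoin_memP _ sfP)[_ [v Pv <-] [n ->]].
have sR := subgroup_adjoin P x; have Rv := inR Pv; have Rx := @mem_adjoin gT P x.
exists (v * x ^+ n); first by apply: (subgroupM sR) => //; apply: (subgroupX n sR).
rewrite fM //; last exact: (subgroupX n sR Rx).
by rewrite (multiplicative_onX n sR fM Rx) fx.
Qed.

Lemma C_fusion_intro P Q k : subgroup_of C P -> subgroup_of C Q ->
  F (adjoin P x) S k -> k x = x -> (forall u, P u -> Q (k u)) -> G P Q k.
Proof.
move=> sP sQ Fk kx PQ; have kM := fusion_mul fusF Fk.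
have sR := subgroup_adjoin P x.
split=> //.
  apply: (fusion_restrict fusF sS Fk) => //; [exact: sP.1|exact: sub_adjoin|].
  exact: (subgroup_of_C sQ).
exists k => //; apply: (fusion_restrict fusF sS Fk) => //.
  exact: adjoin_of_S.
exact: adjoin_map.
Qed.

Lemma C_fusion_elim P Q f : G P Q f -> exists h,
  [/\ subgroup_of C P, subgroup_of C Q, F P Q f &
    [/\ F (adjoin P x) (adjoin Q x) h, forall u, P u -> h u = f u & h x = x]].
Proof.
move=> [sP sQ Ff [h Fh [hf hx]]]; exists h; split=> //; split=> // u Pu.
by apply: hf; apply: mem_set.
Qed.

Lemma C_fusion_centralizes P k u : F (adjoin P x) S k -> k x = x ->
  subgroup_of C P -> P u -> C (k u).
Proof.
move=> Fk kx sP Pu; have kM := fusion_mul fusF Fk.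
have Ru := inR Pu; have Rx := @mem_adjoin gT P x.
split; first exact: (fusion_map fusF Fk Ru).
have [_ cu] := sP.2 _ Pu.
by move=> _ ->; rewrite -{1 2}kx -!kM // cu.
Qed.

(** A morphism of $P\langle x\rangle$ fixing $x$ is an isomorphism onto $k(P)\langle x\rangle$, and
    its inverse also fixes $x$. *)
Lemma C_fusion_factor P k : subgroup_of C P -> F (adjoin P x) S k -> k x = x ->
  isoF G P (k @` P) k.
Proof.
move=> sP Fk kx; have kM := fusion_mul fusF Fk.
have PR u : P u -> adjoin P x u := @inR P u.
have kM' : multiplicative_on P k by move=> u v /PR Ru /PR Rv; apply: kM.
have skP : subgroup_of C (k @` P).
  split; first exact: (subgroup_image sP.1 kM').
  by move=> _ [u Pu <-]; apply: (C_fusion_centralizes Fk kx sP Pu).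
have eR := image_adjoin sP kM kx skP.
have [h [Fk' Fh hk kh]] := isoF_inv (fusion_factor fusF Fk).
rewrite eR in Fk' Fh kh.
have hx : h x = x by rewrite -{1}kx hk //; apply: mem_adjoin.
apply: (isoF_intro (h := h)).
- by apply: C_fusion_intro => // u Pu; exists u.
- apply: C_fusion_intro => //.
    apply: (fusion_restrict fusF sS Fh) => //; first exact: subgroup_adjoin.
    by move=> u Ru; apply: (fusion_dom_sub fusF Fk); apply: (fusion_map fusF Fh).
  by move=> _ [u Pu <-]; rewrite hk //; apply: PR.
- by move=> u Pu; rewrite hk //; apply: PR.
- by move=> _ [u Pu <-]; rewrite hk //; apply: PR.
Qed.

Lemma adjoin_to_S P Q h : F (adjoin P x) (adjoin Q x) h -> F (adjoin P x) S h.
Proof.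
move=> Fh; apply: (fusion_restrict fusF sS Fh) => //; first exact: subgroup_adjoin.
by move=> u Ru; apply: (fusion_cod fusF Fh).2; apply: (fusion_map fusF Fh).
Qed.

Lemma C_fusion_system : fusion_system C G.
Proof.
split.
- by move=> P Q f [sP sQ _ _].
- move=> P Q f k e /C_fusion_elim[h [sP sQ Ff [Fh hf hx]]]; split=> //.
    exact: (fusion_ext fusF e Ff).
  exists h => //; split=> // u uP; rewrite hf ?e //; exact: set_mem.
- move=> P Q R f k /C_fusion_elim[h [sP sQ Ff [Fh hf hx]]].
  move=> /C_fusion_elim[l [_ sR Fk [Fl lk lx]]]; split=> //.
    exact: (fusion_comp fusF Ff Fk).
  exists (l \o h); first exact: (fusion_comp fusF Fh Fl).
  split; last by rewrite /= hx.
  move=> u /set_mem Pu /=; rewrite hf // lk //.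
  exact: (fusion_map fusF Ff Pu).
- move=> P Q sP sQ f [s Cs [sub fs]]; have [Ss /(_ x erefl) cs] := Cs.
  have PQ u : P u -> Q (cj s u) by move=> Pu; apply: sub; exists u.
  have csx : cj s x = x by apply/cj_fixP.
  have FR : F (adjoin P x) S (cj s).
    apply: (fusion_cj fusF) => //; first exact: adjoin_of_S.
    move=> u Ru; apply: subgroup_cj => //.
    exact: (adjoin_of_S sP).2 Ru.
  have [_ _ Fc [h Fh [hf hx]]] := C_fusion_intro sP sQ FR csx PQ.
  split=> //; first by apply: (fusion_eq fusF Fc) => u Pu; apply: fs; apply: mem_set.
  by exists h => //; split=> // u uP; rewrite hf // fs.
- by move=> P Q f [_ _ Ff _]; apply: (fusion_inj fusF Ff).
- move=> P Q f /C_fusion_elim[h [sP sQ Ff [Fh hf hx]]].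
  have isoh := C_fusion_factor sP (adjoin_to_S Fh) hx.
  have e : f @` P = h @` P by apply: eq_imagel => u Pu; rewrite hf.
  rewrite e; have [k [Gh Gk kh hk]] := isoF_inv isoh.
  have [sP' skP Fh' [l Fl [lh lx]]] := Gh.
  apply: (isoF_intro (h := k)) => //.
  + split=> //; first by apply: (fusion_eq fusF Fh') => u Pu; rewrite hf.
    by exists l => //; split=> // u uP; rewrite lh // hf //; apply: set_mem.
  + by move=> u Pu; rewrite -hf // kh.
  + move=> u Pu; rewrite -hf ?hk //; have [_ _ Fk _] := Gk.
    exact: (fusion_map fusF Fk Pu).
Qed.

(** This identity turns full centralization of [P] in $C_{\mathcal F}(x)$ into a statement about
    $P\langle x\rangle$ in $\mathcal F$. *)
Lemma centralizer_adjoin P : subgroup_of C P ->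
  centralizer C P = centralizer S (adjoin P x).
Proof.
move=> sP; apply/seteqP; split=> g.
  move=> [[Sg cx] cg]; split=> // u /(adjoin_memP _ sP)[v Pv [n ->]].
  have cxg : commute g x by apply: cx.
  by apply: commuteM; [exact: cg|exact: commuteX].
move=> [Sg cg]; split; first by split=> // _ ->; apply: cg; apply: mem_adjoin.
by move=> u Pu; apply: cg; apply: sub_adjoin.
Qed.

Lemma isoF_adjoin P Q f : isoF G P Q f -> exists h,
  [/\ isoF F (adjoin P x) (adjoin Q x) h, forall u, P u -> h u = f u & h x = x].
Proof.
move=> isof; have [Gf _] := isof; have eQ := isoF_image C_fusion_system isof.
have [h [sP sQ Ff [Fh hf hx]]] := C_fusion_elim Gf.
have e : h @` P = Q by rewrite -eQ; apply: eq_imagel => u Pu; rewrite hf.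
exists h; split=> //; have := fusion_factor fusF Fh.
rewrite image_adjoin ?e //; exact: (fusion_mul fusF Fh).
Qed.

End CentralizerFusionSystem.

(** * The set $\mathfrak X$, and axioms (II) and (III) for the centralizer systems *)

Section SaturatedCentralizers.
Variables (p : nat) (gT : groupType) (S : set gT) (F : hom_family gT).
Hypotheses (p_pr : prime p) (tS : discrete_p_toral p S).
Hypothesis (fusF : fusion_system S F).
Hypothesis (satF : saturated p S F).
Implicit Types (x y g u : gT) (P Q R : set gT) (f h : gT -> gT).

Let sS : subgroup S := tS.1.
Let sSS : subgroup_of S S := conj sS (fun _ => id).

Local Notation C x := (centralizer S [set x]).

(** The set $\mathfrak X$ that witnesses condition (b). *)
Definition fully_centralized_elt x :=
  [/\ S x, has_order x p & fully_centralized p S F (cyclic_gen x)].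

(** A fully normalized conjugate of $\langle x\rangle$ exists, and axiom (I) makes it fully
    centralized. *)
Lemma fully_centralized_conj x : S x -> has_order x p ->
  exists2 y, fully_centralized_elt y & conj_elts S F x y.
Proof.
move=> Sx ox; have [_ xp x_min] := ox.
have sX : subgroup_of S (cyclic_gen x).
  split; first exact: generated_subgroup.
  by apply: generated_sub => // u ->.
have [Q [f [isof fnQ]]] := exists_fully_normalized p_pr tS fusF sX.
have [satI _ _] := satF; have [fcQ _ _] := satI Q (fusion_cod fusF isof.1) fnQ.
have Xx : cyclic_gen x x by apply: sub_generated.
have cxy := fusion_conj_elts p_pr tS fusF isof.1 Xx xp.
have fM := fusion_mul fusF isof.1; have fI := fusion_injective fusF isof.1.
have sXg := sX.1; have fX k : f (x ^+ k) = f x ^+ k by apply: (multiplicative_onX k sXg fM Xx).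
have f1 := multiplicative_on1 sXg fM.
have fxp : f x ^+ p = 1 by rewrite -fX xp.
have eQ : Q = cyclic_gen (f x).
  rewrite -(isoF_image fusF isof); apply/seteqP; split=> [_ [u Xu <-]|u].
    have [k ->] := (cyclic_genP u (prime_gt0 p_pr) xp).1 Xu.
    by apply/(cyclic_genP _ (prime_gt0 p_pr) fxp); exists k.
  move=> /(cyclic_genP _ (prime_gt0 p_pr) fxp)[k ->]; exists (x ^+ k) => //.
  exact: (subgroupX k sXg Xx).
exists (f x) => //; split; [by case: cxy| |by rewrite -eQ].
split=> //; first exact: prime_gt0.
move=> m /x_min xm; rewrite -fX -f1 => /fI e; apply: xm.
by apply: e; [exact: (subgroupX m sXg Xx)|exact: (subgroup1 sXg)].
Qed.

(** Elements of $C_S(x)$ act trivially on $\langle x\rangle$, so they lie in $N_\varphi$ and axiom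
    (II) extends the map to them. *)
Lemma conj_elts_extend x y : conj_elts S F x y -> fully_centralized_elt y ->
  exists2 rho, F (C x) (C y) rho & rho x = y.
Proof.
move=> [Sx Sy [f Ff fx]] [_ [_ yp _] fcy].
have Xx : cyclic_gen x x by apply: sub_generated.
have sXg : subgroup (cyclic_gen x) := generated_subgroup _.
have fM := fusion_mul fusF Ff; have fI := fusion_injective fusF Ff.
have f1 := multiplicative_on1 sXg fM.
have fX k : f (x ^+ k) = f x ^+ k by apply: (multiplicative_onX k sXg fM Xx).
have xp : x ^+ p = 1.
  apply: fI; [exact: (subgroupX p sXg Xx)|exact: (subgroup1 sXg)|].
  by rewrite fX f1 fx.
have Ff' : F (cyclic_gen x) S f.
  apply: (fusion_restrict fusF sS Ff) => // u Xu.
  by apply: (fusion_cod fusF Ff).2; apply: (fusion_map fusF Ff).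
have eY : f @` cyclic_gen x = cyclic_gen y.
  apply/seteqP; split=> [_ [u Xu <-]|u]; first exact: (fusion_map fusF Ff).
  move=> /(cyclic_genP _ (prime_gt0 p_pr) yp)[k ->]; exists (x ^+ k).
    exact: (subgroupX k sXg Xx).
  by rewrite fX fx.
have [_ satII _] := satF.
have [|rho Frho rhof] := satII _ f Ff'; first by rewrite eY.
have CN : C x `<=` N_phi S (cyclic_gen x) f.
  move=> g [Sg cg]; have cX u : cyclic_gen x u -> cj g u = u.
    move=> /(cyclic_genP _ (prime_gt0 p_pr) xp)[k ->]; apply/cj_fixP.
    by apply: commuteX; apply: cg.
  have ng : normalizer S (cyclic_gen x) g.
    apply: centralizer_normalizer; split=> // u /cX.
    by move/cj_fixP.
  apply/(N_phiP _ _ fI); split=> //; exists 1.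
    exact: (subgroup1 (subgroup_normalizer _ sS)).
  by move=> u Xu; rewrite cX // cj1.
have rhox : rho x = y by rewrite rhof ?fx //; apply: mem_set.
exists rho => //; apply: (fusion_restrict fusF sS Frho) => //.
- exact: (subgroup_C tS).
- by split; [exact: (subgroup_C tS)|exact: C_sub].
move=> g Cg; have Cx : C x x by exact: mem_C.
have := fusion_centralizer fusF Frho (A := [set x]) _ (CN _ Cg) Cg.
by rewrite image_set1 rhox; apply=> u ->; apply: CN.
Qed.

Section FixedElement.
Variable x : gT.
Hypothesis fcx : fully_centralized_elt x.
Local Notation G := (C_fusion S F x).

Let Sx : S x. Proof. by case: fcx. Qed.
Let xp : x ^+ p = 1. Proof. by case: fcx => _ []. Qed.
Let sC : subgroup (C x) := subgroup_C tS x.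
Let sSC : subgroup_of S (C x) := conj sC (@C_sub gT S x).
Let sCC : subgroup_of (C x) (C x) := conj sC (fun _ => id).
Let fusG : fusion_system (C x) G := C_fusion_system p_pr tS fusF Sx xp.

(** A conjugate [R1] of $P\langle x\rangle$ lies in the centralizer of $a(x)$, which extends back to
    $C_S(x)$ as $x$ is in $\mathfrak X$. The image is conjugate inside $C_{\mathcal F}(x)$, where
    [P] has the largest centralizer. *)
Lemma fully_centralized_adjoin P : subgroup_of (C x) P ->
  fully_centralized p (C x) G P -> fully_centralized p S F (adjoin P x).
Proof.
move=> sP fcP R1 [a isoa]; set R := adjoin P x in isoa *.
have Rx : R x by apply: mem_adjoin.
have sR : subgroup R by apply: subgroup_adjoin.
have cxR : centralizer R R x.
  by split=> // u Ru; have [_ cu] := (adjoin_sub_C tS Sx sP).2 _ Ru; rewrite cu.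
have R1x := fusion_map fusF isoa.1 Rx.
have aM := fusion_mul fusF isoa.1.
have sR1 := fusion_cod fusF isoa.1.
have axp : a x ^+ p = 1.
  by rewrite -(multiplicative_onX p sR aM Rx) xp (multiplicative_on1 sR aM).
have [a' isoa' [a'a aa']] := isoF_sym isoa.
have cax : conj_elts S F (a x) x.
  by have := fusion_conj_elts p_pr tS fusF isoa'.1 R1x axp; rewrite a'a.
have [rho Frho rhox] := conj_elts_extend cax fcx.
have R1C : R1 `<=` C (a x).
  apply: (center_sub_C sR1.2); split=> // u R1u.
  have R'u := fusion_map fusF isoa'.1 R1u.
  by rewrite -[u]aa' // -!aM // cxR.2.
have [_ isor] := fusion_sub_iso tS fusF Frho sR1.1 R1C.
have isok := isoF_comp fusF isoa isor.
have Fk : F R S (rho \o a).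
  apply: (fusion_restrict fusF sS isok.1) => // u Ru.
  by apply: (fusion_cod fusF isor.1).2; apply: (fusion_map fusF isok.1).
have kx : (rho \o a) x = x by [].
have isoP := C_fusion_factor p_pr tS fusF Sx xp sP Fk kx.
have sP2 := fusion_cod fusG isoP.1.
have := fcP _ (ex_intro _ _ isoP).
rewrite !(centralizer_adjoin p_pr xp) //.
have -> : adjoin ((rho \o a) @` P) x = rho @` R1.
  rewrite -(image_adjoin p_pr xp sP (fusion_mul fusF Fk) kx sP2).
  by rewrite -(isoF_image fusF isoa) image_comp.
apply: toral_order_le_trans.
have CR1 := centralizer_sub_C (S := S) R1x.
apply: (fusion_order_le p_pr tS fusF Frho (subgroup_centralizer R1 sS) CR1
  (subgroup_of_centralizer tS (rho @` R1)) _).1.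
by move=> u cu; apply: (fusion_centralizer fusF Frho R1C (CR1 _ cu)).
Qed.

Lemma C_fusion_saturation_II : saturation_II p (C x) G.
Proof.
move=> P f Gf fcP; have [h [sP _ Ff [Fh hf hx]]] := C_fusion_elim Gf.
have FhS := adjoin_to_S tS fusF Fh.
set R := adjoin P x in Fh FhS.
have sfP : subgroup_of (C x) (f @` P) := fusion_image fusG Gf.
have e : h @` P = f @` P by apply: eq_imagel => u Pu; rewrite hf.
have eR : h @` R = adjoin (f @` P) x.
  by rewrite -e; apply: (image_adjoin p_pr xp sP (fusion_mul fusF Fh) hx); rewrite e.
have [_ satII _] := satF.
have [|H FH Hh] := satII _ h FhS.
  by rewrite eR; apply: fully_centralized_adjoin.
have fI := fusion_injective fusF Ff; have hI := fusion_injective fusF Fh.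
have fM := fusion_mul fusF Ff; have hM := fusion_mul fusF Fh.
have Rx : R x by apply: mem_adjoin.
(* Elements of $C_S(x)$ fix $x$, so a relation between $g$ and $w$ on [P] persists on $P\langle
   x\rangle$. *)
have NN : N_phi (C x) P f `<=` N_phi S R h.
  move=> g /(N_phiP _ _ fI)[ng [w nw wE]]; apply/(N_phiP _ _ hI).
  have [Sg /(_ x erefl) cg] := ng.1; have gx : cj g x = x by apply/cj_fixP.
  have [Sw /(_ x erefl) cw] := nw.1; have wx : cj w x = x by apply/cj_fixP.
  have nR Q b : subgroup_of (C x) Q -> normalizer (C x) Q b -> normalizer S (adjoin Q x) b.
    move=> sQ nb; have [Sb /(_ x erefl) cb] := nb.1; split=> //.
    have bx : cj b x = x by apply/cj_fixP.
    rewrite (image_adjoin p_pr xp sQ _ bx); first by rewrite nb.2.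
      by move=> u v _ _; apply: cjM.
    by rewrite nb.2.
  split; first exact: nR.
  exists w; first by rewrite eR; apply: nR.
  have ngR : normalizer S R g by apply: nR.
  apply: (adjoin_agree p_pr xp sP (f := h \o cj g) (h := cj w \o h)).
  - by move=> u v Ru Rv /=; rewrite cjM hM //; apply: normalizer_cj ngR _.
  - by move=> u v Ru Rv /=; rewrite hM // cjM.
  - by rewrite /= gx hx wx.
  - by move=> u Pu /=; rewrite !hf ?wE //; apply: normalizer_cj ng Pu.
have sN : subgroup (N_phi (C x) P f) := subgroup_N_phi sC fI.
have NC : N_phi (C x) P f `<=` C x := @N_phi_sub _ (C x) P f.
(* As $x$ already lies in the domain, nothing has to be adjoined to it, and it is enough that the
   extension fixes $x$. *)
have Nx : N_phi (C x) P f x.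
  apply/(N_phiP _ _ fI); have cf Q u : Q `<=` C x -> Q u -> cj x u = u.
    by move=> QC /QC[_ cu]; apply/cj_fixP; rewrite cu.
  have nx Q : Q `<=` C x -> normalizer (C x) Q x.
    move=> QC; apply: centralizer_normalizer; split; first exact: (mem_C Sx).
    by move=> u Qu; apply/cj_fixP/(cf Q).
  split; first exact: (nx _ sP.2).
  exists x; first exact: (nx _ sfP.2).
  move=> u Pu; have fPu : (f @` P) (f u) by exists u.
  by rewrite (cf _ _ sP.2 Pu) (cf _ _ sfP.2 fPu).
have Hx : H x = x by rewrite Hh ?hx //; apply: mem_set.
exists H; last first.
  by move=> u /set_mem Pu; rewrite Hh ?hf //; apply: mem_set; apply: sub_adjoin.
have FN : F (N_phi (C x) P f) S H.
  apply: (fusion_restrict fusF sS FH) => // u Nu.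
  by apply: (fusion_map fusF FH); apply: NN.
apply: (C_fusion_intro p_pr tS fusF Sx xp) => //; rewrite ?adjoin_id //.
move=> g Ng; apply: (C_fusion_centralizes fusF (P := N_phi (C x) P f)) => //.
by rewrite adjoin_id.
Qed.

(** The extensions to the groups $P_n\langle x\rangle$ are unique, hence agree and glue; axiom (III)
    of $\mathcal F$ applies to the glued map on their union. *)
Lemma C_fusion_saturation_III : saturation_III (C x) G.
Proof.
move=> P phi sP incP [phiC phiM] Gphi.
have ext n : exists h, F (adjoin (P n) x) (C x) h /\
    ((forall u, P n u -> h u = phi u) /\ h x = x).
  have [h [_ _ _ [Fh hf hx]]] := C_fusion_elim (Gphi n).
  by exists h; rewrite (adjoin_C_id tS Sx) in Fh.
have /choice[hs hsP] : forall n, exists h, F (adjoin (P n) x) (C x) h /\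
    ((forall u, P n u -> h u = phi u) /\ h x = x) by exact: ext.
have Pmono m n : (m <= n)%N -> P m `<=` P n.
  elim: n => [|n IH]; first by rewrite leqn0 => /eqP ->.
  rewrite leq_eqVlt => /orP[/eqP -> //|]; rewrite ltnS => /IH sub u /sub.
  exact: incP.
have Rmono m n : (m <= n)%N -> adjoin (P m) x `<=` adjoin (P n) x.
  move=> /Pmono sub; apply: adjoin_sub; [exact: subgroup_adjoin| |exact: mem_adjoin].
  by move=> u /sub Pu; apply: sub_adjoin.
have hsE m n u : (m <= n)%N -> adjoin (P m) x u -> hs m u = hs n u.
  move=> mn; have [Fm [hm xm]] := hsP m; have [Fn [hn xn]] := hsP n.
  apply: (adjoin_agree p_pr xp (sP m)).
  - exact: (fusion_mul fusF Fm).
  - by move=> v w /(Rmono _ _ mn) Rv /(Rmono _ _ mn) Rw; apply: (fusion_mul fusF Fn).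
  - by rewrite xm xn.
  - by move=> v Pv; rewrite hm // hn //; apply: Pmono Pv.
pose U := \bigcup_n adjoin (P n) x.
have /choice[Phi PhiP] : forall u, exists v, U u -> exists2 n, adjoin (P n) x u & v = hs n u.
  move=> u; case: (pselect (U u)) => [[n _ Ru]|nU]; last by exists 1.
  by exists (hs n u) => _; exists n.
have PhiE n u : adjoin (P n) x u -> Phi u = hs n u.
  move=> Ru; have [|m Rm ->] := PhiP u; first by exists n.
  by have [mn|/ltnW nm] := leqP m n; [apply: hsE|rewrite (hsE n m)].
have FPhi n : F (adjoin (P n) x) S Phi.
  have [Fn _] := hsP n; apply: (fusion_eq fusF (f := hs n)); last exact: PhiE.
  apply: (fusion_restrict fusF sS Fn) => //; first exact: subgroup_adjoin.
  by move=> u Ru; apply: (fusion_cod fusF Fn).2; apply: (fusion_map fusF Fn).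
have [_ _ satIII] := satF.
have FU : F U S Phi.
  apply: satIII => //.
  - by move=> n; apply: (adjoin_of_S tS Sx (sP n)).
  - by move=> n; apply: Rmono.
  split; first by move=> _ [u [n _ Ru] <-]; apply: (fusion_map fusF (FPhi n)).
  move=> u v /set_mem[m _ Ru] /set_mem[n _ Rv].
  apply: (fusion_mul fusF (FPhi (maxn m n))).
    exact: Rmono (leq_maxl m n) _ Ru.
  exact: Rmono (leq_maxr m n) _ Rv.
have sUP : subgroup_of (C x) (\bigcup_n P n).
  split; last by move=> u [n _ /(sP n).2].
  split; first by exists 0%N => //; apply: subgroup1 (sP 0%N).1.
  move=> u v [m _ Pu] [n _ Pv]; exists (maxn m n) => //; apply: (sP _).1.2.
    exact: Pmono (leq_maxl m n) _ Pu.
  exact: Pmono (leq_maxr m n) _ Pv.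
have eU : adjoin (\bigcup_n P n) x `<=` U.
  apply: adjoin_sub; first exact: (fusion_domS fusF FU).
    by move=> u [n _ Pu]; exists n => //; apply: sub_adjoin.
  by exists 0%N => //; apply: mem_adjoin.
have Phix : Phi x = x.
  by have [_ [_ hx]] := hsP 0%N; rewrite (PhiE 0%N) //; apply: mem_adjoin.
have Phiphi u : (\bigcup_n P n) u -> Phi u = phi u.
  move=> [n _ Pu]; have [_ [hn _]] := hsP n.
  by rewrite (PhiE n) ?hn //; apply: sub_adjoin.
apply: (fusion_eq fusG (f := Phi)); last by move=> u Uu; rewrite Phiphi.
apply: (C_fusion_intro p_pr tS fusF Sx xp) => //.
- apply: (fusion_restrict fusF sS FU) => //; first exact: subgroup_adjoin.
  by move=> u /eU Uu; apply: (fusion_map fusF FU).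
- by move=> u Uu; rewrite Phiphi //; apply: phiC; exists u.
Qed.

End FixedElement.
End SaturatedCentralizers.

(** * Axiom (I) for the centralizer systems *)

Section CentralizerSylow.
Variables (p : nat) (gT : groupType) (S : set gT) (F : hom_family gT).
Hypotheses (p_pr : prime p) (tS : discrete_p_toral p S).
Hypothesis (fusF : fusion_system S F).
Hypothesis (satF : saturated p S F).
Implicit Types (x y g u : gT) (P Q R : set gT) (f h : gT -> gT).

Let sS : subgroup S := tS.1.
Let sSS : subgroup_of S S := conj sS (fun _ => id).

Local Notation C x := (centralizer S [set x]).

Section FixedElement.
Variable x : gT.
Hypothesis fcx : fully_centralized_elt p S F x.
Local Notation G := (C_fusion S F x).

Let Sx : S x. Proof. by case: fcx. Qed.
Let xp : x ^+ p = 1. Proof. by case: fcx => _ []. Qed.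
Let sC : subgroup (C x) := subgroup_C tS x.
Let sSC : subgroup_of S (C x) := conj sC (@C_sub gT S x).
Let fusG : fusion_system (C x) G := C_fusion_system p_pr tS fusF Sx xp.

(** The automorphisms of $P\langle x\rangle$ whose restrictions to [P] form
    $\operatorname{Aut}_{C_{\mathcal F}(x)}(P)$. *)
Definition aut_fix P : set (gT -> gT) :=
  [set f | [/\ AutF F (adjoin P x) f, f x = x & f @` P = P]].

(** The counterpart of $\operatorname{Aut}_{C_S(x)}(P)$ on $P\langle x\rangle$. *)
Definition aut_conj P : set (gT -> gT) :=
  [set f | exists2 g, normalizer (C x) P g & forall u, adjoin P x u -> f u = cj g u].

Lemma normalizer_adjoin Q g : subgroup_of (C x) Q ->
  normalizer (C x) Q g -> normalizer S (adjoin Q x) g.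
Proof.
move=> sQ nb; have [Sb /(_ x erefl) cb] := nb.1; split=> //.
have bx : cj g x = x by apply/cj_fixP.
rewrite (image_adjoin p_pr xp sQ _ bx); first by rewrite nb.2.
  by move=> u v _ _; apply: cjM.
by rewrite nb.2.
Qed.

Section Subgroup.
Variable P : set gT.
Hypothesis sP : subgroup_of (C x) P.
Let R := adjoin P x.

Let sR : subgroup_of S R := adjoin_of_S tS Sx sP.
Let Rx : R x. Proof. exact: mem_adjoin. Qed.
Let PR u : P u -> R u. Proof. exact: sub_adjoin. Qed.

Lemma aut_fixA : aut_fix P `<=` AutF F R. Proof. by move=> f []. Qed.

Lemma aut_fix_id : aut_fix P id.
Proof. by split=> //; [exact: (AutF_id fusF sS sR)|rewrite image_id]. Qed.

Lemma aut_fix_comp f h : aut_fix P f -> aut_fix P h -> aut_fix P (f \o h).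
Proof.
move=> [Af fx fP] [Ah hx hP]; split; first exact: (AutF_comp fusF).
  by rewrite /= hx.
by rewrite -image_comp hP.
Qed.

Lemma aut_conj_fix : aut_conj P `<=` aut_fix P.
Proof.
move=> f [g ng fE]; have [Sg /(_ x erefl) cg] := ng.1; split.
- apply: (AutS_AutF fusF sS sR); exists g; first exact: normalizer_adjoin.
  by move=> u /set_mem; apply: fE.
- by rewrite fE //; apply/cj_fixP.
- by rewrite -[RHS]ng.2; apply: eq_imagel => u Pu; exact: (fE u (PR Pu)).
Qed.

Lemma aut_conj_id : aut_conj P id.
Proof.
exists 1; first exact: (subgroup1 (subgroup_normalizer P sC)).
by move=> u _; rewrite cj1.
Qed.

Lemma aut_conj_comp f h : aut_conj P f -> aut_conj P h -> aut_conj P (f \o h).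
Proof.
move=> [a na fE] [b nb hE]; exists (a * b).
  exact: (subgroupM (subgroup_normalizer P sC) na nb).
move=> u Ru; rewrite /= hE // fE ?cj_comp //.
exact: (normalizer_cj (normalizer_adjoin sP nb) Ru).
Qed.

Lemma aut_conj_AutS : aut_conj P `<=` AutS S R.
Proof.
move=> f [g ng fE]; exists g; first exact: normalizer_adjoin.
by move=> u /set_mem; apply: fE.
Qed.

(** As $x$ is central in $P\langle x\rangle$, the inner automorphisms of this group are those
    induced by [P]. *)
Lemma out_class_adjoin f h f' h' : aut_fix P f -> aut_fix P h ->
  (forall u, P u -> f' u = f u) -> (forall u, P u -> h' u = h u) ->
  out_class R f = out_class R h <-> out_class P f' = out_class P h'.
Proof.
move=> [Af fx fP] [Ah hx hP] fE hE.
have fR u := @AutF_map _ _ _ fusF R f u Af; have hR u := @AutF_map _ _ _ fusF R h u Ah.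
have fP' u : P u -> P (f' u) by move=> Pu; rewrite fE // -fP; exists u.
have hP' u : P u -> P (h' u) by move=> Pu; rewrite hE // -hP; exists u.
have cxP y u : P y -> cj y x = x.
  by move=> /sP.2[_ cy]; apply/cj_fixP/cy.
split=> [/(out_classP sR.1 fR hR)|/(out_classP sP.1 fP' hP')] [g Pg gE].
  apply/(out_classP sP.1 fP' hP').
  have [y Py [n eg]] := (adjoin_memP p_pr xp g sP).1 Pg; exists y => // u Pu.
  rewrite hE // fE // gE ?eg; last exact: PR.
  rewrite cj_comp; congr cj; apply/cj_fixP.
  apply: commute_sym; apply: commuteX.
  have Pfu : P (f u) by rewrite -fE //; apply: fP'.
  by have [_ cf] := sP.2 _ Pfu; apply: cf.
apply/(out_classP sR.1 fR hR); exists g; first exact: PR.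
apply: (adjoin_agree p_pr xp (h := cj g \o f) sP).
- exact: (fusion_mul fusF Ah.1).
- by move=> u v Ru Rv /=; rewrite (fusion_mul fusF Af.1) // cjM.
- by rewrite /= hx fx (cxP _ 1).
- by move=> u Pu /=; rewrite -hE // gE // fE.
Qed.

Lemma aut_fix_AutG f : aut_fix P f -> AutF G P f.
Proof.
move=> [Af fx fP]; rewrite /AutF /= -{2}fP.
apply: (C_fusion_factor p_pr tS fusF Sx xp sP _ fx).
apply: (fusion_restrict fusF sS Af.1) => //; first exact: sR.1.
by move=> u Ru; apply: sR.2; apply: (AutF_map fusF Af).
Qed.

Lemma AutG_aut_fix b : AutF G P b ->
  exists2 f, aut_fix P f & forall u, P u -> b u = f u.
Proof.
move=> Ab; have [f [isof fb fx]] := isoF_adjoin p_pr tS fusF Sx xp Ab.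
exists f; last by move=> u Pu; rewrite fb.
split=> //; rewrite -[RHS](isoF_image fusG Ab).
by apply: eq_imagel => u Pu; rewrite fb.
Qed.

Lemma OutG_card : finite_set (out_class R @` aut_fix P) ->
  finite_set (OutF G P) /\ ncard (OutF G P) = ncard (out_class R @` aut_fix P).
Proof.
apply: (ncard_corr set0 (R := fun f b => forall u, P u -> b u = f u)).
- by move=> f Lf; exists f; [exact: aut_fix_AutG|].
- by move=> b /AutG_aut_fix[f Lf e]; exists f.
- by move=> f1 b1 f2 b2 L1 L2 _ _ e1 e2; apply: out_class_adjoin.
Qed.

Lemma OutC_card : finite_set (out_class R @` aut_conj P) ->
  ncard (OutS (C x) P) = ncard (out_class R @` aut_conj P).
Proof.
move=> fin.
suff [] : finite_set (OutS (C x) P) /\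
    ncard (OutS (C x) P) = ncard (out_class R @` aut_conj P) by [].
apply: (ncard_corr set0 (R := fun f b => forall u, P u -> b u = f u)) fin.
- move=> f [g ng fE]; exists f => //; exists g => // u /set_mem Pu.
  exact: (fE u (PR Pu)).
- move=> b [g ng bE]; exists (cj g); first by exists g.
  by move=> u Pu; apply: bE; apply: mem_set.
- move=> f1 b1 f2 b2 /aut_conj_fix L1 /aut_conj_fix L2 _ _ e1 e2.
  exact: out_class_adjoin.
Qed.

End Subgroup.

(** A Sylow subgroup [U] of the stabilizer of $x$ and [P], taken above the part induced by $C_S(x)$,
    is shown to be equal to that part. *)
Lemma C_fusion_saturation_I : saturation_I p (C x) G.
Proof.
move=> P sP fnP; set R := adjoin P x.
have sR : subgroup_of S R := adjoin_of_S tS Sx sP.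
have Rx : R x by apply: mem_adjoin.
have PR u : P u -> R u by apply: sub_adjoin.
have [Q [a0 [isoa0 fnQ]]] := exists_fully_normalized p_pr tS fusF sR.
have sQ := fusion_cod fusF isoa0.1.
have [satI satII _] := satF; have [fcQ finQ [_ pB idxB]] := satI Q sQ fnQ.
have finR := OutF_finite_iso fusF isoa0 finQ.
have [rT [pi [piM piE]]] := outer_representation fusF sS sR finR.
have Aid := AutF_id fusF sS sR.
have gO := out_image_group_set tS fusF sR piM (fun _ => id) Aid (AutF_comp fusF (P := R)).
have LA := @aut_fixA P.
have VL := @aut_conj_fix P sP.
have VA : aut_conj P `<=` AutF F R by move=> f /VL/LA.
have gL := out_image_group_set tS fusF sR piM LA (aut_fix_id sP) (@aut_fix_comp P).
have gV := out_image_group_set tS fusF sR piM VA (aut_conj_id P) (aut_conj_comp sP).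
(* $\operatorname{Aut}_S(Q)$ pulled back to [R]. Its classes form a Sylow subgroup because [Q] is
   fully normalized, so a conjugate of [U] lies in it. *)
pose B := [set f | AutF F R f /\ exists2 m, normalizer S Q m &
  forall u, R u -> a0 (f u) = cj m (a0 u)].
have BA : B `<=` AutF F R by move=> f [].
have sNQ := subgroup_normalizer Q sS.
have gB : group_set (out_image pi B).
  apply: (out_image_group_set tS fusF sR piM BA).
    by split=> //; exists 1; [exact: (subgroup1 sNQ)|move=> u _; rewrite cj1].
  move=> f h [Af [m nm fE]] [Ah [n nn hE]]; split; first exact: (AutF_comp fusF).
  exists (m * n); first exact: (subgroupM sNQ).
  move=> u Ru; rewrite /= fE; last exact: (AutF_map fusF Ah).
  by rewrite hE // cj_comp.
pose O := Group gO; pose LG := Group gL; pose VG := Group gV; pose BG := Group gB.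
have LO : LG \subset O.
  by apply/fintype.subsetP => _ /out_imageP[f /LA Af <-]; apply/out_imageP; exists f.
have VLG : VG \subset LG.
  by apply/fintype.subsetP => _ /out_imageP[f /VL Af <-]; apply/out_imageP; exists f.
have BO : BG \subset O.
  by apply/fintype.subsetP => _ /out_imageP[f /BA Af <-]; apply/out_imageP; exists f.
have finsub A : A `<=` AutF F R -> finite_set (out_class R @` A).
  by move=> AA; apply: sub_finite_set finR => _ [f /AA Af <-]; exists f.
have cO : #|O| = ncard (OutF F R) by apply: (card_out_image piE).
have cL : #|LG| = ncard (out_class R @` aut_fix P) by apply: (card_out_image piE) => //; exact: (finsub _ LA).
have cV : #|VG| = ncard (out_class R @` aut_conj P) by apply: (card_out_image piE) => //; exact: (finsub _ VA).
have cB : #|BG| = ncard (out_class R @` B) by apply: (card_out_image piE) => //; exact: (finsub _ BA).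
pose rel f b := forall u, R u -> b (a0 u) = a0 (f u).
have fR f u : AutF F R f -> R u -> R (f u) by move=> Af; apply: (AutF_map fusF Af).
have [a0' isoa0' [a0'K a0K']] := isoF_sym isoa0.
have cB' : ncard (OutS S Q) = ncard (out_class R @` B).
  suff [] : finite_set (OutS S Q) /\ ncard (OutS S Q) = ncard (out_class R @` B) by [].
  apply: (ncard_corr set0 (R := rel) _ _ _ (finsub _ BA)).
  - move=> f [Af [m nm fE]]; exists (cj m); first by exists m.
    by move=> u Ru; rewrite fE.
  - move=> b Sb; have [m nm bE] := Sb.
    have [f Af fE] := AutF_conj_inv fusF isoa0 (AutS_AutF fusF sS sQ Sb).
    exists f => //; split=> //; exists m => // u Ru.
    by rewrite -fE // bE //; apply: mem_set; apply: (fusion_map fusF isoa0.1).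
  move=> f1 b1 f2 b2 /BA A1 /BA A2 _ _ R1 R2.
  by apply: (out_class_transport fusF isoa0) => // u; apply: fR.
have cO' : ncard (OutF F Q) = ncard (OutF F R).
  suff [] : finite_set (OutF F Q) /\ ncard (OutF F Q) = ncard (OutF F R) by [].
  apply: (ncard_corr set0 (R := rel) _ _ _ finR).
  - by move=> f /(AutF_conj fusF isoa0)[b Ab bE]; exists b.
  - by move=> b /(AutF_conj_inv fusF isoa0)[f Af fE]; exists f.
  move=> f1 b1 f2 b2 A1 A2 _ _ R1 R2.
  by apply: (out_class_transport fusF isoa0) => // u; apply: fR.
have sylB : p.-Sylow(O) BG.
  apply/and3P; split; [exact: BO|by rewrite /pgroup cB -cB'|].
  by rewrite -divgS // cO cB -cO' -cB'.
have gS := out_image_group_set tS fusF sR piM (AutS_AutF fusF sS sR) (AutS_id tS R)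
  (@AutS_comp _ _ _ tS R).
have pV : p.-group VG.
  have pS : p.-group (Group gS) by apply: (AutS_image_pgroup p_pr tS fusF sR piM piE).
  apply: pgroupS pS; apply/fintype.subsetP => _ /out_imageP[f /(aut_conj_AutS sP) Af <-].
  by apply/out_imageP; exists f.
have [U sylU VU] := Sylow_superset VLG pV.
have [UL pU _] := and3P sylU.
have [s sO sUB] := Sylow_subJ sylB (fintype.subset_trans UL LO) pU.
have [g0 Ag0 es] := out_imageP _ _ _ sO.
pose a := a0 \o g0.
have isoa : isoF F R Q a by apply: (isoF_comp fusF Ag0 isoa0).
have [g0' Ag0' [g0'K g0K']] := isoF_sym Ag0.
have aR u : R u -> Q (a u) := fusion_map fusF isoa.1.
have pi_inv : pi g0' = (pi g0)^-1%g.
  apply/esym/mulg1_eq; rewrite -piM // -(pi_id tS fusF sR piM).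
  apply/piE => //; first exact: (AutF_comp fusF).
  by apply: out_class_eq => u Ru /=; rewrite g0K'.
(* The choice of g0 makes a U a^-1 a group of automorphisms of Q induced by S. *)
have key f : AutF F R f -> pi f \in U ->
    exists2 m, normalizer S Q m & forall u, R u -> a (f u) = cj m (a u).
  move=> Af fU; have /imsetP[t tB et] := fintype.subsetP sUB _ fU.
  have /out_imageP[b [Ab [m nm bE]] eb] := tB.
  have Afg := AutF_comp fusF Af Ag0'.
  have Agfg := AutF_comp fusF Ag0 Afg.
  have : pi b = pi (g0 \o (f \o g0')).
    rewrite (piM _ _ Ag0 Afg) (piM _ _ Af Ag0') pi_inv es eb et.
    by rewrite mulgA (conjgCV s) conjgK mulgK.
  move/(piE _ _ Ab Agfg)/(out_classP sR.1 (fun u => fR b u Ab) (fun u => fR _ u Agfg)).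
  move=> [r Rr rE]; exists (a0 r * m).
    apply: (subgroupM sNQ) => //; apply: subgroup_normalizer_self; [exact: sQ.1|exact: sQ.2|].
    exact: (fusion_map fusF isoa0.1).
  move=> u Ru; have Rgu := fR _ _ Ag0 Ru; have := rE _ Rgu; rewrite /= g0'K // => e.
  by rewrite /a /= e (isoF_cj fusF isoa0) ?bE ?cj_comp //; apply: fR.
have FaS : F R S a.
  apply: (fusion_restrict fusF sS isoa.1) => //; first exact: sR.1.
  by move=> u Ru; apply: sQ.2; apply: aR.
have aI := fusion_injective fusF FaS; have aM := fusion_mul fusF FaS.
have eaR : a @` R = Q := isoF_image fusF isoa.
have [|at_ Fat atE] := satII R a FaS; first by rewrite eaR.
have {}atE u : R u -> at_ u = a u by move=> Ru; apply: atE; apply: mem_set.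
set N := N_phi S R a in Fat.
have NR : R `<=` N.
  by apply: (sub_N_phi sR _ aM aI); rewrite eaR.
set NP := normalizer (C x) P.
have sNP : subgroup NP := subgroup_normalizer P sC.
have NPS : NP `<=` S by move=> g [[]].
(* The automorphisms induced by [NP] have classes in [U], which [a] transports into
   $\operatorname{Aut}_S(Q)$. *)
have NPN : NP `<=` N.
  move=> g ng; apply/(N_phiP _ _ aI); split; first exact: normalizer_adjoin.
  have Vg : aut_conj P (cj g) by exists g.
  have [|m nm mE] := key (cj g) (VA _ Vg).
    by apply: (fintype.subsetP VU); apply/out_imageP; exists (cj g).
  by exists m; rewrite ?eaR.
set x1 := a x; set P1 := a @` P.
have x1p : x1 ^+ p = 1.
  by rewrite -(multiplicative_onX p sR.1 aM Rx) xp (multiplicative_on1 sR.1 aM).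
have [a' isoa' [a'K aK']] := isoF_sym isoa.
have Qx1 : Q x1 := aR _ Rx.
have cx1 : conj_elts S F x1 x.
  by have := fusion_conj_elts p_pr tS fusF isoa'.1 Qx1 x1p; rewrite a'K.
have [ga Fga gax] := conj_elts_extend p_pr tS fusF satF cx1 fcx.
have sP1 : subgroup_of (C x1) P1.
  split.
    by apply: (subgroup_image sP.1) => u v /PR Ru /PR Rv; apply: aM.
  move=> _ [u Pu <-]; have Ru := PR _ Pu; split; first exact: (fusion_map fusF FaS).
  by move=> _ ->; have [_ cu] := sP.2 _ Pu; rewrite -!aM // cu.
set M := normalizer (C x1) P1.
have sM : subgroup M := subgroup_normalizer P1 (subgroup_C tS x1).
have MS : M `<=` S by move=> g [[]].
have atNP g : NP g -> M (at_ g).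
  move=> ng; have Ng := NPN _ ng; split.
    split; first exact: (fusion_map fusF Fat).
    have Nx := NR x Rx; move=> _ ->; rewrite /x1 -(atE x Rx).
    by have [[_ cg] _] := ng; rewrite -!(fusion_mul fusF Fat) // cg.
  have PN : P `<=` N by move=> u /PR/NR.
  have eP : at_ @` P = P1 by apply: eq_imagel => u Pu; exact: (atE u (PR u Pu)).
  have [_] := fusion_normalizer fusF Fat sP.1 PN Ng (normalizer_C_sub ng).
  by rewrite eP.
have [leNM eNM] := fusion_order_le p_pr tS fusF Fat sNP NPN (conj sM MS) atNP.
have [sP2 isoga] := fusion_sub_iso tS fusF Fga sP1.1 sP1.2.
(* [ga] embeds [M] in the normalizer of a $C_{\mathcal F}(x)$-conjugate of [P], and [P] is fully
   normalized there. Hence [at_] maps [NP] onto [M]. *)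
have leMN : toral_order_le p M NP.
  have Fk : F R S (ga \o a).
    have R1C : Q `<=` C x1.
      move=> q Qq; split; first exact: sQ.2.
      move=> _ ->; rewrite -[q]aK' //; have Ra' := fusion_map fusF isoa'.1 Qq.
      have [_ /(_ x erefl) cu] := (adjoin_sub_C tS Sx sP).2 _ Ra'.
      by rewrite /x1 -!aM // cu.
    have [_ isoq] := fusion_sub_iso tS fusF Fga sQ.1 R1C.
    have Fc := fusion_comp fusF isoa.1 isoq.1.
    apply: (fusion_restrict fusF sS Fc) => //; first exact: sR.1.
    by move=> u Ru; apply: (fusion_cod fusF Fc).2; apply: (fusion_map fusF Fc).
  have isoG := C_fusion_factor p_pr tS fusF Sx xp sP Fk gax.
  apply: toral_order_le_trans (fnP _ (ex_intro _ _ isoG)).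
  have sP2' := fusion_cod fusG isoG.1.
  have MC : M `<=` C x1 by move=> g [].
  apply: (fusion_order_le p_pr tS fusF Fga sM MC _ _).1.
    by split; [exact: (subgroup_normalizer _ sC)|move=> g [[]]].
  move=> g ng; split; first exact: (fusion_map fusF Fga (MC _ ng)).
  have [_] := fusion_normalizer fusF Fga sP1.1 sP1.2 (MC _ ng) (normalizer_C_sub ng).
  by rewrite -(image_comp a ga).
have {}eNM := eNM leMN.
(* An automorphism from [U] is transported to $c_m$ with $m$ fixing $x_1$ and normalizing $P_1$, so
   $m\in M$ is the image of some $n\in$ [NP], and $c_n$ is the given automorphism. *)
have UV : U \subset VG.
  apply/fintype.subsetP => t tU.
  have /out_imageP[f Lf ef] := fintype.subsetP UL _ tU.
  have [Af fx fP] := Lf; rewrite -ef in tU.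
  have [m nm mE] := key f Af tU.
  have Mm : M m.
    split.
      split; first exact: (normalizer_sub nm).
      by move=> _ ->; apply/cj_fixP; rewrite -mE // fx.
    apply/seteqP; split=> [_ [_ [u Pu <-] <-]|_ [u Pu <-]].
      by rewrite -mE; [exists (f u) => //; rewrite -fP; exists u|exact: PR].
    move: Pu; rewrite -{1}fP => -[v Pv <-].
    by exists (a v); [exists v|rewrite mE //; apply: PR].
  rewrite -eNM in Mm; have [n nn en] := Mm.
  apply/out_imageP; exists f => //; exists n => // u Ru.
  have nnR := normalizer_adjoin sP nn.
  have Rnu : R (cj n u) := normalizer_cj nnR Ru.
  apply: aI => //; first exact: fR.
  rewrite mE // -en -(atE u) // -(atE (cj n u)) //.
  apply/esym/(multiplicative_on_cj (fusion_domS fusF Fat) (fusion_mul fusF Fat)); [exact: NPN|exact: NR].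
have sylV : p.-Sylow(LG) VG.
  have eUV : U :=: VG by apply/eqP; rewrite finset.eqEsubset UV VU.
  by move: sylU; rewrite /pHall eUV.
(* $C_S(Q)$ lies in [M], the image of [NP], so the inverse of [at_] embeds it in $C_S(R)$. *)
have fcR : toral_order_le p (centralizer S Q) (centralizer S R).
  have CM : centralizer S Q `<=` M.
    move=> g [Sg cg]; split; first by split=> // _ ->; apply: cg.
    have cgP : centralizer S P1 g.
      by split=> // _ [u Pu <-]; apply: (cg _ (aR _ (PR _ Pu))).
    exact: (centralizer_normalizer cgP).2.
  rewrite -eNM in CM.
  have [_ isoN] := fusion_sub_iso tS fusF Fat sNP NPN.
  have [b isob [bK _]] := isoF_sym isoN.
  apply: (fusion_order_le p_pr tS fusF isob.1 (subgroup_centralizer Q sS) CM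
    (subgroup_of_centralizer tS R) _).1.
  move=> _ /[dup] /CM[n nn <-] [_ cn]; rewrite bK //; split; first exact: NPS.
  move=> u Ru; have Nn := NPN _ nn; have Nu := NR _ Ru; have sN := fusion_domS fusF Fat.
  apply: (fusion_injective fusF Fat); [exact: (subgroupM sN)|exact: (subgroupM sN)|].
  by rewrite !(fusion_mul fusF Fat) // (atE u) // cn //; apply: aR.
have [finG cG] := OutG_card sP (finsub _ LA).
have cS := OutC_card sP (finsub _ VA).
split=> //.
  move=> P' isoP; have [k isok] := isoP.
  have [h [isoh _ _]] := isoF_adjoin p_pr tS fusF Sx xp isok.
  rewrite !(centralizer_adjoin p_pr xp) //; last exact: (fusion_cod fusG isok.1).
  apply: toral_order_le_trans fcR; apply: fcQ; exists (h \o a').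
  exact: (isoF_comp fusF isoa' isoh).
have [_ pV' idxV] := and3P sylV.
split.
- exact: (OutS_OutF (discrete_p_toral_C p_pr tS x) fusG sP).
- by rewrite cS -cV.
- by rewrite cG cS -cL -cV divgS.
Qed.

Lemma C_fusion_saturated : saturated p (C x) G.
Proof.
split; first exact: C_fusion_saturation_I.
  exact: (C_fusion_saturation_II p_pr tS fusF satF fcx).
exact: (C_fusion_saturation_III p_pr tS fusF satF fcx).
Qed.

End FixedElement.
End CentralizerSylow.

Theorem proposition2p9 (p : nat) (gT : groupType) (S : set gT)
    (F : hom_family gT) :
  prime p -> discrete_p_toral p S -> fusion_system S F ->
  saturated p S F <->
  (* (a) *)
  (forall (P : nat -> set gT) (phi : gT -> gT),
      (forall n, subgroup_of S (P n)) ->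
      (forall n, (P n `<=` P n.+1)%classic) ->
      homomorphism (\bigcup_n P n)%classic S phi ->
      (forall n, F (P n) S phi) ->
      F (\bigcup_n P n)%classic S phi) /\
  (* (b) *)
  (exists X : set gT,
      [/\ (forall x, X x -> S x /\ has_order x p),
          (forall x, S x -> has_order x p ->
             exists2 y, X y & conj_elts S F x y),
          (forall x y, conj_elts S F x y -> X y ->
             exists2 rho,
               F (centralizer S [set x]%classic)
                 (centralizer S [set y]%classic) rho
               & rho x = y)
        & (forall x, X x ->
             fusion_system (centralizer S [set x]%classic) (C_fusion S F x) /\
             saturated p (centralizer S [set x]%classic) (C_fusion S F x))]).
Proof.
move=> p_pr tS fusF; split=> [satF|[satIII [X [XS X_repr X_extend X_sat]]]].
  split; first by have [] := satF.
  exists (fully_centralized_elt p S F); split.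
  - by move=> x [].
  - by move=> x; apply: fully_centralized_conj.
  - by move=> x y; apply: conj_elts_extend.
  move=> x fcx; have [Sx [_ xp _] _] := fcx.
  by split; [exact: (C_fusion_system p_pr tS)|exact: C_fusion_saturated].
have {}X_sat x : X x -> saturated p (centralizer S [set x]) (C_fusion S F x).
  by move=> /X_sat[].
split=> //.
- exact: (saturation_I_of_centralizers p_pr tS fusF XS X_repr X_extend X_sat).
- exact: (saturation_II_of_centralizers p_pr tS fusF X_repr X_extend X_sat).
Qed.
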